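(* For given initial data there is a time $T_0>0$ such that for all $h>0$ small enough the time-delayed approximate solutions $\eta^{(h)}$ satisfy $$\sup_{(t,x)\in[0,T_0]\times[0,\ell]}|\eta_2^{(h)}(t,x)|\le\frac{\ell}{2}-\frac12\Big(\frac{\ell}{2}-\sup_{x\in[0,\ell]}|(\eta_0)_2(x)|\Big).$$ In particular there is no collision of the solid with $\partial\Omega$ on $[0,T_0]$, even after sending $h\to0$ (the same bound holds for limits of $\eta^{(h)}$).
   Context: Fix $\ell>0$, $\Omega=(0,\ell)\times(-\ell/2,\ell/2)$, constants $c_1,c_2,\lambda_0,\rho_\pm,\mu_\pm,\rho_s>0$, $\alpha>1$, and $$\mathcal{E}_K(\eta)=\int_0^\ell\Big(\tfrac{c_1}{2}|\partial_x\eta_1-1|^2+\tfrac{1}{|\partial_x\eta_1|^{2\alpha}}+\tfrac{\lambda_0}{2}|\partial_{xx}\eta_1|^2+\tfrac{c_2}{2}|\partial_{xx}\eta_2|^2\Big)dx,$$ $\langle\mathcal{L}_\Gamma(\eta),\xi\rangle=\frac{d}{d\epsilon}\big|_{\epsilon=0}\mathcal{E}_K(\eta+\epsilon\xi)$, $\mathcal{H}=\{\eta\in H^2((0,\ell);\mathbb{R}^2):\eta(0)=(0,0),\eta(\ell)=(\ell,0),\partial_x\eta(0)=\partial_x\eta(\ell)=(1,0)\}$, $\varepsilon(u)=\frac12(\nabla u+\nabla u^\top)$. Data: $\eta_0\in\mathcal{H}\cap H^3$ with $\mathcal{E}_K(\eta_0)<\infty$, $\sup|(\eta_0)_2|<\ell/2$;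 $u_0\in L^2(\Omega;\mathbb{R}^2)$, $\eta^*\in L^2((0,\ell);\mathbb{R}^2)$, $f\in L^2([0,T]\times\Omega;\mathbb{R}^2)$; a regularization parameter $0<\delta_0\le1$. Time-delayed approximate solution on $[0,T]$ (obtained by concatenating solutions on intervals of length $h$): a triple $(\eta^{(h)},u^{(h)},\Phi^{(h)})$ with $\eta^{(h)}(t)\in\mathcal{H}\cap H^3$, $\eta^{(h)}(0)=\eta_0$, $u^{(h)}\in L^2(0,T;H^1_0\cap H^3(\Omega;\mathbb{R}^2))$, $\nabla\cdot u^{(h)}=0$, $\partial_t\eta^{(h)}=u^{(h)}\circ\eta^{(h)}$; $\Phi^{(h)}(t):\Omega\to\Omega$ volume-preserving homeomorphisms with $\Phi^{(h)}(0)=\mathrm{id}$, $\partial_t\Phi^{(h)}=u^{(h)}\circ\Phi^{(h)}$, mapping $\Omega^{(h)}_\pm(0)$ onto $\Omega^{(h)}_\pm(t)$, the upper/lower components of $\Omega\setminus\eta^{(h)}(t,(0,\ell))$. Put $\rho^{(h)}=\rho_\pm$, $\mu^{(h)}=\mu_\pm$ on $\Omega_\pm^{(h)}(t)$ and $\Phi^{(h)}_s(t)=\Phi^{(h)}(t+s)\circ\Phi^{(h)}(t)^{-1}$. For a.e. $t\in[0,T]$ and all $(\xi,q)\in (H^2_0\cap H^3)((0,\ell);\mathbb{R}^2)\times(H^1_0\cap H^3)(\Omega;\mathbb{R}^2)$ with $\nabla\cdot q=0$ and $\xi=q\circ\eta^{(h)}(t)$, $$\langle\mathcal{L}_\Gamma(\eta^{(h)}),\xi\rangle+\rho_s\int_0^\ell\tfrac{\partial_t\eta^{(h)}(t)-\partial_t\eta^{(h)}(t-h)}{h}\cdot\xi\,dx+\sqrt{\delta_0}\int_0^\ell\partial_x^3\eta^{(h)}\cdot\partial_x^3\xi\,dx+\int_\Omega\mu^{(h)}\varepsilon(u^{(h)})\cdot\nabla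 q\,dz+\delta_0\int_\Omega\nabla\Delta u^{(h)}\cdot\nabla\Delta q\,dz$$ $$+\int_\Omega\tfrac{(\rho^{(h)}u^{(h)})(t)-(\rho^{(h)}u^{(h)})(t-h)\circ\Phi^{(h)}_{-h}(t)}{h}\cdot q\,dz=\int_\Omega\rho^{(h)}f\cdot q\,dz,$$ where for $t<0$ one sets $\partial_t\eta^{(h)}(t)=\eta^*$, $u^{(h)}(t)=u_0$, $\rho^{(h)}(t)=\rho^{(h)}(0)$, $\Phi^{(h)}(t)=\mathrm{id}$. Moreover, on each interval $[jh,(j+1)h]$ the energy inequality of the construction holds: for a.e. $t_0$ in it, $$\mathcal{E}_K(\eta^{(h)}(t_0))+\tfrac{\sqrt{\delta_0}}{2}\|\partial_x^3\eta^{(h)}(t_0)\|^2_{L^2(0,\ell)}+\int_{jh}^{t_0}\!\int_\Omega\big(\mu^{(h)}|\varepsilon(u^{(h)})|^2+\delta_0|\nabla\Delta u^{(h)}|^2\big)dz\,dt+\tfrac1h\int_{jh}^{t_0}\Big(\int_0^\ell\tfrac{\rho_s}{2}|\partial_t\eta^{(h)}|^2dx+\int_\Omega\tfrac{\rho^{(h)}}{2}|u^{(h)}|^2dz\Big)dt$$ $$\le\mathcal{E}_K(\eta^{(h)}(jh))+\tfrac{\sqrt{\delta_0}}{2}\|\partial_x^3\eta^{(h)}(jh)\|^2_{L^2(0,\ell)}+\tfrac1h\int_{jh-h}^{t_0-h}\Big(\int_0^\ell\tfrac{\rho_s}{2}|\partial_t\eta^{(h)}|^2dx+\int_\Omega\tfrac{\rho^{(h)}}{2}|u^{(h)}|^2dz\Big)dt+\int_{jh}^{t_0}\!\int_\Omega\rho^{(h)}f\cdot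 u^{(h)}dz\,dt .$$ *)

(* Defs.v *)
From HB Require Import structures.
From mathcomp Require Import all_boot all_order all_algebra.
From mathcomp Require Import all_classical all_reals all_analysis.

Set Implicit Arguments.
Unset Strict Implicit.
Unset Printing Implicit Defensive.

Import Order.TTheory GRing.Theory Num.Theory.
Import numFieldNormedType.Exports.

Local Open Scope classical_set_scope.
Local Open Scope ring_scope.

Notation leb R := (@lebesgue_measure R).
Notation leb2 R := ((leb R \x leb R)%E).

Section PlaneVectors.
Variable R : realType.

(* Points of the plane and plane vectors are pairs; their components, and the
   directions of partial derivatives, are indexed by [bool] (false = first). *)
Definition pcomp (i : bool) (v : R * R) : R := if i then v.2 else v.1.
Definition dir (i : bool) : R * R := if i then (0, 1) else (1, 0).
Definition dot (v w : R * R) : R := v.1 * w.1 + v.2 * w.2.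

(* Euclidean; the norm the library puts on R * R is the sup norm. *)
Definition sqnorm (v : R * R) : R := dot v v.

End PlaneVectors.

Section LebesgueSpaces.
Variable R : realType.

Definition L2 d (X : measurableType d) (mu : {measure set X -> \bar R})
    (D : set X) (f : X -> R) : Prop :=
  measurable_fun D f /\ (\int[mu]_(x in D) (f x ^+ 2)%:E < +oo)%E.

(* L^2((0,T) x D); the joint integral is written as an iterated one. *)
Definition L2_time d (X : measurableType d) (mu : {measure set X -> \bar R})
    (T : R) (D : set X) (f : R -> X -> R) : Prop :=
  measurable_fun [set p : measurableTypeR R * X | 0 < p.1 < T /\ D p.2]
    (fun p : measurableTypeR R * X => f p.1 p.2) /\
  (\int[leb R]_(t in `]0%R, T[%classic)
     \int[mu]_(x in D) (f t x ^+ 2)%:E < +oo)%E.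

End LebesgueSpaces.

(* Sobolev spaces on the interval (0,l).  [wder l n f] is a choice of the n-th
   weak derivative of f; it is unique up to null sets and it is 0 when f has
   no square integrable weak derivative of order n. *)
Section SobolevInterval.
Variables (R : realType) (l : R).

Definition test_fun1 (phi : R -> R) : Prop :=
  (forall n x, derivable (derive1n n phi) x 1) /\
  exists a b, [/\ 0 < a, b < l & forall x, ~ (a <= x <= b) -> phi x = 0].

Definition is_wder (n : nat) (f g : R -> R) : Prop :=
  L2 (leb R) `]0, l[ g /\
  forall phi, test_fun1 phi ->
    \int[leb R]_(x in `]0, l[) (f x * derive1n n phi x) =
    (-1) ^+ n * \int[leb R]_(x in `]0, l[) (g x * phi x).

Definition wder (n : nat) (f : R -> R) : R -> R :=
  xget (fun=> 0) [set g | is_wder n f g].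

Definition Hk1 (k : nat) (f : R -> R) : Prop :=
  L2 (leb R) `]0, l[ f /\ forall n, (n <= k)%N -> exists g, is_wder n f g.

(* H^2_0((0,l)), the closure of the test functions in H^2. *)
Definition H20 (f : R -> R) : Prop :=
  Hk1 2 f /\
  forall e : R, 0 < e -> exists2 phi, test_fun1 phi &
    forall n, (n <= 2)%N ->
      (\int[leb R]_(x in `]0%R, l[) ((wder n f x - derive1n n phi x) ^+ 2)%:E
       < e%:E)%E.

Definition wderv (n : nat) (v : R -> R * R) (x : R) : R * R :=
  (wder n (fun y => (v y).1) x, wder n (fun y => (v y).2) x).

Definition Hk1v (k : nat) (v : R -> R * R) : Prop :=
  forall i, Hk1 k (fun x => pcomp i (v x)).

(* The class of admissible deformations.  Elements of H^2 are represented by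
   their continuous representative on [0,l], and the boundary values of the
   first derivative are those of its continuous representative. *)
Definition calH (eta : R -> R * R) : Prop :=
  [/\ Hk1v 2 eta, {within `[0, l], continuous eta},
      eta 0 = (0, 0), eta l = (l, 0) &
      exists deta : R -> R * R,
        [/\ {within `[0, l], continuous deta},
            forall i, is_wder 1 (fun x => pcomp i (eta x))
                                (fun x => pcomp i (deta x)),
            deta 0 = (1, 0) & deta l = (1, 0)]].

End SobolevInterval.

(* Sobolev spaces on a plane domain.  Partial derivatives are indexed by words
   in the two directions, [partial s phi] being the iterated derivative. *)
Section SobolevPlane.
Variables (R : realType) (Om : set (R * R)).

Definition partial (s : seq bool) (phi : R * R -> R) : R * R -> R :=
  foldr (fun i g => 'D_(dir R i) g) phi s.

Definition test_fun2 (phi : R * R -> R) : Prop :=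
  (forall s z, differentiable (partial s phi) z) /\
  exists K : set (R * R),
    [/\ compact K, K `<=` Om & forall z, ~ K z -> phi z = 0].

Definition is_wpartial (s : seq bool) (f g : R * R -> R) : Prop :=
  L2 (leb2 R) Om g /\
  forall phi, test_fun2 phi ->
    \int[leb2 R]_(z in Om) (f z * partial s phi z) =
    (-1) ^+ size s * \int[leb2 R]_(z in Om) (g z * phi z).

Definition wpartial (s : seq bool) (f : R * R -> R) : R * R -> R :=
  xget (fun=> 0) [set g | is_wpartial s f g].

Definition Hk2 (k : nat) (f : R * R -> R) : Prop :=
  L2 (leb2 R) Om f /\
  forall s, (size s <= k)%N -> exists g, is_wpartial s f g.

(* H^1_0, the closure of the test functions in H^1. *)
Definition H10 (f : R * R -> R) : Prop :=
  Hk2 1 f /\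
  forall e : R, 0 < e -> exists2 phi, test_fun2 phi &
    forall s, (size s <= 1)%N ->
      (\int[leb2 R]_(z in Om) ((wpartial s f z - partial s phi z) ^+ 2)%:E
       < e%:E)%E.

(* (H^1_0 /\ H^3)(Om; R^2), functions being represented by their continuous
   representative on the closure (H^3 embeds in C^0 in dimension two), so
   that compositions such as q o eta are meaningful. *)
Definition H10_H3 (v : R * R -> R * R) : Prop :=
  {within closure Om, continuous v} /\
  forall i, H10 (fun z => pcomp i (v z)) /\ Hk2 3 (fun z => pcomp i (v z)).

(* L^2(0,T; (H^1_0 /\ H^3)(Om; R^2)): Bochner measurability and square
   integrability amount to those of all the weak derivatives up to order 3 as
   functions on (0,T) x Om. *)
Definition L2_H10_H3 (T : R) (u : R -> R * R -> R * R) : Prop :=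
  (\forall t \ae leb R, 0 < t < T -> H10_H3 (u t)) /\
  forall i,
    L2_time (leb2 R) T Om (fun t z => pcomp i (u t z)) /\
    forall s, (size s <= 3)%N ->
      exists2 g : R -> R * R -> R, L2_time (leb2 R) T Om g &
        \forall t \ae leb R,
          0 < t < T -> is_wpartial s (fun z => pcomp i (u t z)) (g t).

(* (grad v)_{ij} = d_j v_i *)
Definition grad (v : R * R -> R * R) (i j : bool) (z : R * R) : R :=
  wpartial [:: j] (fun y => pcomp i (v y)) z.

Definition divergence (v : R * R -> R * R) (z : R * R) : R :=
  \sum_(i : bool) grad v i i z.

Definition divergence_free (v : R * R -> R * R) : Prop :=
  \forall z \ae leb2 R, Om z -> divergence v z = 0.

Definition sym_grad (v : R * R -> R * R) (i j : bool) (z : R * R) : R :=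
  (grad v i j z + grad v j i z) / 2.

(* (grad Delta v)_{ij} = sum_k d_j d_k d_k v_i *)
Definition grad_lap (v : R * R -> R * R) (i j : bool) (z : R * R) : R :=
  \sum_(k : bool) wpartial [:: j; k; k] (fun y => pcomp i (v y)) z.

End SobolevPlane.

Definition mdot (R : realType) (A B : bool -> bool -> R) : R :=
  \sum_(i : bool) \sum_(j : bool) A i j * B i j.

Section Domain.
Variables (R : realType) (l : R).

Definition Omega : set (R * R) :=
  [set z | 0 < z.1 < l /\ - (l / 2) < z.2 < l / 2].

Definition bdOmega : set (R * R) := closure Omega `\` interior Omega.

Definition curve (eta : R -> R * R) : set (R * R) := eta @` `]0, l[%classic.

(* The connected component(s) of Omega minus the curve that touch the open
   side of Omega at height y: upper component for y = l/2, lower component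
   for y = -l/2. *)
Definition side_component (y : R) (eta : R -> R * R) : set (R * R) :=
  [set z | (Omega `\` curve eta) z /\
    exists w : R * R,
      [/\ closure (connected_component (Omega `\` curve eta) z) w,
          0 < w.1 < l & w.2 = y]].

Definition Omega_plus : (R -> R * R) -> set (R * R) := side_component (l / 2).
Definition Omega_minus : (R -> R * R) -> set (R * R) :=
  side_component (- (l / 2)).

(* Equal to a above and to b below the curve (and 0 on the null set left). *)
Definition phase (a b : R) (eta : R -> R * R) (z : R * R) : R :=
  a * \1_(Omega_plus eta) z + b * \1_(Omega_minus eta) z.

End Domain.

Record params (R : realType) := Params {
  len : R; c1 : R; c2 : R; lambda0 : R;
  rho_plus : R; rho_minus : R; mu_plus : R; mu_minus : R;
  rho_s : R; alpha : R }.

Definition params_ok (R : realType) (P : params R) : Prop :=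
  [/\ 0 < len P, [/\ 0 < c1 P, 0 < c2 P & 0 < lambda0 P],
      [/\ 0 < rho_plus P, 0 < rho_minus P, 0 < mu_plus P & 0 < mu_minus P],
      0 < rho_s P & 1 < alpha P].

Section Energy.
Variables (R : realType) (P : params R).
Local Notation l := (len P).

(* 1 / |d|^{2 alpha}, equal to +oo at d = 0. *)
Definition compression (d : R) : \bar R :=
  if d == 0 then +oo%E else ((`|d| `^ (2 * alpha P))^-1)%:E.

Definition E_K (eta : R -> R * R) : \bar R :=
  (\int[leb R]_(x in `]0%R, l[)
     ((c1 P / 2 * `|(wderv l 1 eta x).1 - 1| ^+ 2)%:E
      + compression (wderv l 1 eta x).1
      + (lambda0 P / 2 * `|(wderv l 2 eta x).1| ^+ 2)%:E
      + (c2 P / 2 * `|(wderv l 2 eta x).2| ^+ 2)%:E))%E.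

(* E_K is finite near the arguments at which L_Gamma is used below, so that
   [fine] does not hide an infinite value. *)
Definition L_Gamma (eta xi : R -> R * R) : R :=
  derive1 (fun e : R => fine (E_K (fun x => eta x + e *: xi x))) 0.

End Energy.

(* y is an absolutely continuous curve on [0,T] with derivative v a.e., i.e.
   y(t) = y(0) + int_0^t v. *)
Definition has_velocity (R : realType) (T : R) (y v : R -> R * R) : Prop :=
  forall i,
    (leb R).-integrable `[0, T] (fun s => (pcomp i (v s))%:E) /\
    forall t, 0 <= t <= T ->
      pcomp i (y t) = pcomp i (y 0) + \int[leb R]_(s in `[0, t]) pcomp i (v s).

Record data (R : realType) := Data {
  eta0 : R -> R * R;
  u0 : R * R -> R * R;
  eta_star : R -> R * R;
  force : R -> R * R -> R * R }.

Definition sup_abs_second (R : realType) (l : R) (eta : R -> R * R) : R :=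
  sup [set `|(eta x).2| | x in `[0, l]].

Definition data_ok (R : realType) (P : params R) (T : R) (D : data R) : Prop :=
  [/\ [/\ calH (len P) (eta0 D), Hk1v (len P) 3 (eta0 D),
          (E_K P (eta0 D) < +oo)%E &
          sup_abs_second (len P) (eta0 D) < len P / 2],
      forall i, L2 (leb2 R) (Omega (len P)) (fun z => pcomp i (u0 D z)),
      forall i, L2 (leb R) `]0, len P[ (fun x => pcomp i (eta_star D x)) &
      forall i, L2_time (leb2 R) T (Omega (len P))
                  (fun t z => pcomp i (force D t z))].

Section ApproximateSolutions.
Variables (R : realType) (P : params R) (T : R) (D : data R) (delta0 h : R).
Variables (eta : R -> R -> R * R) (u Phi : R -> R * R -> R * R).

(* [veta] stands for the time derivative of eta. *)
Variable veta : R -> R -> R * R.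

Local Notation l := (len P).
Local Notation Om := (Omega (len P)).

Definition veta_ext (t x : R) : R * R := if t < 0 then eta_star D x else veta t x.
Definition u_ext (t : R) (z : R * R) : R * R := if t < 0 then u0 D z else u t z.
Definition Phi_ext (t : R) (z : R * R) : R * R := if t < 0 then z else Phi t z.
Definition rho (t : R) : R * R -> R :=
  phase l (rho_plus P) (rho_minus P) (if t < 0 then eta 0 else eta t).
Definition mu (t : R) : R * R -> R :=
  phase l (mu_plus P) (mu_minus P) (eta t).

Definition Phi_shift (s t : R) (z : R * R) : R * R :=
  Phi_ext (t + s) ('pinv_id Om (Phi_ext t) z).

Definition volume_preserving (F : R * R -> R * R) : Prop :=
  forall A, measurable A -> A `<=` Om ->
    (leb2 R (Om `&` F @^-1` A) = leb2 R A)%E.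

Definition homeomorphism (F : R * R -> R * R) : Prop :=
  [/\ set_bij Om Om F, {within Om, continuous F} &
      {within Om, continuous ('pinv_id Om F)}].

Definition weak_equation (t : R) : Prop :=
  forall (xi : R -> R * R) (q : R * R -> R * R),
    (forall i, H20 l (fun x => pcomp i (xi x))) -> Hk1v l 3 xi ->
    H10_H3 Om q -> divergence_free Om q ->
    (forall x, 0 <= x <= l -> xi x = q (eta t x)) ->
    L_Gamma P (eta t) xi
    + rho_s P * \int[leb R]_(x in `]0, l[)
        dot (h^-1 *: (veta_ext t x - veta_ext (t - h) x)) (xi x)
    + Num.sqrt delta0 * \int[leb R]_(x in `]0, l[)
        dot (wderv l 3 (eta t) x) (wderv l 3 xi x)
    + \int[leb2 R]_(z in Om)
        (mu t z * mdot (fun i j => sym_grad Om (u t) i j z)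
                       (fun i j => grad Om q i j z))
    + delta0 * \int[leb2 R]_(z in Om)
        mdot (fun i j => grad_lap Om (u t) i j z)
             (fun i j => grad_lap Om q i j z)
    + \int[leb2 R]_(z in Om)
        dot (h^-1 *: (rho t z *: u_ext t z
                      - (let w := Phi_shift (- h) t z in
                         rho (t - h) w *: u_ext (t - h) w))) (q z)
    = \int[leb2 R]_(z in Om) (rho t z * dot (force D t z) (q z)).

Definition elastic_energy (t : R) : \bar R :=
  (E_K P (eta t)
   + (Num.sqrt delta0 / 2)%:E
     * \int[leb R]_(x in `]0%R, l[) (sqnorm (wderv l 3 (eta t) x))%:E)%E.

Definition dissipation (t : R) : \bar R :=
  (\int[leb2 R]_(z in Om)
     (mu t z * mdot (fun i j => sym_grad Om (u t) i j z)
                    (fun i j => sym_grad Om (u t) i j z)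
      + delta0 * mdot (fun i j => grad_lap Om (u t) i j z)
                      (fun i j => grad_lap Om (u t) i j z))%:E)%E.

Definition kinetic (t : R) : \bar R :=
  (\int[leb R]_(x in `]0%R, l[) (rho_s P / 2 * sqnorm (veta_ext t x))%:E
   + \int[leb2 R]_(z in Om) (rho t z / 2 * sqnorm (u_ext t z))%:E)%E.

Definition force_power (t : R) : \bar R :=
  (\int[leb2 R]_(z in Om) (rho t z * dot (force D t z) (u t z))%:E)%E.

Definition energy_inequality (j : nat) (t0 : R) : Prop :=
  (elastic_energy t0
   + \int[leb R]_(t in `[(j%:R * h)%R, t0]) dissipation t
   + (h^-1)%:E * \int[leb R]_(t in `[(j%:R * h)%R, t0]) kinetic t
   <= elastic_energy (j%:R * h)%R
      + (h^-1)%:E * \int[leb R]_(t in `[(j%:R * h - h)%R, (t0 - h)%R]) kinetic t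
      + \int[leb R]_(t in `[(j%:R * h)%R, t0]) force_power t)%E.

Record approx_solution_with_velocity : Prop := {
  sol_eta_space : forall t, 0 <= t <= T -> calH l (eta t) /\ Hk1v l 3 (eta t);
  sol_eta_init : forall x, 0 <= x <= l -> eta 0 x = eta0 D x;
  sol_u_space : L2_H10_H3 Om T u;
  sol_u_div : \forall t \ae leb R, 0 < t < T -> divergence_free Om (u t);
  sol_veta_L2 : forall i,
    L2_time (leb R) T `]0, l[ (fun t x => pcomp i (veta t x));
  sol_veta : forall x, 0 <= x <= l ->
    has_velocity T (fun t => eta t x) (fun t => veta t x);
  sol_eta_transport : \forall t \ae leb R, 0 < t < T ->
    forall x, 0 <= x <= l -> veta t x = u t (eta t x);
  sol_Phi_homeo : forall t, 0 <= t <= T ->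
    homeomorphism (Phi t) /\ volume_preserving (Phi t);
  sol_Phi_init : forall z, Om z -> Phi 0 z = z;
  sol_Phi_flow : forall z, Om z ->
    has_velocity T (fun t => Phi t z) (fun t => u t (Phi t z));
  sol_Phi_phases : forall t, 0 <= t <= T ->
    Phi t @` Omega_plus l (eta 0) = Omega_plus l (eta t) /\
    Phi t @` Omega_minus l (eta 0) = Omega_minus l (eta t);
  sol_weak : \forall t \ae leb R, 0 <= t <= T -> weak_equation t;
  sol_energy : forall j : nat, \forall t0 \ae leb R,
    j%:R * h <= t0 <= j.+1%:R * h -> 0 <= t0 <= T -> energy_inequality j t0 }.

End ApproximateSolutions.

Definition approx_solution (R : realType) (P : params R) (T : R) (D : data R)
    (delta0 h : R) (eta : R -> R -> R * R) (u Phi : R -> R * R -> R * R) : Prop :=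
  exists veta, approx_solution_with_velocity P T D delta0 h eta u Phi veta.

Definition height_bound (R : realType) (l : R) (eta0 : R -> R * R) : R :=
  l / 2 - 2^-1 * (l / 2 - sup_abs_second l eta0).

Definition height_sup (R : realType) (T0 l : R) (eta : R -> R -> R * R) : \bar R :=
  ereal_sup [set y : \bar R | exists t x : R,
    [/\ 0 <= t <= T0, 0 <= x <= l & y = `|(eta t x).2|%:E]].

Definition weak_L2_cvg (R : realType) (T0 l : R)
    (etas : nat -> R -> R -> R * R) (eta : R -> R -> R * R) : Prop :=
  let Q := `]0, T0[%classic `*` `]0, l[%classic in
  (forall i, L2 (leb2 R) Q (fun p => pcomp i (eta p.1 p.2))) /\
  forall (i : bool) (g : R * R -> R), L2 (leb2 R) Q g ->
    (fun n => \int[leb2 R]_(p in Q) (pcomp i (etas n p.1 p.2) * g p))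
      @ \oo --> \int[leb2 R]_(p in Q) (pcomp i (eta p.1 p.2) * g p).

(* Main.v *)
Require Import Defs.
From HB Require Import structures.
From mathcomp Require Import all_boot all_order all_algebra.
From mathcomp Require Import all_classical all_reals all_analysis.
From mathcomp Require Import measurable_realfun.
From mathcomp Require Import ring lra.

Set Implicit Arguments.
Unset Strict Implicit.
Unset Printing Implicit Defensive.

Import Order.TTheory GRing.Theory Num.Theory.
Import numFieldNormedType.Exports.

Local Open Scope classical_set_scope.
Local Open Scope ring_scope.
Local Notation pcomp := Defs.pcomp.

(* The discrete energy inequalities telescope.  Off the curve, which is a null
   set, the density is bounded below, so that the force only costs a multiple of
   the kinetic energy, which is absorbed when the time interval is short.  The
   inequality, given for almost every time only, is extended to the nodes t = j h
   by lower semicontinuity of the elastic energy.  Hence, uniformly in h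
   and delta0, the elastic energy is bounded and the square integral of the
   velocity of the solid over [0, T0] is at most A * T0.

   A bound on E_K bounds the slope of the deformation and, the exponent 2 alpha
   being larger than 2, keeps its first component away from 0.  So the height is
   uniformly Lipschitz: a displacement larger than m at one point is at least
   m / 2 on an interval of fixed length, which contradicts the bound on the
   velocity when T0 is small.  The first component of the slope being at least
   k > 0, the abscissa stays between k x and l - k (l - x), so that interior
   points of the solid remain in the open set Omega.  These are convex conditions
   with constants independent of h, hence they survive weak limits. *)

(** * Smooth cut-off functions *)

(** The energies are functions of time that are not known to be measurable, so the estimates on them
    rest on the monotonicity of integrals of nonnegative functions; where additivity in time is
    needed, they are compared with measurable functions built from the L^2 norms of the velocities
    and of the force. The semicontinuity at the nodes avoids weak compactness: pointwise convergence
    of the deformations, together with bounds on their derivatives, gives convergence of the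
    integrals of these derivatives over intervals; averaging over small windows turns it into
    pointwise convergence, and Fatou's lemma applies, for windows of fixed size and then of size
    tending to 0. The integrals over intervals are reached by testing weak derivatives with smooth
    plateaus, whence the explicit cut-off functions. The weight sqrt(delta0) / 2 of the third-order
    term enters this semicontinuity for each fixed delta0 only; the uniform constants see it through
    the initial energy, where it is at most 1 / 2. *)

Section SmoothStep.
Variable R : realType.
Implicit Types (f g : R -> R) (n : nat).

(** Differentiability n times, with the derivatives as explicit witnesses: closure under sums,
    products and inverses is then an induction on n, without formulas for iterated derivatives. *)
Fixpoint Cn n f : Prop :=
  if n is m.+1 then exists2 g : R -> R, (forall x, is_derive x (1 : R) f (g x)) & Cn m g
  else True.

Lemma CnS n f : Cn n.+1 f -> Cn n f.
Proof.
elim: n f => [//|n IH] f [g fg gC].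
by exists g => //; exact: IH.
Qed.

Lemma Cn_cst n (c : R) : Cn n (fun=> c).
Proof.
elim: n c => [//|n IH] c; exists (fun=> 0) => // x; exact: is_derive_cst.
Qed.

Lemma CnD n f g : Cn n f -> Cn n g -> Cn n (fun x => f x + g x).
Proof.
elim: n f g => [//|n IH] f g [f' ff' Cf'] [g' gg' Cg'].
by exists (fun x => f' x + g' x); [move=> x; exact: is_deriveD|exact: IH].
Qed.

Lemma CnM n f g : Cn n f -> Cn n g -> Cn n (fun x => f x * g x).
Proof.
elim: n f g => [//|n IH] f g Cf Cg.
have [f' ff' Cf'] := Cf; have [g' gg' Cg'] := Cg.
exists (fun x => f x * g' x + g x * f' x); first by move=> x; exact: is_deriveM.
by apply: CnD; apply: IH => //; exact: CnS.
Qed.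

Lemma CnV n f : (forall x, f x != 0) -> Cn n f -> Cn n (fun x => (f x)^-1).
Proof.
move=> f0; elim: n => [//|n IH] Cf; have [f' ff' Cf'] := Cf.
exists (fun x => - ((f x)^-1 * (f x)^-1) * f' x).
  move=> x; have := @is_deriveV R f x (f' x) 1 (f0 x) (ff' x).
  by rewrite /GRing.scale/= expr2 invfM.
have CV := IH (CnS Cf).
apply: CnM => //.
rewrite (_ : (fun x => _) = fun x => (-1) * ((f x)^-1 * (f x)^-1)).
  by apply: CnM; [exact: Cn_cst|exact: CnM].
by apply/funext => x; rewrite mulN1r.
Qed.

Lemma Cn_affine n f (a b : R) : Cn n f -> Cn n (fun x => f (a * x + b)).
Proof.
elim: n f => [//|n IH] f [f' ff' Cf'].
exists (fun x => f' (a * x + b) * a); last first.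
  by apply: CnM; [exact: IH|exact: Cn_cst].
move=> x.
have ax : is_derive x 1 (fun y : R => a * y + b) a.
  have := is_deriveD (is_deriveZ a (is_derive_id x (1 : R))) (is_derive_cst b x (1:R)).
  by rewrite addr0 /GRing.scale/= mulr1.
exact: (is_derive1_comp (ff' _) ax).
Qed.

Lemma Cn_derivable f : (forall n, Cn n f) ->
  forall n x, derivable (derive1n n f) x 1.
Proof.
move=> Cf n; have {Cf} : Cn n.+1 f by exact: Cf.
elim: n f => [|n IH] f [g fg Cg] x.
  by rewrite derive1n0; apply: ex_derive.
have -> : derive1n n.+1 f = derive1n n g.
  rewrite /derive1n iterSr; congr (iter _ _ _); apply/funext => y.
  by rewrite derive1E; exact: derive_val.
exact: IH.
Qed.

(* the derivative of [exp_inv n] is [exp_inv n.+2 - n exp_inv n.+1]. *)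
Definition exp_inv n (x : R) : R :=
  if 0 < x then x^-1 ^+ n * expR (- x^-1) else 0.

Lemma exp_inv_ge0 n x : 0 <= exp_inv n x.
Proof.
rewrite /exp_inv; case: ifPn => // x0.
by rewrite mulr_ge0 ?expR_ge0// exprn_ge0// invr_ge0 ltW.
Qed.

Lemma exp_inv_gt0 x : 0 < x -> 0 < exp_inv 0 x.
Proof. by move=> x0; rewrite /exp_inv x0 mul1r expR_gt0. Qed.

(** This is y^(n+2) <= (n+2)! e^y at y = 1/x. The factor x^2 makes the function differentiable at 0
    with derivative 0. *)
Lemma exp_inv_le n x : exp_inv n x <= (n.+2)`!%:R * x ^+ 2.
Proof.
rewrite /exp_inv; case: ifPn => x0; last by rewrite mulr_ge0// sqr_ge0.
have y0 : 0 < x^-1 by rewrite invr_gt0.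
have F0 : (0 : R) < (n.+2)`!%:R by rewrite ltr0n fact_gt0.
have H : x^-1 ^+ n.+2 <= (n.+2)`!%:R * expR x^-1.
  rewrite -ler_pdivrMl// mulrC; apply: le_trans (expR_ge1Dxn n.+1 (ltW y0)).
  by rewrite lerDr.
have -> : x^-1 ^+ n = x^-1 ^+ n.+2 * x ^+ 2.
  by rewrite -addn2 exprD -mulrA -exprMn mulVf ?gt_eqF// expr1n mulr1.
rewrite expRN ler_pdivrMr ?expR_gt0// [leRHS]mulrAC.
by rewrite ler_wpM2r// sqr_ge0.
Qed.

Lemma is_derive_exp_inv n x :
  is_derive x (1 : R) (exp_inv n) (- n%:R * exp_inv n.+1 x + exp_inv n.+2 x).
Proof.
have [x0|x0|<-] := ltgtP 0 x; last first.
- have -> : - n%:R * exp_inv n.+1 0 + exp_inv n.+2 0 = 0.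
    by rewrite /exp_inv ltxx mulr0 addr0.
  have F0 : (0 : R) < (n.+2)`!%:R by rewrite ltr0n fact_gt0.
  (* The difference quotient at the origin is at most (n+2)! |h|. *)
  have H : h^-1 *: ((exp_inv n \o shift 0) (h *: 1) - exp_inv n 0) @[h --> 0^']
             --> (0 : R).
    apply/cvgr0Pnorm_le => e e0; near=> h.
    have h0 : h != 0 by near: h; exact: nbhs_dnbhs_neq.
    rewrite /= addr0 {2}/exp_inv ltxx subr0 normrM normfV ger0_norm ?exp_inv_ge0//.
    rewrite ler_pdivrMl ?normr_gt0// [h *: 1]mulr1.
    rewrite (le_trans (exp_inv_le _ _))// -real_normK ?num_real//.
    rewrite expr2 mulrCA ler_wpM2l// -ler_pdivlMl//.
    by near: h; apply: dnbhs0_le; rewrite mulr_gt0 ?invr_gt0.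
  by apply: DeriveDef; [apply/cvg_ex; exists 0|apply/cvg_lim].
- have -> : - n%:R * exp_inv n.+1 x + exp_inv n.+2 x = 0.
    by rewrite /exp_inv !ltNge (ltW x0)/= mulr0 addr0.
  apply: (near_eq_is_derive (f := fun=> 0)).
    near=> y; rewrite /exp_inv ltNge ifN// negbK.
    by near: y; apply: lt_le_nbhsl.
- apply: (near_eq_is_derive (f := fun y : R => y^-1 ^+ n * expR (- y^-1))).
    near=> y; rewrite /exp_inv ifT//.
    by near: y; apply: lt_nbhsr.
  have xV : is_derive x (1 : R) (fun y : R => y^-1) (- x^-1 ^+ 2).
    have := @is_deriveV R id x 1 1; rewrite gt_eqF// => /(_ isT (is_derive_id _ _)).
    by rewrite /GRing.scale/= mulr1 exprVn.
  have xE : is_derive x (1 : R) (fun y : R => expR (- y^-1)) (expR (- x^-1) * x^-1 ^+ 2).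
    rewrite -[X in _ * X]opprK.
    exact: (is_derive1_comp (is_derive_expR _) (is_deriveN xV)).
  have := is_deriveM (is_deriveX n xV) xE.
  rewrite /exp_inv x0 /GRing.scale/= !fctE.
  set D := (D in is_derive x 1 _ D -> _); set D' := (D in _ -> is_derive x 1 _ D).
  suff -> : D = D' by [].
  rewrite {}/D {}/D'; case: n => [|n]; first by rewrite !mul0r mulr0 oppr0 mul0r addr0 add0r mul1r mulrC.
  by rewrite [n.+1.-1]/= !exprS; ring.
Unshelve. all: by end_near. Qed.

Lemma Cn_exp_inv n k : Cn n (exp_inv k).
Proof.
elim: n k => [//|n IH] k.
exists (fun x => - k%:R * exp_inv k.+1 x + exp_inv k.+2 x).
  by move=> x; exact: is_derive_exp_inv.
by apply: CnD => //; apply: CnM => //; exact: Cn_cst.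
Qed.

Lemma exp_inv_nondecreasing : {homo exp_inv 0 : x y / x <= y}.
Proof.
move=> x y xy; rewrite {1}/exp_inv; case: ifPn => [x0|_]; last exact: exp_inv_ge0.
have y0 := lt_le_trans x0 xy.
by rewrite /exp_inv y0 !mul1r ler_expR lerN2 lef_pV2.
Qed.

Let step_den (x : R) := exp_inv 0 x + exp_inv 0 (1 - x).

Let step_den_gt0 x : 0 < step_den x.
Proof.
rewrite /step_den; have [x0|x0] := ltP 0 x.
  by rewrite ltr_wpDr ?exp_inv_ge0 ?exp_inv_gt0.
by rewrite ltr_wpDl ?exp_inv_ge0 ?exp_inv_gt0// subr_gt0 (le_lt_trans x0).
Qed.

(** The classical smooth transition e(x) / (e(x) + e(1 - x)), where e(x) = exp(-1/x) for x > 0: the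
    two terms of the denominator never vanish together. *)
Definition step (x : R) : R := exp_inv 0 x / step_den x.

Lemma Cn_step n : Cn n step.
Proof.
apply: CnM; first exact: Cn_exp_inv.
apply: CnV; first by move=> x; rewrite gt_eqF// step_den_gt0.
apply: CnD; first exact: Cn_exp_inv.
rewrite (_ : (fun x => _) = (fun x => exp_inv 0 (-1 * x + 1))).
  by apply: Cn_affine; exact: Cn_exp_inv.
by apply/funext => x; rewrite mulN1r addrC.
Qed.

Lemma step_ge0 x : 0 <= step x.
Proof. by rewrite divr_ge0 ?exp_inv_ge0// ltW// step_den_gt0. Qed.

Lemma step_le1 x : step x <= 1.
Proof. by rewrite ler_pdivrMr ?step_den_gt0// mul1r lerDl exp_inv_ge0. Qed.

Lemma step0 x : x <= 0 -> step x = 0.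
Proof. by move=> x0; rewrite /step /exp_inv ltNge x0 mul0r. Qed.

Lemma step1 x : 1 <= x -> step x = 1.
Proof.
move=> x1; rewrite /step /step_den [X in _ + X]/exp_inv subr_gt0 ltNge x1 addr0.
by rewrite divff// gt_eqF// exp_inv_gt0// (lt_le_trans _ x1).
Qed.

Lemma step_nondecreasing : {homo step : x y / x <= y}.
Proof.
move=> x y xy; rewrite ler_pdivrMr ?step_den_gt0// mulrAC ler_pdivlMr ?step_den_gt0//.
rewrite !mulrDr [X in X + _ <= _]mulrC lerD2l ler_pM ?exp_inv_ge0//.
  exact: exp_inv_nondecreasing.
by apply: exp_inv_nondecreasing; rewrite lerD2l lerN2.
Qed.

End SmoothStep.

Section Bump.
Variable R : realType.

Lemma ndecr_derive1_ge0 (f : R -> R) x : {homo f : x y / x <= y} ->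
  derivable f x 1 -> 0 <= derive1 f x.
Proof.
move=> fnd df; rewrite derive1E; apply: limr_ge; first exact: df.
near=> h; rewrite /= [h *: 1]mulr1.
have h0 : h != 0 by near: h; exact: nbhs_dnbhs_neq.
have [h1|h1] := ltP 0 h.
  by rewrite mulr_ge0 ?invr_ge0 ?(ltW h1)// subr_ge0 fnd// lerDr ltW.
by rewrite mulr_le0 ?invr_le0// subr_le0 fnd// gerDr.
Unshelve. all: by end_near. Qed.

(** The transition takes place on [c, c + e]; as e tends to 0 its derivative approximates the Dirac
    mass at c. *)
Definition rise (c e x : R) : R := step ((x - c) / e).

Lemma Cn_rise n c e : Cn n (rise c e).
Proof.
rewrite (_ : rise c e = fun x => step (e^-1 * x + (- c / e))).
  by apply: Cn_affine; exact: Cn_step.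
by apply/funext => x; rewrite /rise; congr step; ring.
Qed.

Lemma derivable_rise c e x : derivable (rise c e) x 1.
Proof.
by have := @Cn_derivable _ (rise c e) (fun n => Cn_rise n c e) 0%N x; rewrite derive1n0.
Qed.

Lemma continuous_rise c e : continuous (rise c e).
Proof.
by move=> x; apply: differentiable_continuous; apply/derivable1_diffP/derivable_rise.
Qed.

Lemma continuous_derive_rise c e : continuous (derive1 (rise c e)).
Proof.
move=> x; apply: differentiable_continuous; apply/derivable1_diffP.
by have := @Cn_derivable _ (rise c e) (fun n => Cn_rise n c e) 1%N x; rewrite derive1n1.
Qed.

Lemma rise0 c e x : 0 < e -> x <= c -> rise c e x = 0.
Proof.
by move=> e0 xc; rewrite /rise step0// mulr_le0_ge0 ?subr_le0// invr_ge0 ltW.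
Qed.

Lemma rise1 c e x : 0 < e -> c + e <= x -> rise c e x = 1.
Proof. by move=> e0 xc; rewrite /rise step1// ler_pdivlMr// mul1r lerBrDl. Qed.

Lemma derive_rise_ge0 c e x : 0 < e -> 0 <= derive1 (rise c e) x.
Proof.
move=> e0; apply: ndecr_derive1_ge0; last exact: derivable_rise.
by move=> y z yz; apply: step_nondecreasing; rewrite ler_pM2r ?invr_gt0// lerD2r.
Qed.

Lemma derive_rise0 c e x : 0 < e -> ~ (c <= x <= c + e) -> derive1 (rise c e) x = 0.
Proof.
move=> e0 xc; rewrite derive1E.
have [xc'|cx] := ltP x c.
  rewrite (@near_eq_derive _ _ _ _ (cst (0 : R))) ?derive_cst//.
  by near=> y; rewrite rise0//; near: y; exact: lt_le_nbhsl.
have ex : c + e < x by rewrite ltNge; apply/negP => ?; apply: xc; rewrite cx.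
rewrite (@near_eq_derive _ _ _ _ (cst (1 : R))) ?derive_cst//.
by near=> y; rewrite rise1//; near: y; exact: lt_le_nbhsr.
Unshelve. all: by end_near. Qed.

Lemma integral_derive_rise (l c e : R) : 0 < e -> 0 <= c -> c + e <= l ->
  \int[leb R]_(x in `]0, l[) derive1 (rise c e) x = 1.
Proof.
move=> e0 c0 cel; have l0 : 0 < l by rewrite (lt_le_trans _ cel)// ltr_wpDl.
have := @continuous_FTC2 R (derive1 (rise c e)) (rise c e) 0 l l0.
have mrise : measurable_fun setT (derive1 (rise c e)).
  by apply: continuous_measurable_fun; exact: continuous_derive_rise.
rewrite /Rintegral -(integral_itv_bndoo true false)//; last first.
  exact/measurable_EFinP/measurable_funTS.
move=> ->//.
- by rewrite (@rise1 c e l)// (@rise0 c e 0)// oppe0 adde0.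
- by apply: continuous_subspaceT => x; exact: continuous_derive_rise.
- split.
  + by move=> x _; exact: derivable_rise.
  + by apply: cvg_at_right_filter; exact: continuous_rise.
  + by apply: cvg_at_left_filter; exact: continuous_rise.
Qed.

(* A smooth nonnegative function that is 1 on [a + 2 e, b - 2 e] and vanishes
   off [a + e, b - e]. *)
Definition plateau (a b e x : R) : R := rise (a + e) e x - rise (b - 2 * e) e x.

(** The margin e on both sides makes the support a compact subset of the open interval even when a =
    0 and b = l. *)
Lemma plateau_test_fun l a b e : 0 <= a -> b <= l -> 0 < e -> 4 * e <= b - a ->
  test_fun1 l (plateau a b e).
Proof.
move=> a0 bl e0 eab; split.
  apply: Cn_derivable => n; rewrite /plateau.
  rewrite (_ : (fun x => _) = (fun x => rise (a + e) e x + (-1) * rise (b - 2 * e) e x)).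
    by apply: CnD; [exact: Cn_rise|apply: CnM; [exact: Cn_cst|exact: Cn_rise]].
  by apply/funext => x; rewrite mulN1r.
exists (a + e), (b - e); split; [lra|lra|move=> x xab].
rewrite /plateau; have [xa|ax] := leP x (a + e).
  rewrite !rise0 ?subrr//; lra.
rewrite !rise1 ?subrr//; last by lra.
  by apply/negP => xb; apply: xab; lra.
Qed.

End Bump.

(** * Square integrable functions and weak derivatives *)

Section L2Facts.
Context d (X : measurableType d) (R : realType) (mu : {measure set X -> \bar R}).
Implicit Types (D E : set X) (f g h : X -> R).

Lemma L2_sqr_integrable D f : measurable D -> L2 mu D f ->
  mu.-integrable D (EFin \o (fun x => f x ^+ 2)).
Proof.
move=> mD [mf foo]; apply/integrableP; split.
  by apply/measurable_EFinP; exact: measurable_funX.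
by under eq_integral do rewrite /= ger0_norm ?sqr_ge0//.
Qed.

Lemma L2_mul_integrable D f g : measurable D -> L2 mu D f -> L2 mu D g ->
  mu.-integrable D (EFin \o (fun x => f x * g x)).
Proof.
move=> mD Lf Lg.
apply: (@le_integrable _ _ _ mu D mD _ (EFin \o (fun x => f x ^+ 2 + g x ^+ 2))).
- by apply/measurable_EFinP; apply: measurable_funM; [exact: Lf.1|exact: Lg.1].
- move=> x _; rewrite /= lee_fin normrM [leRHS]ger0_norm ?addr_ge0 ?sqr_ge0//.
  rewrite -[f x ^+ 2]real_normK ?num_real// -[g x ^+ 2]real_normK ?num_real//.
  have := sqr_ge0 (`|f x| - `|g x|); have := normr_ge0 (f x); have := normr_ge0 (g x).
  nra.
- apply: eq_integrable (integrableD mD (L2_sqr_integrable mD Lf) (L2_sqr_integrable mD Lg)) => //.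
Qed.

Lemma L2_cst D (c : R) : measurable D -> (mu D < +oo)%E -> L2 mu D (fun=> c).
Proof.
move=> mD Doo; split; first exact: measurable_cst.
rewrite integral_cst// -ge0_fin_numE ?mule_ge0 ?lee_fin ?sqr_ge0//.
by rewrite fin_numM// ge0_fin_numE.
Qed.

Lemma L2_integrable D f : measurable D -> (mu D < +oo)%E -> L2 mu D f ->
  mu.-integrable D (EFin \o f).
Proof.
move=> mD Doo Lf; have := L2_mul_integrable mD Lf (L2_cst 1 mD Doo).
by apply: eq_integrable => // x _; rewrite /= mulr1.
Qed.

Lemma L2_bounded D f (M : R) : measurable D -> (mu D < +oo)%E ->
  measurable_fun D f -> (forall x, D x -> `|f x| <= M) -> L2 mu D f.
Proof.
move=> mD Doo mf fM; split => //.
apply: (@le_lt_trans _ _ (\int[mu]_(x in D) (M ^+ 2)%:E)%E); last exact: (L2_cst M mD Doo).2.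
apply: ge0_le_integral => //.
- by move=> x _; rewrite lee_fin sqr_ge0.
- by apply/measurable_EFinP; exact: measurable_funX.
- move=> x Dx; rewrite lee_fin -real_normK ?num_real// lerXn2r ?nnegrE ?fM//.
  exact: le_trans (fM _ Dx).
Qed.

Lemma L2S D E f : measurable D -> measurable E -> E `<=` D -> L2 mu D f -> L2 mu E f.
Proof.
move=> mD mE ED [mf foo]; split; first exact: measurable_funS mf.
apply: le_lt_trans foo; apply: ge0_subset_integral => //.
  by apply/measurable_EFinP; exact: measurable_funX.
by move=> x _; rewrite lee_fin sqr_ge0.
Qed.

Lemma Rintegral_subset D E f : measurable D -> measurable E -> E `<=` D ->
  (forall x, D x -> 0 <= f x) -> mu.-integrable D (EFin \o f) ->
  \int[mu]_(x in E) f x <= \int[mu]_(x in D) f x.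
Proof.
move=> mD mE ED f0 intf; apply: fine_le.
- by apply: integrable_fin_num => //; exact: integrableS intf.
- exact: integrable_fin_num.
- by apply: ge0_subset_integral => //; exact: (measurable_int mu intf).
Qed.

(** The Cauchy-Schwarz inequality in the form |f g| <= (t f^2 + g^2 / t) / 2; the parameter t is
    kept free, so that no square roots appear in the estimates. *)
Lemma Rintegral_Young D f g (t : R) : measurable D -> L2 mu D f -> L2 mu D g ->
  0 < t ->
  `|\int[mu]_(x in D) (f x * g x)| <=
  (t * \int[mu]_(x in D) (f x ^+ 2) + t^-1 * \int[mu]_(x in D) (g x ^+ 2)) / 2.
Proof.
move=> mD Lf Lg t0.
apply: (le_trans (le_normr_Rintegral mD (L2_mul_integrable mD Lf Lg))).
have If := L2_sqr_integrable mD Lf; have Ig := L2_sqr_integrable mD Lg.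
have If' : mu.-integrable D (EFin \o (fun x => t / 2 * f x ^+ 2)).
  exact: eq_integrable (integrableZl mD (t / 2) If).
have Ig' : mu.-integrable D (EFin \o (fun x => t^-1 / 2 * g x ^+ 2)).
  exact: eq_integrable (integrableZl mD (t^-1 / 2) Ig).
have -> : (t * \int[mu]_(x in D) (f x ^+ 2) + t^-1 * \int[mu]_(x in D) (g x ^+ 2)) / 2
  = \int[mu]_(x in D) (t / 2 * f x ^+ 2 + t^-1 / 2 * g x ^+ 2).
  by rewrite RintegralD// !RintegralZl//; ring.
apply: le_Rintegral => //.
- exact: integrable_norm (L2_mul_integrable mD Lf Lg).
- exact: eq_integrable (integrableD mD If' Ig').
move=> x _; rewrite normrM.
rewrite -[f x ^+ 2]real_normK ?num_real// -[g x ^+ 2]real_normK ?num_real//.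
have : 0 <= t^-1 * (t * `|f x| - `|g x|) ^+ 2 by rewrite mulr_ge0 ?sqr_ge0// invr_ge0 ltW.
have -> : t^-1 * (t * `|f x| - `|g x|) ^+ 2 =
  t * `|f x| ^+ 2 - 2 * (`|f x| * `|g x|) + t^-1 * `|g x| ^+ 2.
  by field; rewrite gt_eqF.
by move: (t^-1) => s; lra.
Qed.

End L2Facts.

Section IntervalFacts.
Variable R : realType.
Implicit Types (f g : R -> R) (l a b c e t : R).

Lemma leb_oo a b : a <= b -> leb R `]a, b[ = (b - a)%:E.
Proof.
move=> ab; rewrite lebesgue_measure_itv/= lte_fin; case: ltP => // ba.
by rewrite (@le_anti _ _ a b) ?ab ?subrr.
Qed.

Lemma leb_oo_lty a b : (leb R `]a, b[ < +oo)%E.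
Proof. by rewrite lebesgue_measure_itv/=; case: ifP => // _; rewrite -EFinB ltry. Qed.

Lemma plateau_ge0 a b e x : 0 < e -> 4 * e <= b - a -> 0 <= plateau a b e x.
Proof.
move=> e0 eab; rewrite subr_ge0; apply: step_nondecreasing.
by rewrite ler_pM2r ?invr_gt0//; lra.
Qed.

Lemma plateau_le1 a b e x : plateau a b e x <= 1.
Proof. by rewrite lerBlDr ler_wpDr ?step_ge0// step_le1. Qed.

Lemma plateau_in a b e x : 0 < e -> a + 2 * e <= x <= b - 2 * e -> plateau a b e x = 1.
Proof. by move=> e0 xab; rewrite /plateau rise1 ?rise0 ?subr0//; lra. Qed.

Lemma plateau_out a b e x : 0 < e -> 4 * e <= b - a -> ~ (a < x < b) ->
  plateau a b e x = 0.
Proof.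
move=> e0 eab xab; rewrite /plateau; have [xa|ax] := leP x (a + e).
  by rewrite !rise0 ?subrr//; lra.
rewrite !rise1 ?subrr//; first by apply: contra_notT xab => ?; lra.
by apply: contra_notT xab => ?; lra.
Qed.

Lemma continuous_plateau a b e : continuous (plateau a b e).
Proof. by move=> x; apply: cvgB; exact: continuous_rise. Qed.

Lemma measurable_plateau a b e D : measurable_fun D (plateau a b e).
Proof. by apply: measurable_funTS; apply: continuous_measurable_fun; exact: continuous_plateau. Qed.

(** The plateau differs from the indicator of (a, b) by at most 1, and on a set of measure 4 e at
    most; Young's inequality then bounds the error. *)
Lemma plateau_approx l g a b e t : L2 (leb R) `]0, l[ g ->
  0 <= a -> b <= l -> 0 < e -> 4 * e <= b - a -> 0 < t ->
  `|\int[leb R]_(x in `]0, l[) (g x * plateau a b e x) - \int[leb R]_(x in `]a, b[) g x| <=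
  (t * \int[leb R]_(x in `]0, l[) (g x ^+ 2) + t^-1 * (4 * e)) / 2.
Proof.
move=> Lg a0 bl e0 eab t0; have ab : a <= b by lra.
have sab : `]a, b[ `<=` `]0%R, l[ by apply: subset_itvW; [exact: a0|exact: bl].
have Lgab : L2 (leb R) `]a, b[ g by apply: L2S Lg.
have Ig : (leb R).-integrable `]a, b[ (EFin \o g).
  by apply: L2_integrable => //; exact: leb_oo_lty.
have pl1 x : `|plateau a b e x| <= 1.
  by rewrite ger0_norm ?plateau_ge0// plateau_le1.
have pl1' x : `|plateau a b e x - 1| <= 1.
  rewrite distrC ger0_norm ?subr_ge0 ?plateau_le1// gerBl ?plateau_ge0//.
have Lp : L2 (leb R) `]a, b[ (plateau a b e).
  by apply: (@L2_bounded _ _ _ _ _ _ 1) => //; [exact: leb_oo_lty|exact: measurable_plateau].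
have Lp1 : L2 (leb R) `]a, b[ (fun x => plateau a b e x - 1).
  apply: (@L2_bounded _ _ _ _ _ _ 1) => //; first exact: leb_oo_lty.
  by apply: measurable_funB => //; exact: measurable_plateau.
have -> : \int[leb R]_(x in `]0, l[) (g x * plateau a b e x) =
          \int[leb R]_(x in `]a, b[) (g x * plateau a b e x).
  rewrite -[in RHS](setIidr sab) Rintegral_mkcondr; apply: eq_Rintegral => x _.
  rewrite patchE; case: ifPn => // xab; rewrite plateau_out ?mulr0// => ?.
  by move/negP: xab; apply; rewrite inE/= in_itv/=.
rewrite -RintegralB//; last exact: L2_mul_integrable.
under eq_Rintegral do rewrite -{2}[g _]mulr1 -mulrBr.
apply: (le_trans (Rintegral_Young _ Lgab Lp1 t0)) => //.
rewrite ler_pM2r// lerD//.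
  rewrite ler_pM2l//; apply: Rintegral_subset => //; first by move=> ? _; exact: sqr_ge0.
  exact: L2_sqr_integrable.
rewrite ler_pM2l ?invr_gt0//.
pose K := `[a + 2 * e, b - 2 * e]%classic.
have IK : (leb R).-integrable `]a, b[ (EFin \o (\1_K : R -> R)).
  apply: L2_integrable => //; first exact: leb_oo_lty.
  apply: (@L2_bounded _ _ _ _ _ _ 1) => //; first exact: leb_oo_lty.
    by apply: measurable_indic; exact: measurable_itv.
  by move=> x _; rewrite indicE; case: (_ \in _); rewrite ?normr1 ?normr0.
have I1 : (leb R).-integrable `]a, b[ (EFin \o (cst 1 : R -> R)).
  by apply: L2_integrable => //; [exact: leb_oo_lty|apply: L2_cst => //; exact: leb_oo_lty].
apply: (@le_trans _ _ (\int[leb R]_(x in `]a, b[) (1 - \1_K x))).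
  apply: le_Rintegral => //.
  - exact: L2_sqr_integrable.
  - exact: eq_integrable (integrableB _ I1 IK).
  move=> x _; rewrite indicE; have [|xK] := boolP (x \in K).
    by rewrite inE /K/= in_itv/= => xK; rewrite plateau_in// !subrr expr0n.
  by rewrite subr0 -real_normK ?num_real// exprn_ile1.
rewrite RintegralB// Rintegral_cst//= leb_oo// /Rintegral /K integral_indic//=.
rewrite setIidl; last by move=> x; rewrite /= !in_itv/=; lra.
rewrite lebesgue_measure_itv/= lte_fin; case: ifPn => [_|]/=; first lra.
by rewrite -leNgt; lra.
Qed.

End IntervalFacts.

(** * Weak derivatives, window averages and semicontinuity of quadratic integrals *)

Section WeakDerivatives.
Variable R : realType.
Implicit Types (f g : R -> R) (l a b c e t eps : R).

Lemma within_continuous_dist l f a eps : {within `[0, l], continuous f} ->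
  0 <= a <= l -> 0 < eps -> exists2 d : R, 0 < d &
  forall x : R, 0 <= x <= l -> `|x - a| < d -> `|f x - f a| <= eps.
Proof.
move=> /subspace_continuousP cf al eps0.
have /cvgrPdist_le/(_ _ eps0) := cf a al.
rewrite near_withinE => /nbhs_ballP[d /= d0 H]; exists d => // x xl xa.
by rewrite distrC; apply: H => //; rewrite /ball/= distrC.
Qed.

Lemma derive_plateau a b e x : derive1 (plateau a b e) x =
  derive1 (rise (a + e) e) x - derive1 (rise (b - 2 * e) e) x.
Proof.
by rewrite !derive1E [LHS]deriveB//; exact: derivable_rise.
Qed.

Lemma continuous_itv_integrable l f : {within `[0, l], continuous f} ->
  (leb R).-integrable `]0, l[ (EFin \o f).
Proof.
move=> cf.
have H : (leb R).-integrable (`[0, l]%classic : set R) (EFin \o f).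
  by apply: continuous_compact_integrable => //; exact: segment_compact.
by apply: integrableS H => //; exact: subset_itv_oo_cc.
Qed.

(** The derivative of the rise is nonnegative, has integral 1 and vanishes off [c, c + e]: the
    integral is a weighted mean of f over that interval. *)
Lemma rise_delta f l c e p eps : {within `[0, l], continuous f} ->
  0 < e -> 0 <= c -> c + e <= l -> 0 <= eps ->
  (forall x, c <= x <= c + e -> `|f x - p| <= eps) ->
  `|\int[leb R]_(x in `]0, l[) (f x * derive1 (rise c e) x) - p| <= eps.
Proof.
move=> cf e0 c0 cel eps0 fp.
have crho : {within `[0, l], continuous (derive1 (rise c e))}.
  by apply: continuous_subspaceT => x; exact: continuous_derive_rise.
have Irho := continuous_itv_integrable crho.
have Ifrho : (leb R).-integrable `]0, l[ (EFin \o (fun x => f x * derive1 (rise c e) x)).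
  by apply: continuous_itv_integrable; move=> x; apply: cvgM; [exact: cf|exact: crho].
have Iprho : (leb R).-integrable `]0, l[ (EFin \o (fun x => p * derive1 (rise c e) x)).
  exact: eq_integrable (integrableZl _ p Irho).
rewrite -[p in _ - p]mulr1 -(integral_derive_rise e0 c0 cel) -RintegralZl// -RintegralB//.
have I2 : (leb R).-integrable `]0, l[ (EFin \o (fun x => f x * derive1 (rise c e) x - p * derive1 (rise c e) x)).
  exact: eq_integrable (integrableB _ Ifrho Iprho).
apply: (le_trans (le_normr_Rintegral _ I2)) => //.
rewrite -[leRHS]mulr1 -(integral_derive_rise e0 c0 cel) -RintegralZl//.
apply: le_Rintegral => //.
- exact: integrable_norm I2.
- exact: eq_integrable (integrableZl _ eps Irho).
move=> x _; rewrite -mulrBl normrM [X in _ * X]ger0_norm ?derive_rise_ge0//.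
have [xc|xc] := pselect (c <= x <= c + e); last by rewrite derive_rise0// !mulr0.
by rewrite ler_wpM2r ?derive_rise_ge0// fp.
Qed.

(** Arithmetic of [wder1_ftc]: I is the integral of g against the plateau, J its integral over (a,
    b), and A, B are the weighted means of f near a and b. *)
Lemma telescope_le (I J A B x y e : R) : `|I - J| <= e -> `|A - x| <= e -> `|B - y| <= e ->
  A - B = - I -> `|y - x - J| <= 3 * e.
Proof. rewrite !ler_norml; lra. Qed.

(** The weak derivative is tested with a plateau over (a, b), whose derivative is a bump of mass 1
    near a minus a bump of mass 1 near b. As the edges get steeper, one side tends to f a - f b and
    the other to minus the integral of g. *)
Lemma wder1_ftc l f g a b : is_wder l 1 f g -> {within `[0, l], continuous f} ->
  0 <= a -> a <= b -> b <= l -> f b - f a = \int[leb R]_(x in `]a, b[) g x.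
Proof.
move=> [Lg fg] cf a0; rewrite le_eqVlt => /predU1P[<- _|ab bl].
  by rewrite subrr set_itv_ge ?Rintegral_set0// bnd_simp ltxx.
apply/eqP; rewrite -subr_eq0 -normr_le0; apply/ler_addgt0Pr => eps' eps'0; rewrite add0r.
pose eps := eps' / 3; have eps0 : 0 < eps by rewrite divr_gt0.
set G := \int[leb R]_(x in `]0, l[) (g x ^+ 2).
have G0 : 0 <= G by apply: Rintegral_ge0 => x _; exact: sqr_ge0.
have al : 0 <= a <= l by rewrite a0 (le_trans (ltW ab)).
have bl' : 0 <= b <= l by rewrite bl (le_trans a0 (ltW ab)).
have [d1 d10 fa] := within_continuous_dist cf al eps0.
have [d2 d20 fb] := within_continuous_dist cf bl' eps0.
(* This choice makes t G <= eps; then e is taken so small that 4 e / t <= eps as well. *)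
pose t := eps / (G + 1); have t0 : 0 < t by rewrite divr_gt0// ltr_wpDl.
have [e [e0 e1 e2 e3 e4]] : exists e : R, [/\ 0 < e, 4 * e <= b - a,
    4 * e <= eps * t, 2 * e < d1 & 2 * e < d2].
  near (0 : R)^'+ => e; exists e; split => //.
  - rewrite -ler_pdivlMl//; near: e; apply: nbhs_right_le; rewrite mulr_gt0// subr_gt0//.
  - rewrite -ler_pdivlMl//; near: e; apply: nbhs_right_le; by rewrite mulr_gt0 ?invr_gt0 // mulr_gt0.
  - rewrite -ltr_pdivlMl//; near: e; apply: nbhs_right_lt; by rewrite mulr_gt0 ?invr_gt0.
  - rewrite -ltr_pdivlMl//; near: e; apply: nbhs_right_lt; by rewrite mulr_gt0 ?invr_gt0.
have Q1 : `|\int[leb R]_(x in `]0, l[) (f x * derive1 (rise (a + e) e) x) - f a| <= eps.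
  apply: rise_delta => //; rewrite ?(ltW eps0)//; [lra|lra|move=> x xa].
  by apply: fa; [lra|rewrite ger0_norm; lra].
have Q2 : `|\int[leb R]_(x in `]0, l[) (f x * derive1 (rise (b - 2 * e) e) x) - f b| <= eps.
  apply: rise_delta => //; rewrite ?(ltW eps0)//; [lra|lra|move=> x xa].
  by apply: fb; [lra|rewrite ler0_norm; lra].
have := fg _ (plateau_test_fun a0 bl e0 e1).
rewrite derive1n1 expr1 mulN1r => fg1.
have := plateau_approx Lg a0 bl e0 e1 t0; rewrite -/G => P1.
have P2 : (t * G + t^-1 * (4 * e)) / 2 <= eps.
  have : t * G <= eps.
    by rewrite /t mulrAC ler_pdivrMr ?ltr_wpDl// ler_pM2l// lerDl.
  have : t^-1 * (4 * e) <= eps by rewrite ler_pdivrMl// [leRHS]mulrC.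
  lra.
move: fg1; under eq_Rintegral do rewrite derive_plateau mulrBr.
have Irho c : (leb R).-integrable `]0, l[ (EFin \o (fun x => f x * derive1 (rise c e) x)).
  apply: continuous_itv_integrable => x; apply: cvgM; first exact: cf.
  by apply: continuous_subspaceT => y; exact: continuous_derive_rise.
rewrite RintegralB// => fg1.
have -> : eps' = 3 * eps by rewrite /eps; field.
exact: telescope_le (le_trans P1 P2) Q1 Q2 fg1.
Unshelve. all: by end_near. Qed.
Lemma derive1_vanish (phi : R -> R) (a b x : R) :
  (forall x, ~ (a <= x <= b) -> phi x = 0) -> ~ (a <= x <= b) -> derive1 phi x = 0.
Proof.
move=> phi0 xab; rewrite derive1E (@near_eq_derive _ _ _ _ (cst (0 : R))) ?derive_cst//.
have [xa|ax] := ltP x a.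
  near=> y; apply: phi0; have : y < a by near: y; exact: lt_nbhsl.
  by move=> ?; lra.
have bx : b < x by rewrite ltNge; apply/negP => ?; apply: xab; rewrite ax.
near=> y; apply: phi0; have : b < y by near: y; exact: lt_nbhsr.
by move=> ?; lra.
Unshelve. all: by end_near. Qed.

Lemma test_fun1_derive l phi : test_fun1 l phi -> test_fun1 l (derive1 phi).
Proof.
move=> [dphi [a [b [a0 bl phi0]]]]; split.
  by move=> n x; have := dphi n.+1 x; rewrite /derive1n iterSr.
by exists a, b; split => // x; exact: derive1_vanish.
Qed.

(** The derivative of a test function is again one: the first-order relation tested with phi' meets
    the second-order relation tested with phi. *)
Lemma is_wder_trans l f d g : is_wder l 1 f d -> is_wder l 2 f g -> is_wder l 1 d g.
Proof.
move=> [_ fd] [Lg fg]; split => // phi tphi.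
have := fd _ (test_fun1_derive tphi).
have := fg _ tphi.
rewrite /= !expr1 mulN1r expr2 mulrNN !mul1r => <- ->.
by rewrite mulN1r opprK.
Qed.

Lemma wderP l n k f : Hk1 l k f -> (n <= k)%N -> is_wder l n f (wder l n f).
Proof. by move=> [_ H] /H [g fg]; rewrite /wder; apply: xgetPex; exists g. Qed.

(** The Steklov average of g extended by 0 outside (0, l); the divisor remains 2 r near the
    endpoints. *)
Definition avg l g (r x : R) : R :=
  (2 * r)^-1 * \int[leb R]_(y in `]x - r, x + r[) (g \_ `]0, l[) y.

Lemma avgE l g r x : avg l g r x = (2 * r)^-1 *
  \int[leb R]_(y in `]Order.max 0 (x - r), Order.min l (x + r)[) g y.
Proof.
rewrite /avg -Rintegral_mkcondr; congr (_ * Rintegral _ _ _).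
apply/seteqP; split => y /=; rewrite !in_itv/= gt_max lt_min.
  by move=> [/andP[-> ->] /andP[-> ->]].
by move=> /andP[/andP[-> ->] /andP[-> ->]].
Qed.

(** Lebesgue differentiation of the extension by 0, which is integrable on the line, along the balls
    of radius 1 / (n + 1). *)
Lemma avg_cvg l g : L2 (leb R) `]0, l[ g ->
  {ae leb R, forall x, 0 < x < l -> avg l g n.+1%:R^-1 x @[n --> \oo] --> g x}.
Proof.
move=> Lg.
have Ig : (leb R).-integrable `]0, l[ (EFin \o g).
  by apply: L2_integrable => //; exact: leb_oo_lty.
have It : (leb R).-integrable setT (EFin \o (g \_ `]0, l[)).
  by move: (Ig); rewrite integrable_mkcond//= (restrict_EFin g).
have loc : locally_integrable setT (g \_ `]0, l[).
  by apply: open_integrable_locally => //; exact: openT.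
pose rr (n : nat) : {posnum R} := PosNum (ltr0Sn R n : 0 < n.+1%:R).
have nice (x : R) : nicely_shrinking x (fun n => ball x (n.+1%:R^-1 : R)).
  split; first by move=> n; exact: measurable_ball.
  exists (1, fun n => ((rr n)%:num^-1)%:pos); split => //=.
  - exact: cvg_harmonic.
  - by move=> n.
  - by move=> n; rewrite mul1e.
have := lebesgue_differentiation loc.
apply: filterS; first exact: (ae_filter_ringOfSetsType (leb R)).
move=> x xpt x0l.
have := nice_lebesgue_differentiation nice loc xpt.
move/fine_cvgP => [_ /=].
rewrite patchE mem_set ?in_itv//=.
apply: cvg_trans; apply: near_eq_cvg; near=> n.
have n0 : (0 : R) <= n.+1%:R^-1 by rewrite invr_ge0.
rewrite /avg /= lebesgue_measure_ball// inver mulrn_eq0/= invr_eq0 pnatr_eq0/=.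
rewrite fineM//=; last first.
  apply: integrable_fin_num; first exact: measurable_ball.
  by apply: integrableS It => //; exact: measurable_ball.
by rewrite mulr_natl ball_itv.
Unshelve. all: by end_near. Qed.
(** The averages of g1 and g2, being integrals over intervals, coincide, and they converge almost
    everywhere to g1 and to g2. *)
Lemma ae_eq_of_itv_integral l g1 g2 :
  L2 (leb R) `]0, l[ g1 -> L2 (leb R) `]0, l[ g2 ->
  (forall a b, 0 <= a -> a <= b -> b <= l ->
    \int[leb R]_(x in `]a, b[) g1 x = \int[leb R]_(x in `]a, b[) g2 x) ->
  {ae leb R, forall x, 0 < x < l -> g1 x = g2 x}.
Proof.
move=> L1 L2' H; have := avg_cvg L1; have := avg_cvg L2'.
apply: filterS2; first exact: (ae_filter_ringOfSetsType (leb R)).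
move=> x c2 c1 xl; have {}c1 := c1 xl; have {}c2 := c2 xl.
apply: cvg_unique c1 _; first exact: Rhausdorff.
apply: cvg_trans c2; apply: near_eq_cvg; near=> n.
rewrite !avgE; congr (_ * _).
set a := Order.max _ _; set b := Order.min _ _.
have [ab|ba] := leP a b.
  by rewrite H// ?ge_min ?lexx// le_max lexx.
by rewrite set_itv_ge ?Rintegral_set0// bnd_simp -leNgt ltW.
Unshelve. all: by end_near. Qed.

Lemma wder1_unique l f d g : is_wder l 1 f d -> is_wder l 1 f g ->
  {within `[0, l], continuous f} -> {ae leb R, forall x, 0 < x < l -> d x = g x}.
Proof.
move=> fd fg cf; apply: ae_eq_of_itv_integral; [exact: fd.1|exact: fg.1|].
by move=> a b a0 ab bl; rewrite -(wder1_ftc fd)// -(wder1_ftc fg).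
Qed.

Lemma itv_integral_Young l g a b t : L2 (leb R) `]0, l[ g ->
  0 <= a -> a <= b -> b <= l -> 0 < t ->
  `|\int[leb R]_(x in `]a, b[) g x| <=
  (t * \int[leb R]_(x in `]0, l[) (g x ^+ 2) + t^-1 * (b - a)) / 2.
Proof.
move=> Lg a0 ab bl t0.
have sab : `]a, b[ `<=` `]0%R, l[ by apply: subset_itvW; [exact: a0|exact: bl].
have Lgab : L2 (leb R) `]a, b[ g by apply: L2S Lg.
have L1 : L2 (leb R) `]a, b[ (fun=> 1) by apply: L2_cst => //; exact: leb_oo_lty.
have := @Rintegral_Young _ _ _ (leb R) `]a, b[%classic g (fun=> 1) t (measurable_itv _) Lgab L1 t0.
under eq_Rintegral do rewrite mulr1.
move=> /le_trans; apply; rewrite ler_pM2r// lerD//.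
  rewrite ler_pM2l//; apply: Rintegral_subset => //; first by move=> ? _; exact: sqr_ge0.
  exact: L2_sqr_integrable.
by rewrite ler_pM2l ?invr_gt0// Rintegral_cst//= leb_oo//= expr1n mul1r.
Qed.

Lemma L2_patch l g a b : L2 (leb R) `]0, l[ g -> L2 (leb R) `]a, b[ (g \_ `]0, l[).
Proof.
move=> Lg; have m : measurable_fun setT (g \_ `]0, l[).
  by apply/(measurable_restrictT _ _).1 => //; exact: Lg.1.
apply: (@L2S _ _ _ _ setT) => //; split => //.
have := Lg.2; rewrite integral_mkcond; congr (_ < _)%E; apply: eq_integral => x _.
by rewrite !patchE; case: ifP => //; rewrite expr0n.
Qed.

(** Jensen's inequality, deduced from Young's inequality with parameter 1 / m, where m is the
    modulus of the average. *)
Lemma avg_sqr_le l g r x : L2 (leb R) `]0, l[ g -> 0 < r ->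
  avg l g r x ^+ 2 <=
  (2 * r)^-1 * \int[leb R]_(y in `]x - r, x + r[) ((g \_ `]0, l[) y ^+ 2).
Proof.
move=> Lg r0; set S := Rintegral _ _ _.
have S0 : 0 <= S by apply: Rintegral_ge0 => y _; exact: sqr_ge0.
have r20 : 0 < 2 * r by rewrite mulr_gt0.
rewrite ler_pdivlMl// -real_normK ?num_real//.
have [->|m0] := eqVneq (avg l g r x) 0; first by rewrite normr0 expr0n mulr0.
set m := `|avg l g r x|; have {}m0 : 0 < m by rewrite normr_gt0.
have Lp := @L2_patch l g (x - r) (x + r) Lg.
have L1 : L2 (leb R) `](x - r), (x + r)[ (fun=> 1) by apply: L2_cst => //; exact: leb_oo_lty.
have m'0 : 0 < m^-1 by rewrite invr_gt0.
have := @Rintegral_Young _ _ _ (leb R) _ _ (fun=> 1) m^-1 (measurable_itv _) Lp L1 m'0.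
under eq_Rintegral do rewrite mulr1.
rewrite -/S Rintegral_cst//= leb_oo/=; last by lra.
have -> : `|\int[leb R]_(y in `]x - r, x + r[) (g \_ `]0, l[) y| = 2 * r * m.
  by rewrite /m /avg normrM [`|(2 * r)^-1|]gtr0_norm ?invr_gt0// mulVKf// gt_eqF.
rewrite expr1n mul1r invrK => H.
have : m * (2 * r * m) <= m * ((m^-1 * S + m * (x + r - (x - r))) / 2).
  by rewrite ler_pM2l.
have -> : m * ((m^-1 * S + m * (x + r - (x - r))) / 2) = (S + m ^+ 2 * (2 * r)) / 2.
  by field; rewrite gt_eqF.
rewrite (_ : m * (2 * r * m) = 2 * r * m ^+ 2); last by ring.
by rewrite [m ^+ 2 * _]mulrC; lra.
Qed.
(** Tonelli's theorem on the strip |x - y| < r: each y lies in the windows whose centres form an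
    interval of length 2 r. *)
Lemma window_fubini (q : R -> R) (r : R) : measurable_fun setT q ->
  (forall x, 0 <= q x) -> 0 < r ->
  measurable_fun setT (fun x : R => \int[leb R]_(y in `](x - r)%R, (x + r)%R[) (q y)%:E)%E /\
  (\int[leb R]_x \int[leb R]_(y in `](x - r)%R, (x + r)%R[) (q y)%:E =
   (2 * r)%:E%E * \int[leb R]_y (q y)%:E)%E.
Proof.
move=> mq q0 r0.
pose S := [set p : R * R | `|p.1 - p.2| < r].
pose F (p : measurableTypeR R * measurableTypeR R) : \bar R := (\1_S p * q p.2)%:E.
have mS : measurable (S : set (measurableTypeR R * measurableTypeR R)).
  have mf : measurable_fun setT (fun p : measurableTypeR R * measurableTypeR R => `|p.1 - p.2|).
    apply: measurableT_comp => //; apply: measurable_funB => //.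
  rewrite (_ : S = setT `&` (fun p => `|p.1 - p.2|) @^-1` `]-oo, r[).
    by apply: mf => //.
  by rewrite setTI; apply/seteqP; split => p; rewrite /S/= in_itv/=.
have mF : measurable_fun setT F.
  apply/measurable_EFinP; apply: measurable_funM; first exact: measurable_indic.
  by apply: measurableT_comp.
have F0 p : (0 <= F p)%E by rewrite lee_fin mulr_ge0// indicE.
have Fx x : (\int[leb R]_(y in `](x - r)%R, (x + r)%R[) (q y)%:E = \int[leb R]_y F (x, y))%E.
  rewrite integral_mkcond; apply: eq_integral => y _.
  rewrite patchE /F indicE; have -> : ((x, y) \in S) = (y \in `](x - r), (x + r)[%classic).
    by apply/idP/idP; rewrite !inE /S/= in_itv/= ltr_distlC// => /andP[]; lra.
  by case: ifPn => _; rewrite ?mul1r ?mul0r.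
split.
  have -> : (fun x : R => (\int[leb R]_(y in `](x - r)%R, (x + r)%R[) (q y)%:E)%E) =
      fubini_F (leb R) F by apply/funext => x; rewrite /fubini_F; exact: Fx.
  exact: measurable_fun_fubini_tonelli_F.
under eq_integral => x _ do rewrite (Fx x).
rewrite fubini_tonelli//= -ge0_integralZl_EFin//; last 3 first.
- by move=> x _; rewrite lee_fin.
- exact/measurable_EFinP.
- by rewrite mulr_ge0// ltW.
apply: eq_integral => y _.
rewrite /F; under eq_integral do rewrite /= mulrC EFinM.
rewrite ge0_integralZl_EFin//; last first.
  apply/measurable_EFinP; exact: (measurableT_comp (measurable_indic mS)).
rewrite muleC; congr (_ * _)%E.
transitivity (\int[leb R]_x (\1_(`](y - r), (y + r)[%classic) x)%:E)%E.
  apply: eq_integral => x _; rewrite !indicE; congr (_%:R%:E); congr nat_of_bool.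
  by apply/idP/idP; rewrite !inE /S/= in_itv/= ltr_distlC// => /andP[]; lra.
rewrite integral_indic//= setIT leb_oo; last by lra.
by congr EFin; ring.
Qed.
(** [window_fubini] concerns nonnegative functions, so the extension of g is split into its positive
    and negative parts. *)
Lemma measurable_avg l g r : L2 (leb R) `]0, l[ g -> 0 < r ->
  measurable_fun setT (avg l g r).
Proof.
move=> Lg r0; have m : measurable_fun setT (g \_ `]0, l[).
  by apply/(measurable_restrictT _ _).1 => //; exact: Lg.1.
pose q1 (x : R) := Order.max ((g \_ `]0, l[) x) 0.
pose q2 (x : R) := Order.max (- (g \_ `]0, l[) x) 0.
have mq1 : measurable_fun setT q1 by apply: measurable_maxr.
have mq2 : measurable_fun setT q2.
  by apply: measurable_maxr => //; exact: measurableT_comp.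
have q10 x : 0 <= q1 x by rewrite le_max lexx orbT.
have q20 x : 0 <= q2 x by rewrite le_max lexx orbT.
have gq x : (g \_ `]0, l[) x = q1 x - q2 x.
  by rewrite /q1 /q2; case: (leP (_ x) 0) => ?; case: leP => ?; lra.
have q1g x : `|q1 x| <= `|(g \_ `]0, l[) x|.
  by rewrite ger0_norm// ge_max normr_ge0 ler_norm.
have q2g x : `|q2 x| <= `|(g \_ `]0, l[) x|.
  by rewrite ger0_norm// ge_max normr_ge0 -normrN ler_norm.
have Ig x : (leb R).-integrable `](x - r), (x + r)[ (EFin \o (g \_ `]0, l[)).
  by apply: L2_integrable; [exact: measurable_itv|exact: leb_oo_lty|exact: L2_patch].
have Iq1 x : (leb R).-integrable `](x - r), (x + r)[ (EFin \o q1).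
  by apply: le_integrable (Ig x) => //; [apply/measurable_EFinP; exact: measurable_funTS|move=> y _; rewrite lee_fin].
have Iq2 x : (leb R).-integrable `](x - r), (x + r)[ (EFin \o q2).
  by apply: le_integrable (Ig x) => //; [apply/measurable_EFinP; exact: measurable_funTS|move=> y _; rewrite lee_fin].
rewrite (_ : avg l g r = fun x => (2 * r)^-1 *
  (fine (\int[leb R]_(y in `](x - r)%R, (x + r)%R[) (q1 y)%:E)%E -
   fine (\int[leb R]_(y in `](x - r)%R, (x + r)%R[) (q2 y)%:E)%E)); last first.
  apply/funext => x; rewrite /avg; congr (_ * _).
  by under eq_Rintegral do rewrite gq; rewrite RintegralB.
apply: measurable_funM => //; apply: measurable_funB.
- apply: measurableT_comp => //; exact: (window_fubini mq1 q10 r0).1.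
- apply: measurableT_comp => //; exact: (window_fubini mq2 q20 r0).1.
Qed.

(** Averaging is a contraction of L^2: Jensen's inequality at each point, integrated by Tonelli's
    theorem. *)
Lemma integral_avg_sqr_le l g r : L2 (leb R) `]0, l[ g -> 0 < r ->
  (\int[leb R]_(x in `]0%R, l[) (avg l g r x ^+ 2)%:E <=
   \int[leb R]_(x in `]0%R, l[) (g x ^+ 2)%:E)%E.
Proof.
move=> Lg r0; have m : measurable_fun setT (g \_ `]0, l[).
  by apply/(measurable_restrictT _ _).1 => //; exact: Lg.1.
pose q (x : R) := (g \_ `]0, l[) x ^+ 2.
have mq : measurable_fun setT q by exact: measurable_funX.
have q0 x : 0 <= q x by exact: sqr_ge0.
have [mw Iw] := window_fubini mq q0 r0.
have r2 : 0 < (2 * r)^-1 by rewrite invr_gt0 mulr_gt0.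
have m2 : measurable_fun setT (fun x : R => (avg l g r x ^+ 2)%:E).
  by apply/measurable_EFinP; apply: measurable_funX; exact: measurable_avg.
apply: (@le_trans _ _ (\int[leb R]_x (avg l g r x ^+ 2)%:E)%E).
  by apply: ge0_subset_integral => //= x _; rewrite lee_fin sqr_ge0.
apply: (@le_trans _ _ (\int[leb R]_x ((2 * r)^-1%:E *
   \int[leb R]_(y in `](x - r)%R, (x + r)%R[) (q y)%:E))%E).
  apply: ge0_le_integral => //=.
  - by move=> x _; rewrite lee_fin sqr_ge0.
  - exact: measurable_funeM.
  move=> x _; have := avg_sqr_le x Lg r0; rewrite -lee_fin => /le_trans; apply.
  rewrite EFinM /Rintegral fineK//; apply: integrable_fin_num => //.
  apply: L2_sqr_integrable => //; exact: L2_patch.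
rewrite ge0_integralZl_EFin//=; last 2 first.
- by move=> x _; apply: integral_ge0 => y _; rewrite lee_fin.
- by rewrite ltW.
rewrite Iw muleA -EFinM mulVf ?mul1e; last by rewrite gt_eqF// mulr_gt0.
rewrite [leRHS]integral_mkcond le_eqVlt; apply/orP; left; apply/eqP.
apply: eq_integral => x _; rewrite /q !patchE; case: ifP => //=; by rewrite expr0n.
Qed.

Lemma Rintegral_dominated_cvg d (X : measurableType d) (mu : {measure set X -> \bar R})
    (D : set X) (hk : nat -> X -> R) (h H : X -> R) : measurable D ->
  (forall k, measurable_fun D (hk k)) -> measurable_fun D h ->
  (forall x, D x -> hk k x @[k --> \oo] --> h x) ->
  mu.-integrable D (EFin \o H) -> (forall k x, D x -> `|hk k x| <= H x) ->
  \int[mu]_(x in D) hk k x @[k --> \oo] --> \int[mu]_(x in D) h x.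
Proof.
move=> mD mk mh kh IH kH.
have [|||||Ih _ C] := @dominated_convergence _ _ _ mu D mD
   (fun k x => (hk k x)%:E) (EFin \o h) (EFin \o H).
- by move=> k; exact/measurable_EFinP.
- exact/measurable_EFinP.
- by apply: aeW => x Dx; apply: cvg_EFin; [exact: nearW|exact: kh].
- exact: IH.
- by apply: aeW => x k Dx; rewrite lee_fin kH.
by apply: fine_cvg; rewrite /Rintegral fineK//; exact: integrable_fin_num.
Qed.

Lemma test_derive_continuous l phi n : test_fun1 l phi -> continuous (derive1n n phi).
Proof.
by move=> [dphi _] x; apply: differentiable_continuous; apply/derivable1_diffP/dphi.
Qed.

(** Against a smooth plateau the derivatives move to the test function, and dominated convergence of
    the f_k suffices. The uniform L^2 bound on the g_k controls the replacement of the plateau by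
    the indicator of (a, b), uniformly in k. *)
Lemma itv_integral_cvg l n (fk gk : nat -> R -> R) f g (G M : R) a b :
  (forall k, is_wder l n (fk k) (gk k)) -> is_wder l n f g ->
  (forall k, {within `[0, l], continuous (fk k)}) ->
  {within `[0, l], continuous f} ->
  (forall k x, 0 < x < l -> `|fk k x| <= M) ->
  (forall x, 0 < x < l -> fk k x @[k --> \oo] --> f x) ->
  (forall k, \int[leb R]_(x in `]0, l[) (gk k x ^+ 2) <= G) ->
  0 <= a -> a <= b -> b <= l ->
  \int[leb R]_(x in `]a, b[) gk k x @[k --> \oo] --> \int[leb R]_(x in `]a, b[) g x.
Proof.
move=> fgk fg cfk cf fM ff gG a0 + bl; rewrite le_eqVlt => /predU1P[<-|ab].
  rewrite set_itv_ge ?bnd_simp ?ltxx// Rintegral_set0.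
  by under eq_fun do rewrite Rintegral_set0; exact: cvg_cst.
(* G' bounds the limit too, so that one plateau serves for all the g_k and for g. *)
set G' := Order.max G (\int[leb R]_(x in `]0, l[) (g x ^+ 2)).
have G'0 : 0 <= G'.
  by rewrite le_max; apply/orP; right; apply: Rintegral_ge0 => x _; exact: sqr_ge0.
apply/cvgrPdist_le => eps' eps'0.
pose eps := eps' / 3; have eps0 : 0 < eps by rewrite divr_gt0.
pose t := eps / (G' + 1); have t0 : 0 < t by rewrite divr_gt0// ltr_wpDl.
have [e [e0 e1 e2]] : exists e : R, [/\ 0 < e, 4 * e <= b - a & 4 * e <= eps * t].
  near (0 : R)^'+ => e; exists e; split => //.
  - by rewrite -ler_pdivlMl//; near: e; apply: nbhs_right_le; rewrite mulr_gt0// subr_gt0.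
  - by rewrite -ler_pdivlMl//; near: e; apply: nbhs_right_le; rewrite mulr_gt0 ?invr_gt0 // mulr_gt0.
have Peps G1 : G1 <= G' -> (t * G1 + t^-1 * (4 * e)) / 2 <= eps.
  move=> GG; have : t * G1 <= eps.
    rewrite /t mulrAC ler_pdivrMr ?ltr_wpDl// ler_pM2l// (le_trans GG)// lerDl//.
  have : t^-1 * (4 * e) <= eps by rewrite ler_pdivrMl// [leRHS]mulrC.
  lra.
have tphi := plateau_test_fun a0 bl e0 e1.
pose phi := plateau a b e.
have C : \int[leb R]_(x in `]0, l[) (gk k x * phi x) @[k --> \oo] -->
         \int[leb R]_(x in `]0, l[) (g x * phi x).
  have H (u v : R -> R) : is_wder l n u v -> \int[leb R]_(x in `]0, l[) (v x * phi x) =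
      (-1) ^+ n * \int[leb R]_(x in `]0, l[) (u x * derive1n n phi x).
    by move=> [_ /(_ _ tphi) ->]; rewrite mulrA -exprD addnn -signr_odd odd_double expr0 mul1r.
  under eq_fun do rewrite (H _ _ (fgk _)).
  rewrite (H _ _ fg); apply: cvgM; first exact: cvg_cst.
  have cphi : {within `[0, l], continuous (derive1n n phi)}.
    by apply: continuous_subspaceT => x; exact: test_derive_continuous tphi _.
  have mphi : measurable_fun `]0, l[ (derive1n n phi).
    by apply: measurable_funTS; apply: continuous_measurable_fun; exact: test_derive_continuous tphi.
  have mm (u : R -> R) : {within `[0, l], continuous u} -> measurable_fun `]0, l[ u.
    by move=> /continuous_itv_integrable/measurable_int/measurable_EFinP.
  apply: (@Rintegral_dominated_cvg _ _ (leb R) `]0, l[%classic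
    (fun k x => fk k x * derive1n n phi x) (fun x => f x * derive1n n phi x)
    (fun x => M * `|derive1n n phi x|)).
  - by [].
  - by move=> k; apply: measurable_funM; [exact: mm|].
  - by apply: measurable_funM; [exact: mm|].
  - by move=> x; rewrite /= in_itv/= => xl; apply: cvgM; [exact: ff|exact: cvg_cst].
  - exact: eq_integrable (integrableZl _ M (integrable_norm (continuous_itv_integrable cphi))).
  - by move=> k x; rewrite /= in_itv/= => xl; rewrite normrM ler_wpM2r// fM.
have A1 := plateau_approx fg.1 a0 bl e0 e1 t0.
have B1 : \int[leb R]_(x in `]0, l[) (g x ^+ 2) <= G' by rewrite le_max lexx orbT.
have {}A1 := le_trans A1 (Peps _ B1).
move/cvgrPdist_le : C => /(_ _ eps0); apply: filterS => k Ck.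
have A2 := plateau_approx (fgk k).1 a0 bl e0 e1 t0.
have B2 : \int[leb R]_(x in `]0, l[) (gk k x ^+ 2) <= G' by rewrite le_max gG.
have {}A2 := le_trans A2 (Peps _ B2).
have -> : eps' = 3 * eps by rewrite /eps; field.
move: A1 A2 Ck; rewrite -/phi !ler_norml.
by move=> /andP[? ?] /andP[? ?] /andP[? ?]; lra.
Unshelve. all: by end_near. Qed.

Lemma integral_fatou_le d (X : measurableType d) (mu : {measure set X -> \bar R})
    (D : set X) (uk : nat -> X -> R) (u : X -> R) (C : \bar R) : measurable D ->
  (forall k, measurable_fun D (uk k)) -> measurable_fun D u ->
  (forall k x, D x -> 0 <= uk k x) -> (forall x, D x -> 0 <= u x) ->
  {ae mu, forall x, D x -> uk k x @[k --> \oo] --> u x} ->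
  (forall k, \int[mu]_(x in D) (uk k x)%:E <= C)%E ->
  (\int[mu]_(x in D) (u x)%:E <= C)%E.
Proof.
move=> mD muk mu_ uk0 u0 uku ukC.
have mE k : measurable_fun D (fun x => (uk k x)%:E) by exact/measurable_EFinP.
apply: (@le_trans _ _ (\int[mu]_(x in D) limn_einf (fun k => (uk k x)%:E))%E).
  apply: ae_ge0_le_integral => //.
  - exact/measurable_EFinP.
  - move=> x Dx; rewrite limn_einf_lim; apply: lime_ge; first exact: is_cvg_einfs.
    by apply: nearW => n; apply/ereal_infP => _ [m _ <-]; rewrite lee_fin uk0.
  - rewrite /limn_einf; apply: measurableT_comp => //.
    by apply: measurable_fun_limn_esup => k; exact: measurableT_comp.
  move: uku; apply: filterS.
  move=> x H Dx; have : (uk k x)%:E @[k --> \oo] --> (u x)%:E.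
    by apply: cvg_EFin; [exact: nearW|exact: H].
  by move=> /cvg_limn_einf_sup[-> _].
apply: (le_trans (fatou _ _ _ _)) => //.
rewrite limn_einf_lim; apply: lime_le; first exact: is_cvg_einfs.
apply: nearW => n; apply: le_trans (ukC n).
by apply: ereal_inf_lbound; exists n => /=.
Qed.

(** For a fixed window size r the averages of the g_k converge pointwise, being integrals over
    intervals; Fatou's lemma and the contraction property of averaging bound the integral with
    averages of g. Then r tends to 0: Lebesgue differentiation and Fatou's lemma again. The p_k,
    whose dependence on the slope will not be convex, are supposed to converge pointwise. *)
Lemma quadratic_lsc l N (c : 'I_N -> R) (pk : nat -> R -> R) (p : R -> R)
    (gk : nat -> 'I_N -> R -> R) (g : 'I_N -> R -> R) (C : \bar R) :
  (forall i, 0 <= c i) ->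
  (forall k, measurable_fun `]0, l[ (pk k)) -> measurable_fun `]0, l[ p ->
  (forall k x, 0 < x < l -> 0 <= pk k x) -> (forall x, 0 < x < l -> 0 <= p x) ->
  (forall x, 0 < x < l -> pk k x @[k --> \oo] --> p x) ->
  (forall k i, L2 (leb R) `]0, l[ (gk k i)) -> (forall i, L2 (leb R) `]0, l[ (g i)) ->
  (forall i a b, 0 <= a -> a <= b -> b <= l ->
    \int[leb R]_(x in `]a, b[) gk k i x @[k --> \oo] --> \int[leb R]_(x in `]a, b[) g i x) ->
  (forall k, \int[leb R]_(x in `]0%R, l[) (pk k x + \sum_i c i * gk k i x ^+ 2)%:E <= C)%E ->
  (\int[leb R]_(x in `]0%R, l[) (p x + \sum_i c i * g i x ^+ 2)%:E <= C)%E.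
Proof.
move=> c0 mpk mp pk0 p0 pkp Lgk Lg gkg gC.
have mquad (v : 'I_N -> R -> R) : (forall i, measurable_fun `]0, l[ (v i)) ->
    measurable_fun `]0, l[ (fun x => \sum_i c i * v i x ^+ 2).
  move=> mv; apply: measurable_sum => i; apply: measurable_funM => //.
  exact: measurable_funX.
have quad0 (v : 'I_N -> R -> R) x : 0 <= \sum_i c i * v i x ^+ 2.
  by apply: sumr_ge0 => i _; rewrite mulr_ge0// sqr_ge0.
have mavg (v : R -> R) r : 0 < r -> L2 (leb R) `]0, l[ v ->
    measurable_fun `]0, l[ (avg l v r).
  by move=> r0 Lv; apply: measurable_funTS; exact: measurable_avg.
have step1 r : 0 < r ->
    (\int[leb R]_(x in `]0%R, l[) (p x + \sum_i c i * avg l (g i) r x ^+ 2)%:E <= C)%E.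
  move=> r0; apply: (@integral_fatou_le _ _ (leb R) `]0, l[%classic
      (fun k x => pk k x + \sum_i c i * avg l (gk k i) r x ^+ 2)
      (fun x => p x + \sum_i c i * avg l (g i) r x ^+ 2)) => //.
  - by move=> k; apply: measurable_funD; [exact: mpk|exact: (mquad (fun i => avg l (gk k i) r) (fun i => mavg _ _ r0 (Lgk k i)))].
  - by apply: measurable_funD; [exact: mp|exact: (mquad (fun i => avg l (g i) r) (fun i => mavg _ _ r0 (Lg i)))].
  - move=> k x; rewrite /= in_itv/= => xl.
    by apply: addr_ge0; [exact: pk0|exact: (quad0 (fun i => avg l (gk k i) r))].
  - move=> x; rewrite /= in_itv/= => xl.
    by apply: addr_ge0; [exact: p0|exact: (quad0 (fun i => avg l (g i) r))].
  - apply: aeW => x; rewrite /= in_itv/= => xl; apply: cvgD; first exact: pkp.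
    apply: cvg_big => [|i _]; first exact: add_continuous.
    apply: cvgM; first exact: cvg_cst.
    have H : avg l (gk k i) r x @[k --> \oo] --> avg l (g i) r x.
      under eq_fun do rewrite avgE.
      rewrite avgE; apply: cvgM; first exact: cvg_cst.
      set a := Order.max _ _; set b := Order.min _ _.
      have [ab|ba] := leP a b.
        by apply: gkg => //; rewrite ?ge_min ?lexx// le_max lexx.
      rewrite set_itv_ge ?bnd_simp -?leNgt ?(ltW ba)// Rintegral_set0.
      by under eq_fun do rewrite Rintegral_set0; exact: cvg_cst.
    by apply: cvgM.
  move=> k; apply: le_trans (gC k).
  under eq_integral do rewrite EFinD; under [leRHS]eq_integral do rewrite EFinD.
  rewrite !ge0_integralD//=; last 8 first.
  - by move=> x; rewrite in_itv/= => xl; rewrite lee_fin pk0.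
  - by apply/measurable_EFinP; exact: mpk.
  - by move=> x _; rewrite lee_fin; exact: (quad0 (gk k)).
  - by apply/measurable_EFinP; apply: (mquad (gk k)) => i; exact: (Lgk k i).1.
  - by move=> x; rewrite in_itv/= => xl; rewrite lee_fin pk0.
  - by apply/measurable_EFinP; exact: mpk.
  - by move=> x _; rewrite lee_fin; exact: (quad0 (fun i => avg l (gk k i) r)).
  - by apply/measurable_EFinP; apply: (mquad (fun i => avg l (gk k i) r)) => i; exact: mavg.
  apply: leeD => //.
  have E (v : 'I_N -> R -> R) : (forall i, measurable_fun `]0, l[ (v i)) ->
    (\int[leb R]_(x in `]0%R, l[) (\sum_i c i * v i x ^+ 2)%:E =
     \sum_i (c i)%:E * \int[leb R]_(x in `]0%R, l[) (v i x ^+ 2)%:E)%E.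
    move=> mv; under eq_integral do rewrite -sumEFin.
    rewrite ge0_integral_sum//=; last 2 first.
    - move=> i; apply/measurable_EFinP; apply: measurable_funM => //.
      by apply: measurable_funX; exact: mv.
    - by move=> i x _; rewrite lee_fin mulr_ge0// sqr_ge0.
    apply: eq_bigr => i _; under eq_integral do rewrite EFinM.
    rewrite ge0_integralZl_EFin//.
    - by move=> x _; rewrite lee_fin sqr_ge0.
    - by apply/measurable_EFinP; apply: measurable_funX; exact: mv.
  rewrite (E (fun i => avg l (gk k i) r)); last by move=> i; exact: mavg.
  rewrite (E (gk k)); last by move=> i; exact: (Lgk k i).1.
  apply: lee_sum => i _; apply: lee_wpmul2l; first by rewrite lee_fin.
  exact: integral_avg_sqr_le.
apply: (@integral_fatou_le _ _ (leb R) `]0, l[%classic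
    (fun k x => p x + \sum_i c i * avg l (g i) k.+1%:R^-1 x ^+ 2)
    (fun x => p x + \sum_i c i * g i x ^+ 2)) => //.
- move=> k; apply: measurable_funD; first exact: mp.
  by apply: (mquad (fun i => avg l (g i) k.+1%:R^-1)) => i; exact: mavg.
- by apply: measurable_funD; [exact: mp|apply: (mquad g) => i; exact: (Lg i).1].
- move=> k x; rewrite /= in_itv/= => xl.
  by apply: addr_ge0; [exact: p0|exact: (quad0 (fun i => avg l (g i) k.+1%:R^-1))].
- move=> x; rewrite /= in_itv/= => xl.
  by apply: addr_ge0; [exact: p0|exact: (quad0 g)].
- have : {ae leb R, forall x, forall i, 0 < x < l ->
      avg l (g i) n.+1%:R^-1 x @[n --> \oo] --> g i x}.
    (* The finitely many exceptional sets are collected through a quantifier over all natural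
       numbers, vacuous from N on. *)
    have : {ae leb R, forall x, forall n, forall i : 'I_N, nat_of_ord i = n -> 0 < x < l ->
        avg l (g i) n0.+1%:R^-1 x @[n0 --> \oo] --> g i x}.
      apply: ae_foralln => n; have [nN|nN] := ltnP n N.
        have := avg_cvg (Lg (Ordinal nN)).
        apply: filterS; first exact: (ae_filter_ringOfSetsType (leb R)).
        by move=> x H i iE; rewrite (_ : i = Ordinal nN)//; exact: val_inj.
      by apply: aeW => x i iE; move: nN; rewrite -iE leqNgt ltn_ord.
    apply: filterS; first exact: (ae_filter_ringOfSetsType (leb R)).
    by move=> x H i; exact: (H i).
  apply: filterS; first exact: (ae_filter_ringOfSetsType (leb R)).
  move=> x H; rewrite /= in_itv/= => xl; apply: cvgD; first exact: cvg_cst.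
  apply: cvg_big => [|i _]; first exact: add_continuous.
    apply: cvgM; first exact: cvg_cst.
  by apply: cvgM; exact: H.
- by move=> k; exact: step1.
Qed.

End WeakDerivatives.

(** * Deformations of bounded elastic energy *)

Section LowerIntegral.
Context d (X : measurableType d) (R : realType) (mu : {measure set X -> \bar R}).
Local Open Scope ereal_scope.
Import HBNNSimple.

(* The integral of a nonnegative function is defined as a supremum over simple
   functions, so that monotonicity holds without measurability. *)
Lemma ae_ge0_le_lower_integral (D : set X) (f g : X -> \bar R) : measurable D ->
  (forall x, D x -> 0 <= f x) -> (forall x, D x -> 0 <= g x) ->
  {ae mu, forall x, D x -> f x <= g x} ->
  \int[mu]_(x in D) f x <= \int[mu]_(x in D) g x.
Proof.
move=> mD f0 g0 [N [mN N0 fgN]].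
rewrite [leLHS]ge0_integralE//; apply: ge_ereal_sup => _ [h hf <-].
have mNc : measurable (~` N) by exact: measurableC.
rewrite -integralT_nnsfun (ge0_negligible_integral mN)//; last 2 first.
- by apply/measurable_EFinP.
- by move=> x _; rewrite lee_fin.
rewrite [leRHS]ge0_integralE//; apply: ereal_sup_ubound.
exists (proj_nnsfun h mNc).
  move=> x /=; rewrite /patch; have [xN|xN] := pselect (N x).
    by rewrite mindicE memNset ?mulr0//; case: ifPn => // xD; apply: g0; exact: set_mem.
  rewrite mindicE mem_set// mulr1 (le_trans (hf x))//.
  rewrite /patch; case: ifPn => // /set_mem xD.
  by have [|fgx] := pselect (D x -> f x <= g x); [exact|have := xN (fgN _ fgx)].
rewrite -integralT_nnsfun setTD [RHS]integral_mkcond; apply: eq_integral => x _.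
rewrite /= patchE mindicE; case: ifPn => xN; first by rewrite mulr1.
by rewrite mulr0.
Qed.

End LowerIntegral.

Section Slope.
Variables (R : realType) (P : params R).
Local Notation l := (len P).
Local Notation al := (alpha P).
Implicit Types (d g : R -> R) (x y t : R).

Lemma compression_ge0 x : (0 <= compression P x)%E.
Proof. by rewrite /compression; case: ifP => // _; rewrite lee_fin invr_ge0 powR_ge0. Qed.

Lemma compression_ge (x a : R) : 0 < a -> `|x| <= a -> 1 < al ->
  ((a `^ (2 * al))^-1%:E <= compression P x)%E.
Proof.
move=> a0 xa al1; rewrite /compression; case: ifPn => [_|x0]; first by rewrite leey.
rewrite lee_fin lef_pV2 ?posrE ?powR_gt0 ?normr_gt0//.
have al0 : 0 <= al := ltW (lt_trans ltr01 al1).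
by apply: ge0_ler_powR => //; rewrite ?nnegrE ?mulr_ge0 // ltW.
Qed.

(* If |d| <= k somewhere, the half-Hoelder bound on d keeps it below A k on an
   interval of length k ^ 2, which costs energy at least
   k ^ 2 / (A k) ^ (2 alpha); this is unbounded as k -> 0 because alpha > 1. *)
Lemma slope_lower_bound (C M : R) : 0 < l -> 1 < al -> 0 <= C -> 0 <= M ->
  exists2 k : R, 0 < k & forall d, {within `[0, l], continuous d} -> d 0 = 1 ->
    (forall x y t, 0 <= x -> x <= y -> y <= l -> 0 < t ->
       `|d y - d x| <= (t * C + t^-1 * (y - x)) / 2) ->
    (\int[leb R]_(x in `]0%R, l[) compression P (d x) <= M%:E)%E ->
    forall x, 0 <= x <= l -> k < d x.
Proof.
move=> l0 al1 C0 M0.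
(* At distance at most k^2 from x the bound with t = k gives |d y - d x| <= k (C + 1) / 2, hence |d
   y| <= A k. *)
pose A := 1 + (C + 1) / 2; have A0 : 0 < A by rewrite /A; lra.
have AA : 0 < A `^ (2 * al) by rewrite powR_gt0.
(* Once k^(2 (alpha - 1)) < B, one has M (A k)^(2 alpha) < k^2, which contradicts the energy
   bound. *)
pose B := (M * A `^ (2 * al) + 1)^-1.
have B0 : 0 < B by rewrite invr_gt0 ltr_wpDl// mulr_ge0// ltW.
have p0 : 0 < 2 * (al - 1) by rewrite mulr_gt0// subr_gt0.
have /cvgrPdist_lt/(_ _ B0) HB := powR_cvg0 p0.
have [k [k0 k1 kl kB]] : exists k : R, [/\ 0 < k, k < 1, k <= l / 2 & k `^ (2 * (al - 1)) < B].
  near (0 : R)^'+ => k; exists k; split => //.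
  - by near: k; apply: nbhs_right_le; rewrite divr_gt0.
  - have : `|0 - k `^ (2 * (al - 1))| < B by near: k; exact: HB.
    by rewrite sub0r normrN ger0_norm// powR_ge0.
have E : M * (A * k) `^ (2 * al) < k ^+ 2.
  rewrite powRM ?ltW// (_ : 2 * al = 2%:R + 2 * (al - 1)); last by ring.
  rewrite [k `^ _]powRD; last by rewrite (gt_eqF k0) implybT.
  rewrite (_ : 2%:R + 2 * (al - 1) = 2 * al); last by ring.
  rewrite powR_mulrn ?(ltW k0)//.
  rewrite (_ : M * _ = k ^+ 2 * (M * A `^ (2 * al) * k `^ (2 * (al - 1)))); last by ring.
  rewrite gtr_pMr ?exprn_gt0//.
  apply: (@le_lt_trans _ _ (M * A `^ (2 * al) * B)).
    by rewrite ler_wpM2l ?mulr_ge0 ?powR_ge0// ltW.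
  by rewrite /B ltr_pdivrMr ?mul1r ?ltrDl// ltr_wpDl// mulr_ge0// powR_ge0.
exists k => // d cd d01 dH dM.
have kk : k ^+ 2 <= l / 2.
  by rewrite expr2 (le_trans _ kl)// ler_piMl// ltW.
have key x : 0 <= x <= l -> k < `|d x|.
  move=> xl; rewrite ltNge; apply/negP => dxk.
  have [a [b [a0 ab bl abk close]]] : exists a b : R, [/\ 0 <= a, a <= b, b <= l, b - a = k ^+ 2 &
      forall y, a < y < b -> `|d y - d x| <= (k * C + k^-1 * k ^+ 2) / 2].
    have kpos : 0 < k ^+ 2 by rewrite exprn_gt0.
    (* The interval starts at x if it fits in [0, l] and ends at x otherwise, where it fits because
       k^2 <= l / 2. *)
    have [xs|xs] := leP (x + k ^+ 2) l.
      exists x, (x + k ^+ 2); split; [lra|lra|lra|lra|move=> y yab].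
      apply: le_trans (dH x y k _ _ _ _) _; [lra|lra|lra|lra|].
      by rewrite ler_pM2r// lerD2l ler_pM2l ?invr_gt0//; lra.
    exists (x - k ^+ 2), x; split; [lra|lra|lra|lra|move=> y yab].
    rewrite distrC; apply: le_trans (dH y x k _ _ _ _) _; [lra|lra|lra|lra|].
    by rewrite ler_pM2r// lerD2l ler_pM2l ?invr_gt0//; lra.
  have Ak y : a < y < b -> `|d y| <= A * k.
    move=> /close; have -> : (k * C + k^-1 * k ^+ 2) / 2 = (A - 1) * k.
      by rewrite /A; field; rewrite gt_eqF.
    move=> H; rewrite -[d y](subrK (d x)); apply: le_trans (ler_normD _ _) _.
    by rewrite mulrBl mul1r in H; lra.
  have Ak0 : 0 < A * k by rewrite mulr_gt0.
  have : (\int[leb R]_(y in `]0%R, l[) (((A * k) `^ (2 * al))^-1 * \1_(`]a, b[%classic) y)%:E <= M%:E)%E.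
    apply: le_trans dM; apply: ae_ge0_le_lower_integral => //.
    - by move=> y _; rewrite lee_fin mulr_ge0// invr_ge0 powR_ge0.
    - by move=> y _; exact: compression_ge0.
    apply: aeW => y _; rewrite indicE; have [|_] := boolP (y \in _).
      by rewrite inE/= in_itv/= mulr1 => yab; apply: compression_ge => //; exact: Ak.
    by rewrite mulr0 compression_ge0.
  under eq_integral do rewrite EFinM.
  rewrite ge0_integralZl_EFin//=; last 2 first.
  - by apply/measurable_EFinP; apply: measurable_funTS; exact: measurable_indic.
  - by rewrite invr_ge0 powR_ge0.
  rewrite integral_indic//= setIidl; last by apply: subset_itvW; [exact: a0|exact: bl].
  rewrite leb_oo// abk -EFinM lee_fin.
  by rewrite ler_pdivrMl ?powR_gt0// mulrC leNgt E.
(* From |d| > k to d > k: a negative value would, with d 0 = 1, force a zero of d by the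
   intermediate value theorem. *)
move=> x /andP[x0 xl]; have dxk := key x (introT andP (conj x0 xl)).
have [dx0|dx0] := leP 0 (d x); first by rewrite ger0_norm in dxk.
have cdx : {within `[0, x], continuous d}.
  apply: continuous_subspaceW cd => y; rewrite /= !in_itv/= => /andP[-> yx].
  exact: le_trans yx xl.
have [|z /[!in_itv]/= /andP[z0 zx] dz0] := @IVT _ d 0 x 0 x0 cdx.
  by rewrite d01 ge_min le_max ler01 (ltW dx0) orbT.
have := key z; rewrite z0 (le_trans zx xl) dz0 normr0 => /(_ isT).
by rewrite ltNge ltW.
Unshelve. all: by end_near. Qed.

End Slope.

Lemma le_adde4 (R : realType) (a b c d : \bar R) :
  (0 <= a -> 0 <= b -> 0 <= c -> 0 <= d ->
   [/\ b <= a + b + c + d, c <= a + b + c + d & d <= a + b + c + d])%E.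
Proof.
move=> a0 b0 c0 d0; have ab : (0 <= a + b)%E by exact: adde_ge0.
have abc : (0 <= a + b + c)%E by exact: adde_ge0.
have H1 : (b <= a + b)%E by exact: leeDr.
have H2 : (a + b <= a + b + c)%E by exact: leeDl.
have H2' : (c <= a + b + c)%E by exact: leeDr.
have H3 : (a + b + c <= a + b + c + d)%E by exact: leeDl.
split; [exact: le_trans (le_trans H1 H2) H3|exact: le_trans H2' H3|exact: leeDr].
Qed.

(** * A priori bounds and lower semicontinuity of the elastic energy *)

Section Deformation.
Variables (R : realType) (P : params R).
Hypothesis okP : params_ok P.
Local Notation l := (len P).

Let len_gt0 : 0 < l. Proof. by case: okP. Qed.
Let c1_gt0 : 0 < c1 P. Proof. by case: okP => _ []. Qed.
Let c2_gt0 : 0 < c2 P. Proof. by case: okP => _ []. Qed.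
Let lambda0_gt0 : 0 < lambda0 P. Proof. by case: okP => _ []. Qed.
Let alpha_gt1 : 1 < alpha P. Proof. by case: okP. Qed.

Definition E_K_density (eta : R -> R * R) (x : R) : \bar R :=
  ((c1 P / 2 * `|(wderv l 1 eta x).1 - 1| ^+ 2)%:E
   + compression P (wderv l 1 eta x).1
   + (lambda0 P / 2 * `|(wderv l 2 eta x).1| ^+ 2)%:E
   + (c2 P / 2 * `|(wderv l 2 eta x).2| ^+ 2)%:E)%E.

Let t1_ge0 eta x : (0 <= (c1 P / 2 * `|(wderv l 1 eta x).1 - 1| ^+ 2)%:E)%E.
Proof. by rewrite lee_fin mulr_ge0 ?exprn_ge0// divr_ge0// ltW. Qed.
Let t3_ge0 eta x : (0 <= (lambda0 P / 2 * `|(wderv l 2 eta x).1| ^+ 2)%:E)%E.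
Proof. by rewrite lee_fin mulr_ge0 ?exprn_ge0// divr_ge0// ltW. Qed.
Let t4_ge0 eta x : (0 <= (c2 P / 2 * `|(wderv l 2 eta x).2| ^+ 2)%:E)%E.
Proof. by rewrite lee_fin mulr_ge0 ?exprn_ge0// divr_ge0// ltW. Qed.

Lemma E_K_density_ge0 eta x : (0 <= E_K_density eta x)%E.
Proof. by rewrite /E_K_density !adde_ge0// compression_ge0. Qed.

Lemma E_K_ge0 eta : (0 <= E_K P eta)%E.
Proof. by apply: integral_ge0 => x _; exact: E_K_density_ge0. Qed.

Lemma E_K_compression eta :
  (\int[leb R]_(x in `]0%R, l[) compression P (wder l 1 (fun x => (eta x).1) x) <= E_K P eta)%E.
Proof.
apply: ae_ge0_le_lower_integral => //.
- by move=> x _; exact: compression_ge0.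
- by move=> x _; exact: E_K_density_ge0.
apply: aeW => x _.
by have [] := le_adde4 (t1_ge0 eta x) (compression_ge0 P (wderv l 1 eta x).1) (t3_ge0 eta x)
  (t4_ge0 eta x).
Qed.

Lemma E_K_wder2 eta (i : bool) : L2 (leb R) `]0, l[ (wder l 2 (fun x => pcomp i (eta x))) ->
  ((if i then c2 P / 2 else lambda0 P / 2)%:E *
   \int[leb R]_(x in `]0%R, l[) (wder l 2 (fun x => pcomp i (eta x)) x ^+ 2)%:E <= E_K P eta)%E.
Proof.
move=> [mg _]; rewrite -ge0_integralZl_EFin//; last 3 first.
- by move=> x _; rewrite lee_fin sqr_ge0.
- by apply/measurable_EFinP; exact: measurable_funX.
- by case: i mg => _; rewrite divr_ge0// ltW.
apply: ae_ge0_le_lower_integral => //.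
- by move=> x _; rewrite -EFinM lee_fin mulr_ge0 ?sqr_ge0//; case: i mg => _; rewrite divr_ge0// ltW.
- by move=> x _; exact: E_K_density_ge0.
apply: aeW => x _; rewrite -EFinM -[X in (_ * X)%:E]real_normK ?num_real//.
have [_ H3 H4] := le_adde4 (t1_ge0 eta x) (compression_ge0 P (wderv l 1 eta x).1)
  (t3_ge0 eta x) (t4_ge0 eta x).
by case: i mg.
Qed.

Lemma within_continuous_pcomp (A : set R) (v : R -> R * R) (i : bool) :
  {within A, continuous v} -> {within A, continuous (fun x => pcomp i (v x))}.
Proof.
move=> /subspace_continuousP cv; apply/subspace_continuousP => x Ax.
by apply: cvg_comp (cv x Ax) _; case: i; [exact: cvg_snd|exact: cvg_fst].
Qed.

(** The last condition of [calH], with the continuous derivative made explicit. *)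
Definition slope_of (eta deta : R -> R * R) : Prop :=
  [/\ {within `[0, l], continuous deta},
      forall i, is_wder l 1 (fun x => pcomp i (eta x)) (fun x => pcomp i (deta x)),
      deta 0 = (1, 0) & deta l = (1, 0)].

(** The half-Hoelder bound of a function with square integrable derivative: the best t would give
    the square root of C (y - x). *)
Lemma slope_Young eta deta (i : bool) (C x y t : R) : Hk1v l 2 eta -> slope_of eta deta ->
  \int[leb R]_(z in `]0, l[) (wder l 2 (fun x => pcomp i (eta x)) z ^+ 2) <= C ->
  0 <= x -> x <= y -> y <= l -> 0 < t ->
  `|pcomp i (deta y) - pcomp i (deta x)| <= (t * C + t^-1 * (y - x)) / 2.
Proof.
move=> H2 [cd wd _ _] gC x0 xy yl t0.
have w2 := wderP (H2 i) (leqnn 2).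
have w12 := is_wder_trans (wd i) w2.
rewrite (wder1_ftc w12 (within_continuous_pcomp (i := i) cd) x0 xy yl).
apply: (le_trans (itv_integral_Young w2.1 x0 xy yl t0)).
by rewrite ler_pM2r// lerD2r ler_pM2l.
Qed.

Lemma deformation_bounds (M : R) : 0 <= M -> exists k L C : R, [/\ 0 < k, 0 <= L &
  forall eta deta, Hk1v l 2 eta -> {within `[0, l], continuous eta} ->
    slope_of eta deta -> (E_K P eta <= M%:E)%E ->
  [/\ forall x, 0 <= x <= l -> k <= (deta x).1,
      forall i x, 0 <= x <= l -> `|pcomp i (deta x)| <= L &
      forall i, \int[leb R]_(z in `]0, l[) (wder l 2 (fun x => pcomp i (eta x)) z ^+ 2) <= C]].
Proof.
(* The two bending terms bound the second derivatives of the first and of the second component by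
   the two summands of C. *)
move=> M0; pose C := M / (lambda0 P / 2) + M / (c2 P / 2).
have C0 : 0 <= C by rewrite addr_ge0// divr_ge0// divr_ge0// ltW.
have [k k0 Hk] := slope_lower_bound len_gt0 alpha_gt1 C0 M0.
(* The value of L comes from the half-Hoelder bound with t = 1 between 0, where the slope is (1, 0),
   and x. *)
exists k, (1 + (C + l) / 2), C; split => //; first by have := len_gt0; lra.
move=> eta deta H2 ce sl EM.
have [cd wd d0 dl] := sl.
have gC i : \int[leb R]_(z in `]0, l[) (wder l 2 (fun x => pcomp i (eta x)) z ^+ 2) <= C.
  have w2 := wderP (H2 i) (leqnn 2).
  have := le_trans (E_K_wder2 w2.1) EM.
  have I2 : (leb R).-integrable `]0, l[ (EFin \o (fun x => wder l 2 (fun x => pcomp i (eta x)) x ^+ 2)).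
    by apply: L2_sqr_integrable; [exact: measurable_itv|exact: w2.1].
  rewrite -[X in (_ * X)%E]fineK; last exact: (integrable_fin_num _ I2).
  have ci0 : 0 < (if i then c2 P / 2 else lambda0 P / 2) by case: (i); rewrite divr_gt0.
  rewrite -EFinM lee_fin -ler_pdivlMl// => /le_trans; apply; rewrite mulrC /C.
  by case: (i); rewrite ?lerDl ?lerDr divr_ge0// divr_ge0// ltW.
split => //.
- move=> x xl; apply: ltW; apply: (Hk (fun x => (deta x).1)) => //.
  + exact: (within_continuous_pcomp (i := false) cd).
  + by rewrite d0.
  + by move=> y z t y0 yz zl t0; exact: (@slope_Young eta deta false).
  + apply: le_trans (le_trans (E_K_compression eta) EM).
    apply: ae_ge0_le_lower_integral => //.
    * by move=> y _; exact: compression_ge0.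
    * by move=> y _; exact: compression_ge0.
    have w1 := wderP (H2 false) (isT : (1 <= 2)%N).
    have := wder1_unique (wd false) w1 (within_continuous_pcomp (i := false) ce).
    apply: filterS; first exact: (ae_filter_ringOfSetsType (leb R)).
    by move=> y H; rewrite /= in_itv/= => /H /= ->.
- move=> i x /andP[x0 xl].
  have := @slope_Young eta deta i C 0 x 1 H2 sl (gC i) (lexx 0) x0 xl ltr01.
  rewrite mul1r invr1 mul1r subr0 d0 => H.
  have H1 : `|pcomp i (1, 0)| <= 1 :> R by case: i H; rewrite /= ?normr0 ?normr1.
  rewrite -[pcomp i (deta x)](subrK (pcomp i (1, 0))).
  by apply: le_trans (ler_normD _ _) _; lra.
Qed.

Lemma slope_increment (eta deta : R -> R * R) (i : bool) (k L x y : R) :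
  {within `[0, l], continuous eta} -> slope_of eta deta ->
  (forall z, x < z < y -> k <= pcomp i (deta z) <= L) ->
  0 <= x -> x <= y -> y <= l ->
  k * (y - x) <= pcomp i (eta y) - pcomp i (eta x) <= L * (y - x).
Proof.
move=> ce [cd wd _ _] kL x0 xy yl.
rewrite (wder1_ftc (wd i) (within_continuous_pcomp (i := i) ce) x0 xy yl).
have sub : `]x, y[ `<=` `]0, l[ by apply: subset_itvW; [exact: x0|exact: yl].
have Id : (leb R).-integrable `]x, y[ (EFin \o (fun z => pcomp i (deta z))).
  have H := continuous_itv_integrable (within_continuous_pcomp (i := i) cd).
  by apply: integrableS H => //; exact: measurable_itv.
have Ic (c : R) : (leb R).-integrable `]x, y[ (EFin \o (cst c : R -> R)).
  by apply: L2_integrable => //; [exact: leb_oo_lty|apply: L2_cst => //; exact: leb_oo_lty].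
have E (c : R) : c * (y - x) = \int[leb R]_(z in `]x, y[) cst c z.
  by rewrite Rintegral_cst//= leb_oo.
have kL' z : `]x, y[%classic z -> k <= pcomp i (deta z) <= L.
  by rewrite /= in_itv/=; exact: kL.
by rewrite !E; apply/andP; split; apply: le_Rintegral => // z /kL' /andP[].
Qed.

(** By the half-Hoelder bound the slope at x is close to the difference quotient over [x, x + r],
    uniformly in k, and these quotients converge pointwise. *)
Lemma slope_cvg (etak detak : nat -> R -> R * R) (eta deta : R -> R * R) (i : bool) (C x : R) :
  (forall k, Hk1v l 2 (etak k)) -> Hk1v l 2 eta ->
  (forall k, {within `[0, l], continuous (etak k)}) -> {within `[0, l], continuous eta} ->
  (forall k, slope_of (etak k) (detak k)) -> slope_of eta deta ->
  (forall k, \int[leb R]_(z in `]0, l[) (wder l 2 (fun x => pcomp i (etak k x)) z ^+ 2) <= C) ->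
  (forall x, 0 <= x <= l -> pcomp i (etak k x) @[k --> \oo] --> pcomp i (eta x)) ->
  0 < x < l -> pcomp i (detak k x) @[k --> \oo] --> pcomp i (deta x).
Proof.
move=> H2k H2 cek ce slk sl gC0 etaC /andP[x0 xl].
pose C' := Order.max C (\int[leb R]_(z in `]0, l[) (wder l 2 (fun x => pcomp i (eta x)) z ^+ 2)).
have C'0 : 0 <= C'.
  by rewrite le_max; apply/orP; right; apply: Rintegral_ge0 => z _; exact: sqr_ge0.
apply/cvgrPdist_le => eps' eps'0.
pose eps := eps' / 3; have eps0 : 0 < eps by rewrite divr_gt0.
pose t := eps / (C' + 1); have t0 : 0 < t by rewrite divr_gt0// ltr_wpDl.
have [r [r0 rl re]] : exists r : R, [/\ 0 < r, x + r <= l & r <= eps * t].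
  near (0 : R)^'+ => r; exists r; split => //.
  - by rewrite -lerBrDl; near: r; apply: nbhs_right_le; rewrite subr_gt0.
  - by near: r; apply: nbhs_right_le; rewrite mulr_gt0.
have Beps : (t * C' + t^-1 * r) / 2 <= eps.
  have : t * C' <= eps by rewrite /t mulrAC ler_pdivrMr ?ltr_wpDl// ler_pM2l// lerDl.
  have : t^-1 * r <= eps by rewrite ler_pdivrMl// [leRHS]mulrC.
  lra.
have diffq (v dv : R -> R * R) : Hk1v l 2 v -> {within `[0, l], continuous v} -> slope_of v dv ->
    \int[leb R]_(z in `]0, l[) (wder l 2 (fun x => pcomp i (v x)) z ^+ 2) <= C' ->
    `|pcomp i (dv x) - (pcomp i (v (x + r)) - pcomp i (v x)) / r| <= eps.
  move=> Hv cv slv vC.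
  have osc z : x < z < x + r -> pcomp i (dv x) - eps <= pcomp i (dv z) <= pcomp i (dv x) + eps.
    move=> /andP[xz zx].
    have := @slope_Young v dv i C' x z t Hv slv vC (ltW x0) (ltW xz) _ t0.
    move=> /(_ (le_trans (ltW zx) rl)) H.
    have : `|pcomp i (dv z) - pcomp i (dv x)| <= eps.
      apply: le_trans H (le_trans _ Beps); rewrite ler_pM2r// lerD2l ler_pM2l ?invr_gt0//; lra.
    by rewrite ler_norml; lra.
  have := slope_increment cv slv osc (ltW x0) _ rl.
  rewrite lerDl (ltW r0) => /(_ isT).
  rewrite (_ : x + r - x = r); last by ring.
  set D := (_ - _ in X in _ <= X <= _) => /andP[D1 D2].
  have : pcomp i (dv x) - eps <= D / r by rewrite ler_pdivlMr.
  have : D / r <= pcomp i (dv x) + eps by rewrite ler_pdivrMr.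
  by rewrite ler_norml -/D; lra.
have cq : (pcomp i (etak k (x + r)) - pcomp i (etak k x)) / r @[k --> \oo] -->
          (pcomp i (eta (x + r)) - pcomp i (eta x)) / r.
  by apply: cvgM; [apply: cvgB; apply: etaC; lra|exact: cvg_cst].
have /cvgrPdist_le/(_ _ eps0) := cq; apply: filterS => k Hk.
have E1 : `|pcomp i (deta x) - (pcomp i (eta (x + r)) - pcomp i (eta x)) / r| <= eps.
  by apply: diffq => //; rewrite le_max lexx orbT.
have E2 : `|pcomp i (detak k x) - (pcomp i (etak k (x + r)) - pcomp i (etak k x)) / r| <= eps.
  by apply: diffq => //; rewrite le_max gC0.
have -> : eps' = 3 * eps by rewrite /eps; field.
move: E1 E2 Hk; rewrite !ler_norml.
by move=> /andP[? ?] /andP[? ?] /andP[? ?]; lra.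
Unshelve. all: by end_near. Qed.

(** The part of the energy density that depends on the first derivative, in its real-valued form: it
    is the stretching term plus the compression wherever v does not vanish. *)
Definition slope_density (v : R) : R := c1 P / 2 * `|v - 1| ^+ 2 + (`|v| `^ (2 * alpha P))^-1.

(** The indices 0 and 1 stand for the second derivatives, 2 and 3 for the third ones; the parity of
    the index selects the component. *)
Let coef (s : R) (i : 'I_4) : R :=
  if (i < 2)%N then (if odd i then c2 P / 2 else lambda0 P / 2) else s.
Let ord (i : 'I_4) : nat := if (i < 2)%N then 2 else 3.

Let big4 (F : 'I_4 -> R) : \sum_i F i =
  F (@Ordinal 4 0 isT) + F (@Ordinal 4 1 isT) + F (@Ordinal 4 2 isT) + F (@Ordinal 4 3 isT).
Proof.
rewrite !big_ord_recl big_ord0 addr0 !addrA.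
by congr (F _ + F _ + F _ + F _); apply: val_inj.
Qed.

Let coef_ge0 s i : 0 <= s -> 0 <= coef s i.
Proof.
by move=> s0; rewrite /coef; case: ifP => // _; case: ifP => _; rewrite divr_ge0// ltW.
Qed.

Lemma slope_density_ge0 v : 0 <= slope_density v.
Proof.
rewrite addr_ge0 ?invr_ge0 ?powR_ge0// mulr_ge0 ?exprn_ge0// divr_ge0// ltW//.
Qed.

Lemma measurable_slope_density eta deta : slope_of eta deta ->
  measurable_fun `]0, l[ (fun x => slope_density (deta x).1).
Proof.
move=> [_ wd _ _]; have [md _] := (wd false).1.
apply: measurable_funD.
  apply: measurable_funM => //; apply: measurable_funX; apply: measurableT_comp => //.
  exact: measurable_funB.
rewrite (_ : (fun x => _) = fun x => `|(deta x).1| `^ (- (2 * alpha P))).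
  apply: (measurableT_comp (measurable_powR _)).
  exact: (measurableT_comp (@normr_measurable R setT) md).
by apply/funext => x; rewrite powRN.
Qed.

(** For s = sqrt(delta0) / 2 this is the [elastic_energy] of a solution at a given time, freed from
    the time variable. *)
Definition elastic (s : R) (eta : R -> R * R) : \bar R :=
  (E_K P eta + s%:E * \int[leb R]_(x in `]0%R, l[) (sqnorm (wderv l 3 eta x))%:E)%E.

(** The shape required by [quadratic_lsc]. The lower bound on the slope excludes the infinite value
    of the compression, and the chosen weak derivative agrees almost everywhere with the continuous
    one. *)
Lemma elasticE (s k : R) eta deta : 0 <= s -> 0 < k -> Hk1v l 2 eta -> Hk1v l 3 eta ->
  {within `[0, l], continuous eta} -> slope_of eta deta ->
  (forall x, 0 <= x <= l -> k <= (deta x).1) ->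
  elastic s eta = (\int[leb R]_(x in `]0%R, l[)
    (slope_density (deta x).1 +
     \sum_i coef s i * wder l (ord i) (fun y => pcomp (odd i) (eta y)) x ^+ 2)%:E)%E.
Proof.
move=> s0 k0 H2 H3 ce sl kd.
have w1 := wderP (H2 false) (isT : (1 <= 2)%N).
have w2 i := wderP (H2 i) (leqnn 2).
have w3 i := wderP (H3 i) (leqnn 3).
have [_ wd _ _] := sl.
pose g2 i := wder l 2 (fun y => pcomp i (eta y)).
pose g3 i := wder l 3 (fun y => pcomp i (eta y)).
have mg2 i : measurable_fun `]0, l[ (fun x => g2 i x ^+ 2) by apply: measurable_funX; exact: (w2 i).1.1.
have mg3 i : measurable_fun `]0, l[ (fun x => g3 i x ^+ 2) by apply: measurable_funX; exact: (w3 i).1.1.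
pose W x := slope_density (deta x).1 + lambda0 P / 2 * g2 false x ^+ 2 + c2 P / 2 * g2 true x ^+ 2.
have W0 x : 0 <= W x.
  have lam0 : 0 <= lambda0 P / 2 by rewrite divr_ge0// ltW.
  have c20 : 0 <= c2 P / 2 by rewrite divr_ge0// ltW.
  apply: addr_ge0; [apply: addr_ge0; [exact: slope_density_ge0|]|];
    by apply: mulr_ge0 => //; exact: sqr_ge0.
have mW : measurable_fun `]0, l[ W.
  apply: measurable_funD; [apply: measurable_funD; [exact: measurable_slope_density sl|]|];
  exact: measurable_funM.
have S3 x : sqnorm (wderv l 3 eta x) = g3 false x ^+ 2 + g3 true x ^+ 2 by rewrite /sqnorm /dot -!expr2.
have EW : E_K P eta = (\int[leb R]_(x in `]0%R, l[) (W x)%:E)%E.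
  have H : {ae leb R, forall x, `]0%R, l[%classic x -> E_K_density eta x = (W x)%:E}.
    have := wder1_unique (wd false) w1 (within_continuous_pcomp (i := false) ce).
    apply: filterS; first exact: (ae_filter_ringOfSetsType (leb R)).
    move=> x Hx; rewrite /= in_itv/= => xl.
    rewrite /E_K_density /W /slope_density /g2 [(wderv l 1 eta x).1](_ : _ = (deta x).1); last first.
      exact: (esym (Hx xl)).
    have dk : k <= (deta x).1 by apply: kd; lra.
    rewrite /compression gt_eqF; last exact: lt_le_trans dk.
    by rewrite !EFinD !real_normK ?num_real.
  apply/eqP; rewrite eq_le; apply/andP; split; apply: ae_ge0_le_lower_integral => //;
    try (by move=> x _; rewrite lee_fin); try (by move=> x _; exact: E_K_density_ge0);
    move: H; (apply: filterS; first exact: (ae_filter_ringOfSetsType (leb R)));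
    by move=> x Hx xl; rewrite -(Hx xl).
have mS : measurable_fun `]0, l[ (fun x => (sqnorm (wderv l 3 eta x))%:E).
  apply/measurable_EFinP; rewrite (_ : (fun x => _) = fun x => g3 false x ^+ 2 + g3 true x ^+ 2).
    by apply: measurable_funD; exact: mg3.
  by apply/funext => x; exact: S3.
rewrite /elastic EW -ge0_integralZl_EFin//; last first.
  by move=> x _; rewrite lee_fin S3 addr_ge0 ?sqr_ge0.
rewrite -ge0_integralD//=; last 4 first.
- by move=> x _; rewrite lee_fin.
- exact/measurable_EFinP.
- by move=> x _; rewrite -EFinM lee_fin S3 mulr_ge0 ?addr_ge0 ?sqr_ge0.
- exact: measurable_funeM.
apply: eq_integral => x _; rewrite -EFinM -EFinD S3 big4 /coef /ord/=; congr EFin.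
by rewrite /W /g2 /g3/=; ring.
Qed.

Lemma calH_slope eta : calH l eta ->
  [/\ Hk1v l 2 eta, {within `[0, l], continuous eta} & exists deta, slope_of eta deta].
Proof. by move=> [H2 ce _ _ [deta [? ? ? ?]]]; split => //; exists deta. Qed.

Lemma E_K_le_elastic s eta : 0 <= s -> (E_K P eta <= elastic s eta)%E.
Proof.
move=> s0; rewrite leeDl// mule_ge0 ?lee_fin//; apply: integral_ge0 => x _.
by rewrite lee_fin /sqnorm /dot addr_ge0// -expr2 sqr_ge0.
Qed.

Lemma deformation_le eta deta (L : R) (i : bool) x : eta 0 = (0, 0) ->
  {within `[0, l], continuous eta} -> slope_of eta deta ->
  (forall x, 0 <= x <= l -> `|pcomp i (deta x)| <= L) -> 0 <= x <= l ->
  `|pcomp i (eta x)| <= L * l.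
Proof.
move=> e0 ce sl dL /andP[x0 xl].
have osc z : 0 < z < x -> - L <= pcomp i (deta z) <= L.
  by move=> zx; rewrite -ler_norml; apply: dL; lra.
have := slope_increment ce sl osc (lexx 0) x0 xl; rewrite e0 subr0.
have -> : pcomp i (0, 0) = 0 :> R by case: (i).
rewrite subr0 mulNr -ler_norml => /le_trans; apply.
have L0 : 0 <= L by apply: le_trans (dL 0 _) => //; rewrite lexx ltW.
by rewrite ler_wpM2l.
Qed.

Lemma cvgn_ge (u : nat -> R) (v a : R) : u k @[k --> \oo] --> v ->
  (\forall k \near \oo, a <= u k) -> a <= v.
Proof.
move=> uv au; rewrite -(cvg_lim (@Rhausdorff R) uv); apply: limr_ge => //.
by apply/cvg_ex; exists v.
Qed.

Lemma slope_density_cvg (vk : nat -> R) (v : R) : 0 < v ->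
  vk k @[k --> \oo] --> v -> slope_density (vk k) @[k --> \oo] --> slope_density v.
Proof.
move=> v0 vkv; apply: cvgD.
  apply: cvgM; first exact: cvg_cst.
  have H : `|vk k - 1| @[k --> \oo] --> `|v - 1|.
    by apply: cvg_norm; apply: cvgB => //; exact: cvg_cst.
  exact: (cvgM H H).
apply: cvgV; first by rewrite gt_eqF// powR_gt0// normr_gt0 gt_eqF.
have cp : {for `|v|, continuous (fun a : R => a `^ (2 * alpha P))}.
  apply: differentiable_continuous; apply/derivable1_diffP.
  by apply: derivable_powR; rewrite in_itv/= andbT normr_gt0 gt_eqF.
have H : `|vk k| @[k --> \oo] --> `|v| by exact: cvg_norm.
exact: (continuous_cvg _ cp H).
Qed.

(** The energy bound makes the slopes converge pointwise, which handles stretching and compression,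
    and bounds the second derivatives; the third derivatives are bounded by c / s, whence s > 0. The
    derivatives of order 2 and 3 are then treated as the quadratic part. *)
Lemma elastic_lsc (s c : R) (etak : nat -> R -> R * R) (eta : R -> R * R) :
  0 < s -> 0 <= c -> (forall k, calH l (etak k)) -> (forall k, Hk1v l 3 (etak k)) ->
  calH l eta -> Hk1v l 3 eta ->
  (forall i x, 0 <= x <= l -> pcomp i (etak k x) @[k --> \oo] --> pcomp i (eta x)) ->
  (forall k, elastic s (etak k) <= c%:E)%E -> (elastic s eta <= c%:E)%E.
Proof.
move=> s0 c0 Hk H3k H H3 etaC ek.
have [H2 ce [deta sl]] := calH_slope H.
have slk0 k : exists d, slope_of (etak k) d by have [_ _] := calH_slope (Hk k).
have [detak slk] := choice slk0.
have H2k k : Hk1v l 2 (etak k) by have [] := calH_slope (Hk k).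
have cek k : {within `[0, l], continuous (etak k)} by have [] := calH_slope (Hk k).
have [kap [L [C [kap0 L0 bounds]]]] := deformation_bounds c0.
have EKk k : (E_K P (etak k) <= c%:E)%E.
  by apply: le_trans (ek k); apply: E_K_le_elastic; exact: ltW.
have bk k := bounds _ _ (H2k k) (cek k) (slk k) (EKk k).
have detaC i x : 0 < x < l -> pcomp i (detak k x) @[k --> \oo] --> pcomp i (deta x).
  apply: (@slope_cvg etak detak eta deta i C) => // [k|]; first by have [_ _] := bk k.
  by move=> y; exact: etaC.
have kapd x : 0 <= x <= l -> kap <= (deta x).1.
  (* Convergence of the slopes is known inside the interval only; at both ends all slopes equal (1,
     0), and the bound holds for a term of the sequence. *)
  move=> /andP[]; rewrite le_eqVlt => /predU1P[<- _|x0].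
    have [_ _ -> _] := sl; have [_ _ d0 _] := slk 0%N; have [k0 _ _] := bk 0%N.
    by have := k0 0; rewrite d0 lexx ltW// => /(_ isT).
  rewrite le_eqVlt => /predU1P[->|xl].
    have [_ _ _ ->] := sl; have [_ _ _ dl] := slk 0%N; have [k0 _ _] := bk 0%N.
    by have := k0 l; rewrite dl lexx ltW// => /(_ isT).
  have dC := detaC false x (introT andP (conj x0 xl)).
  by apply: (cvgn_ge dC); apply: nearW => k; have [k0 _ _] := bk k; apply: k0; lra.
rewrite (elasticE (ltW s0) kap0 H2 H3 ce sl kapd).
apply: (@quadratic_lsc R l 4 (coef s) (fun k x => slope_density (detak k x).1) _
  (fun k i => wder l (ord i) (fun y => pcomp (odd i) (etak k y)))).
- by move=> i; apply: coef_ge0; exact: ltW.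
- by move=> k; exact: measurable_slope_density (slk k).
- exact: measurable_slope_density sl.
- by move=> k x _; exact: slope_density_ge0.
- by move=> x _; exact: slope_density_ge0.
- move=> x xl; apply: slope_density_cvg; last exact: (detaC false x xl).
  by apply: lt_le_trans kap0 (kapd _ _); lra.
- move=> k i; rewrite /ord; case: ifP => _.
    exact: (wderP (H2k k _) (leqnn 2)).1.
  exact: (wderP (H3k k _) (leqnn 3)).1.
- move=> i; rewrite /ord; case: ifP => _.
    exact: (wderP (H2 _) (leqnn 2)).1.
  exact: (wderP (H3 _) (leqnn 3)).1.
- move=> i a b a0 ab bl.
  have ic := @within_continuous_pcomp `[0, l]%classic _ (odd i) ce.
  have ick k := @within_continuous_pcomp `[0, l]%classic _ (odd i) (cek k).
  have Mk k x : 0 < x < l -> `|pcomp (odd i) (etak k x)| <= L * l.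
    move=> xl; have [_ bL _] := bk k; have [_ _ e0 _ _] := Hk k.
    by apply: (deformation_le e0 (cek k) (slk k) (bL (odd i))); lra.
  have Ck x : 0 < x < l -> pcomp (odd i) (etak k x) @[k --> \oo] --> pcomp (odd i) (eta x).
    by move=> xl; apply: etaC; lra.
  rewrite /ord; case: ifP => _.
    apply: (itv_integral_cvg (G := C) (M := L * l) (fun k => wderP (H2k k (odd i)) (leqnn 2))
       (wderP (H2 (odd i)) (leqnn 2)) ick ic Mk Ck _ a0 ab bl).
    by move=> k; have [_ _] := bk k; exact.
  apply: (itv_integral_cvg (G := c / s) (M := L * l) (fun k => wderP (H3k k (odd i)) (leqnn 3))
       (wderP (H3 (odd i)) (leqnn 3)) ick ic Mk Ck _ a0 ab bl).
  move=> k; have w3 b := wderP (H3k k b) (leqnn 3).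
  have I3 m : (leb R).-integrable `]0, l[ (EFin \o (fun x => wder l 3 (fun x => pcomp m (etak k x)) x ^+ 2)).
    by apply: L2_sqr_integrable; [exact: measurable_itv|exact: (w3 m).1].
  rewrite ler_pdivlMr// mulrC -lee_fin EFinM; apply: le_trans (ek k).
  apply: (@le_trans _ _ (s%:E * \int[leb R]_(x in `]0%R, l[) (sqnorm (wderv l 3 (etak k) x))%:E)%E).
    apply: lee_wpmul2l; first by rewrite lee_fin ltW.
    rewrite /Rintegral fineK; last exact: (integrable_fin_num _ (I3 (odd i))).
    apply: ae_ge0_le_lower_integral => //.
    + by move=> x _; rewrite lee_fin sqr_ge0.
    + by move=> x _; rewrite lee_fin /sqnorm /dot addr_ge0// -expr2 sqr_ge0.
    apply: aeW => x _; rewrite lee_fin /sqnorm /dot -!expr2 /=.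
    by case: (odd i); rewrite ?lerDl ?lerDr sqr_ge0.
  by rewrite /elastic leeDr// E_K_ge0.
- move=> k; rewrite -(elasticE (ltW s0) kap0 (H2k k) (H3k k) (cek k) (slk k)) //.
  by have [] := bk k.
Qed.

End Deformation.

(** * Phases separated by the curve *)

Section IntervalWindows.
Variable R : realType.
Implicit Types (l x y : R).

(** The window starts at x0, or at l - r when x0 is too close to the right end. *)
Lemma window_around l (r x0 : R) : 0 < r <= l -> 0 <= x0 <= l ->
  exists a, [/\ 0 <= a, a + r <= l & forall x, a < x < a + r -> 0 <= x <= l /\ `|x0 - x| <= r].
Proof.
move=> rl xl; exists (Order.min x0 (l - r)).
have H1 : Order.min x0 (l - r) <= x0 by rewrite ge_min lexx.
have H2 : Order.min x0 (l - r) <= l - r by rewrite ge_min lexx orbT.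
have H3 : x0 <= Order.min x0 (l - r) + r by rewrite minEle; case: ifP => _; lra.
have H4 : 0 <= Order.min x0 (l - r) by rewrite le_min; apply/andP; split; lra.
move: (Order.min x0 (l - r)) H1 H2 H3 H4 => a H1 H2 H3 H4.
by split=> [||x xa]; [|lra|rewrite ler_norml; lra].
Qed.

Lemma lipschitz_sym l (M : R) (w : R -> R) :
  (forall x y, 0 <= x -> x <= y -> y <= l -> `|w y - w x| <= M * (y - x)) ->
  forall x y, 0 <= x <= l -> 0 <= y <= l -> `|w y - w x| <= M * `|y - x|.
Proof.
move=> H x y; wlog xy : x y / x <= y => [W xl yl|/andP[x0 _] /andP[_ yl]].
  by have [?|/ltW ?] := leP x y; [exact: W|rewrite distrC [X in _ <= _ * X]distrC; exact: W].
by rewrite [X in _ <= _ * X]ger0_norm ?subr_ge0// H.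
Qed.

End IntervalWindows.

Section Phase.
Variable R : realType.
Implicit Types (l a b y : R) (eta : R -> R * R) (z : R * R).

Lemma segment_continuous (c : R) : continuous (fun s : R => (c, s)).
Proof.
move=> s B [[B1 B2] /= [n1 n2] sub]; move: n2; apply: filterS => r B2r.
by apply: sub; split => //=; exact: nbhs_singleton.
Qed.

(** A vertical segment through z that avoids the curve is connected, hence lies in the component of
    z; the last hypothesis says that it accumulates at height y. *)
Lemma segment_side l y eta z (I : interval R) : 0 < z.1 < l ->
  (Omega l `\` curve l eta) z -> z.2 \in I ->
  (forall s, s \in I -> (Omega l `\` curve l eta) (z.1, s)) ->
  (forall B : set R, nbhs y B -> exists2 s, s \in I & B s) ->
  side_component l y eta z.
Proof.
move=> zl Cz zI IC yI; split => //; exists (z.1, y); split => //.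
have zE : (z.1, z.2) = z by case: (z).
have cI : connected ((fun s : R => (z.1, s)) @` [set` I]).
  apply: connected_continuous_connected.
    by apply/connected_intervalP; exact: interval_is_interval.
  by apply: continuous_subspaceT => s; exact: segment_continuous.
have sub : (fun s : R => (z.1, s)) @` [set` I] `<=` connected_component (Omega l `\` curve l eta) z.
  apply: connected_component_max => //; first by exists z.2.
  by move=> _ [s sI <-]; exact: IC.
move=> B nB; have : nbhs y ((fun s : R => (z.1, s)) @^-1` B) by exact: segment_continuous.
move=> /yI[s sI Bs]; exists (z.1, s); split => //; apply: sub; by exists s.
Qed.

Lemma phase_ge0 l a b eta z : 0 <= a -> 0 <= b -> 0 <= phase l a b eta z.
Proof. by move=> a0 b0; rewrite /phase addr_ge0// mulr_ge0// indicE. Qed.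

(** The bound is the sum and not the maximum, since the two sides are not shown to be disjoint. *)
Lemma phase_le l a b eta z : 0 <= a -> 0 <= b -> phase l a b eta z <= a + b.
Proof.
move=> a0 b0; rewrite /phase !indicE.
by rewrite lerD// ler_piMr//; case: (_ \in _).
Qed.

(** If a point of the curve lies above z on the same vertical, it is the only one on it, and the
    segment from z down to the bottom avoids the curve; otherwise the segment up to the top does. *)
Lemma phase_ge l a b eta z : 0 <= a -> 0 <= b ->
  (forall x y, 0 < x < l -> 0 < y < l -> (eta x).1 = (eta y).1 -> x = y) ->
  Omega l z -> ~ curve l eta z -> Order.min a b <= phase l a b eta z.
Proof.
move=> a0 b0 inj Oz Cz; have [zl zb] := Oz.
have nb (y : R) (I : interval R) : (\forall s \near y^'-, s \in I) \/ (\forall s \near y^'+, s \in I) ->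
    forall B : set R, nbhs y B -> exists2 s, s \in I & B s.
  move=> H B nB; case: H => H.
    have [s [sI Bs]] := @filter_ex _ (y^'-) _ _ (filterI H (cvg_within _ nB)).
    by exists s.
  have [s [sI Bs]] := @filter_ex _ (y^'+) _ _ (filterI H (cvg_within _ nB)).
  by exists s.
have [[x [xl x1 x2]]|noup] := pselect (exists x, [/\ 0 < x < l, (eta x).1 = z.1 & z.2 < (eta x).2]).
  have Om : Omega_minus l eta z.
    apply: (@segment_side _ _ _ _ `](- (l / 2)), z.2]) => //.
    - by rewrite in_itv/= lexx andbT; lra.
    - move=> s; rewrite in_itv/= => sz; split; first by split => //=; lra.
      move=> [y]; rewrite /= in_itv/= => yl eys.
      have yx : y = x by apply: inj => //; rewrite x1 eys.
      by move: x2; rewrite -yx eys /=; lra.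
    - apply: nb; right; near=> s; rewrite in_itv/=; apply/andP; split => //.
      near: s; apply: nbhs_right_le; lra.
  rewrite /phase [in X in _ <= _ + X]indicE mem_set// mulr1.
  by rewrite ge_min; apply/orP; right; rewrite lerDr mulr_ge0// indicE.
have Op : Omega_plus l eta z.
  apply: (@segment_side _ _ _ _ `[z.2, (l / 2)[) => //.
  - by rewrite in_itv/= lexx; lra.
  - move=> s; rewrite in_itv/= => sz; split; first by split => //=; lra.
    move=> [y]; rewrite /= in_itv/= => yl eys; apply: noup; exists y; split => //; rewrite eys//=.
    rewrite lt_neqAle; apply/andP; split; last by lra.
    apply/eqP => zs; apply: Cz; exists y; first by rewrite /= in_itv.
    by rewrite eys -zs; case: (z).
  - apply: nb; left; near=> s; rewrite in_itv/=; apply/andP; split => //.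
    near: s; apply: nbhs_left_ge; lra.
rewrite /phase [in X in _ <= X + _]indicE mem_set// mulr1.
by rewrite ge_min; apply/orP; left; rewrite lerDl mulr_ge0// indicE.
Unshelve. all: by end_near. Qed.

End Phase.

(** * The curve is a null set of the plane *)

Section CurveNull.
Variable R : realType.
Implicit Types (l : R) (eta : R -> R * R).

Lemma OmegaE l : Omega l = `]0, l[%classic `*` `](- (l / 2)), (l / 2)[%classic.
Proof. by apply/seteqP; split => z; rewrite /Omega /= !in_itv/=. Qed.

Lemma measurable_Omega l : measurable (Omega l : set (measurableTypeR R * measurableTypeR R)).
Proof. by rewrite OmegaE; apply: measurableX; exact: measurable_itv. Qed.

Lemma open_Omega l : open (Omega l).
Proof.
rewrite OmegaE openE => z [z1 z2]; exists (`]0, l[%classic, `](- (l / 2)), (l / 2)[%classic) => //.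
by split; apply: open_nbhs_nbhs; split => //; exact: itv_open.
Qed.

(* Both components of the curve are Lipschitz functions of its abscissa, which
   confines the curve to a countable intersection of double cones with null
   vertical sections. *)
Lemma curve_null (k L l : R) eta : 0 < k -> 0 <= L -> 0 < l ->
  {within `[0, l], continuous (fun x => (eta x).1)} ->
  (forall x y, 0 <= x -> x <= y -> y <= l ->
     k * (y - x) <= (eta y).1 - (eta x).1 <= L * (y - x)) ->
  (forall x y, 0 <= x -> x <= y -> y <= l -> `|(eta y).2 - (eta x).2| <= L * (y - x)) ->
  eta 0 = (0, 0) -> eta l = (l, 0) ->
  exists G : set (measurableTypeR R * measurableTypeR R),
    [/\ measurable G, leb2 R G = 0%E & curve l eta `<=` G].
Proof.
move=> k0 L0 l0 ce e1 e2 eta0 etal.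
(* An enumeration of the rationals clamped to [0, l]; the cones have their vertices at the
   corresponding points of the curve. *)
pose q (n : nat) : R := if (unpickle n : option rat) is Some r
  then Order.max 0 (Order.min l (ratr r)) else 0.
have q0 n : 0 <= q n <= l.
  rewrite /q; case: unpickle => [r|]; last by rewrite lexx ltW.
  by rewrite le_max lexx ge_max ge_min lexx /= (ltW l0).
(* A Lipschitz constant of the height as a function of the abscissa. *)
pose A := L / k.
pose S n := [set z : R * R | `|z.2 - (eta (q n)).2| <= A * `|z.1 - (eta (q n)).1|].
pose G := (`]0, l[%classic `*` setT) `&` \bigcap_n S n.
have mS n : measurable (S n : set (measurableTypeR R * measurableTypeR R)).
  have mf : measurable_fun setT (fun z : measurableTypeR R * measurableTypeR R =>
     A * `|z.1 - (eta (q n)).1| - `|z.2 - (eta (q n)).2|).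
    apply: measurable_funB.
      apply: measurable_funM => //; apply: measurableT_comp => //; exact: measurable_funB.
    by apply: measurableT_comp => //; exact: measurable_funB.
  have -> : S n = setT `&` (fun z : measurableTypeR R * measurableTypeR R =>
     A * `|z.1 - (eta (q n)).1| - `|z.2 - (eta (q n)).2|) @^-1` `[0, +oo[.
    by apply/seteqP; split => z; rewrite /S /= in_itv/= andbT subr_ge0; tauto.
  exact: mf.
have mG : measurable (G : set (measurableTypeR R * measurableTypeR R)).
  apply: measurableI; first by apply: measurableX.
  exact: bigcap_measurableType.
have e1' x y : 0 <= x <= l -> 0 <= y <= l -> k * `|y - x| <= `|(eta y).1 - (eta x).1| <= L * `|y - x|.
  wlog xy : x y / x <= y => [H xl yl|/andP[x0 _] /andP[_ yl]].
    by have [|/ltW] := leP x y => ?; [exact: H| rewrite distrC [X in _ <= X <= _]distrC; exact: H].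
  have := e1 x y x0 xy yl; rewrite ger0_norm ?subr_ge0// => /andP[H1 H2].
  have : 0 <= k * (y - x) by rewrite mulr_ge0 ?subr_ge0// ltW.
  by move=> /le_trans/(_ H1) H0; rewrite ger0_norm// H1.
have e2' := @lipschitz_sym R l L (fun x => (eta x).2) e2.
exists G; split => //.
- rewrite /product_measure1/= integral0_eq// => v _ /=.
  have [vl|vl] := pselect (0 < v < l); last first.
    rewrite (_ : xsection G v = set0) ?measure0//; apply/seteqP; split => w //.
    by rewrite /xsection/= inE => -[[/=]]; rewrite in_itv.
  have [|x /[!in_itv]/= xl xv] := @IVT _ (fun x => (eta x).1) 0 l v (ltW l0) ce.
    by rewrite eta0 etal/= ge_min le_max; lra.
  apply/eqP; rewrite eq_le measure_ge0 andbT; apply/lee_addgt0Pr => eps eps0.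
  rewrite add0e.
  have A0 : 0 <= A by rewrite divr_ge0// ltW.
  (* The cone with vertex at a rational parameter within d of x has, over v, a section of
     half-height at most A L d <= eps / 2. *)
  pose d := eps / (2 * A * L + 1).
  have dpos : 0 < 2 * A * L + 1 by rewrite ltr_wpDl// mulr_ge0// mulr_ge0.
  have d0 : 0 < d by rewrite divr_gt0.
  have [|r] := @rat_in_itvoo R (Order.max 0 (x - d)) (Order.min l (x + d)).
    by rewrite gt_max !lt_min; lra.
  rewrite in_itv/= gt_max lt_min => /andP[/andP[r0 rx] /andP[rl rd]].
  have qr : q (pickle r) = ratr r.
    by rewrite /q pickleK (min_idPr (ltW rl)) (max_idPr (ltW r0)).
  have close : A * `|v - (eta (ratr r)).1| <= eps / 2.
    have rr : 0 <= (ratr r : R) <= l by apply/andP; split; exact: ltW.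
    have /andP[_ H] := e1' (ratr r) x rr xl.
    rewrite -xv; apply: le_trans (ler_wpM2l A0 H) _.
    have : `|x - ratr r| <= d by rewrite ler_norml; lra.
    move=> /(ler_wpM2l (mulr_ge0 A0 L0)); rewrite -mulrA => /le_trans; apply.
    rewrite /d mulrA ler_pdivrMr// mulrAC -mulrA [leRHS]mulrDr mulr1; nra.
  apply: (@le_trans _ _ (leb R `[(eta (ratr r)).2 - eps / 2, (eta (ratr r)).2 + eps / 2]%classic)).
    apply: le_measure; rewrite ?inE//; first exact: measurable_xsection.
    move=> w; rewrite /xsection/= inE => -[_ /(_ (pickle r) I)].
    rewrite /S/= qr in_itv/= => /le_trans/(_ close); rewrite ler_norml; lra.
  rewrite lebesgue_measure_itv/= lte_fin; case: ifP => _; last by rewrite lee_fin ltW.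
  by rewrite -EFinB lee_fin; lra.
- move=> _ [x + <-]; rewrite /= in_itv/= => /andP[x0 xl]; split.
    split => //=; rewrite in_itv/=.
    have := e1 0 x (lexx _) (ltW x0) (ltW xl); have := e1 x l (ltW x0) (ltW xl) (lexx _).
    rewrite eta0 etal/= !subr0 => /andP[H1 _] /andP[H2 _].
    have : 0 < k * x by rewrite mulr_gt0.
    have : 0 < k * (l - x) by rewrite mulr_gt0// subr_gt0.
    by lra.
  move=> n _; rewrite /S/=; have xl' : 0 <= x <= l by rewrite (ltW x0) (ltW xl).
  apply: le_trans (e2' _ _ (q0 n) xl') _.
  have /andP[H _] := e1' _ _ (q0 n) xl'.
  by rewrite /A -mulrA ler_wpM2l// ler_pdivlMl.
Qed.

End CurveNull.

(** * The discrete energy inequality *)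

Section LowerIntegralSet.
Context d (X : measurableType d) (R : realType) (mu : {measure set X -> \bar R}).
Local Open Scope ereal_scope.

Lemma lower_integral_subset (A B : set X) (f : X -> \bar R) :
  (forall x, 0 <= f x) -> A `<=` B -> \int[mu]_(x in A) f x <= \int[mu]_(x in B) f x.
Proof.
move=> f0 AB; rewrite integral_mkcond [leRHS]integral_mkcond.
apply: ae_ge0_le_lower_integral => //.
- by move=> x _; exact: erestrict_ge0.
- by move=> x _; exact: erestrict_ge0.
- by apply: aeW => x _; apply: restrict_lee.
Qed.

(** Meant for the power of the force, which may change sign: its integral is at most that of its
    positive part, which lies below g. *)
Lemma integral_le_bound (D : set X) (f g : X -> \bar R) : measurable D ->
  (forall x, D x -> 0 <= g x) -> {ae mu, forall x, D x -> f x <= g x} ->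
  \int[mu]_(x in D) f x <= \int[mu]_(x in D) g x.
Proof.
move=> mD g0 fg; rewrite integralE; apply: (@le_trans _ _ (\int[mu]_(x in D) f^\+ x)).
  by rewrite -[leRHS]sube0 leeB// integral_ge0.
apply: ae_ge0_le_lower_integral => //.
by move: fg; apply: filterS => x fg Dx; rewrite funeposE ge_max fg// g0.
Qed.

End LowerIntegralSet.

Section LineIntegrals.
Variable R : realType.
Implicit Types (g : R -> \bar R) (a b c t : R).

Lemma ae_exists_itv (a b : R) (Q : R -> Prop) : a < b ->
  (\forall t \ae leb R, a < t < b -> Q t) -> exists2 t : R, a < t < b & Q t.
Proof.
move=> ab [N [mN N0 QN]]; apply: contrapT => noQ.
have sub : `]a, b[ `<=` N.
  move=> t; rewrite /= in_itv/= => tab; apply: QN => /= H; apply: noQ; exists t => //; exact: H.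
have : (leb R `]a, b[%classic <= leb R N)%E by apply: le_measure; rewrite ?inE.
by rewrite N0 (leb_oo (ltW ab)) lee_fin; lra.
Qed.

Lemma leb_aeS (Q Q' : R -> Prop) : (forall t, Q t -> Q' t) ->
  (\forall t \ae leb R, Q t) -> \forall t \ae leb R, Q' t.
Proof. exact: (@filterS _ _ (ae_filter_ringOfSetsType (leb R))). Qed.

Lemma leb_aeS2 (Q1 Q2 Q' : R -> Prop) : (forall t, Q1 t -> Q2 t -> Q' t) ->
  (\forall t \ae leb R, Q1 t) -> (\forall t \ae leb R, Q2 t) -> \forall t \ae leb R, Q' t.
Proof. exact: (@filterS2 _ _ (ae_filter_ringOfSetsType (leb R))). Qed.

Lemma ae_neq (t0 : R) : \forall t \ae leb R, t != t0.
Proof.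
exists [set t0]; split; rewrite ?lebesgue_measure_set1//.
by move=> t /= /negP; rewrite negbK => /eqP.
Qed.

Lemma ge0_itv_split g a b c : measurable_fun setT g -> (forall x, 0 <= g x)%E ->
  a <= b -> b <= c ->
  (\int[leb R]_(t in `[a, c]) g t =
   \int[leb R]_(t in `[a, b]) g t + \int[leb R]_(t in `[b, c]) g t)%E.
Proof.
move=> mg g0 ab bc.
rewrite -[X in (_ = _ + X)%E]integral_itv_obnd_cbnd; last exact: measurable_funTS.
rewrite -ge0_integral_setU//=.
- by rewrite -itv_bndbnd_setU// bnd_simp.
- exact: measurable_funTS.
- by apply/disj_setPRL => t /=; rewrite !in_itv/= => ? ?; lra.
Qed.

(** Monotone convergence along the intervals [a, b - (b - a) / (n + 1)]. *)
Lemma ge0_itv_left_limit g a b (c : \bar R) : measurable_fun setT g -> (forall x, 0 <= g x)%E ->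
  a < b -> (forall t, a <= t < b -> (\int[leb R]_(s in `[a, t]) g s <= c)%E) ->
  (\int[leb R]_(s in `[a, b]) g s <= c)%E.
Proof.
move=> mg g0 ab H; rewrite -integral_itv_bndo_bndc; last exact: measurable_funTS.
pose F n : set R := `[a, b - (b - a) / n.+1%:R]%classic.
have FE : \bigcup_n F n = `[a, b[%classic.
  apply/seteqP; split => t /=; rewrite ?in_itv/=.
    move=> [n _]; rewrite /F/= in_itv/= => /andP[-> tb]; apply: le_lt_trans tb _.
    by rewrite ltrBlDr ltrDl divr_gt0// subr_gt0.
  move=> /andP[at_ tb]; pose n := Num.truncn ((b - a) / (b - t)).
  exists n => //; rewrite /F/= in_itv/= at_/=.
  have := truncnS_gt ((b - a) / (b - t)); rewrite -/n => nb.
  rewrite lerBrDl -lerBrDr.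
  rewrite ler_pdivrMr// mulrC -ler_pdivrMr ?subr_gt0//; exact: ltW.
have ndF : nondecreasing_seq F.
  apply/nondecreasing_seqP => n; rewrite subsetEset => t; rewrite /F/= !in_itv/= => /andP[-> /le_trans]; apply.
  by rewrite lerD2l lerN2 ler_pM2l ?subr_gt0// lef_pV2 ?posrE// ler_nat.
have mF n : measurable (F n) by exact: measurable_itv.
have mgF n : measurable_fun (F n) g by exact: measurable_funTS.
have gF n x : F n x -> (0 <= g x)%E by move=> _; exact: g0.
have gc := @ge0_nondecreasing_set_cvg_integral _ (measurableTypeR R) R F g (leb R) ndF mF mgF gF.
rewrite -FE -(cvg_lim _ gc)//; apply: lime_le; first by apply/cvg_ex; eexists; exact: gc.
apply: nearW => n; have d0 : 0 < (b - a) / n.+1%:R by rewrite divr_gt0// subr_gt0.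
have d1 : (b - a) / n.+1%:R <= b - a by rewrite ler_pdivrMr// ler_peMr ?ler1n ?subr_ge0 ?ltW//.
by move: d0 d1 (H (b - (b - a) / n.+1%:R)); rewrite /F; move: (_ / _) => r ? ?; apply; lra.
Qed.

End LineIntegrals.

Ltac real_lra :=
  repeat match goal with
  | H : context [@EFin] |- _ => clear H
  | H : context [@lebesgue_measure] |- _ => clear H
  end; lra.

(** * Induction over the time cells, for abstract energies *)

Section DiscreteEnergy.
(** [E] is the elastic energy, [kin] the kinetic energy, [pow] the power of the force. The
    measurable [gu] and [gv] are lower bounds of [kin] by the fluid and by the solid part, and [gf]
    is the cost of the force. [K0] bounds the kinetic energy at negative times, [B0] the total
    initial energy. *)
Variables (R : realType) (T h K0 B0 B Cu : R) (E kin pow gu gv gf : R -> \bar R).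
Hypothesis h0 : 0 < h.
Hypothesis K00 : 0 <= K0.
Hypothesis Cu0 : 0 <= Cu.
Hypothesis E0 : forall t, (0 <= E t)%E.
Hypothesis kin0 : forall t, (0 <= kin t)%E.
Hypothesis mgu : measurable_fun setT gu.
Hypothesis mgv : measurable_fun setT gv.
Hypothesis mgf : measurable_fun setT gf.
Hypothesis gu0 : forall t, (0 <= gu t)%E.
Hypothesis gv0 : forall t, (0 <= gv t)%E.
Hypothesis gf0 : forall t, (0 <= gf t)%E.
Hypothesis gu_fin : (\int[leb R]_(t in `[0%R, T]) gu t < +oo)%E.
Hypothesis gu_kin : forall t, 0 < t < T -> (E t < +oo -> gu t <= kin t)%E.
Hypothesis gv_kin : forall t, 0 < t < T -> (gv t <= kin t)%E.
Hypothesis kin_past : forall t, t < 0 -> (kin t <= K0%:E)%E.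
Hypothesis pow_le : forall t, 0 < t < T -> (pow t <= gf t + Cu%:E * gu t)%E.
Hypothesis E_lsc : forall t (c : R), 0 < t <= T ->
  (forall e : R, 0 < e -> exists s : R, [/\ t - e < s < t, 0 <= s & (E s <= c%:E)%E]) ->
  (E t <= c%:E)%E.
Hypothesis energy : forall j : nat, \forall t0 \ae leb R,
  j%:R * h <= t0 <= j.+1%:R * h -> 0 <= t0 <= T ->
  (E t0 + (h^-1)%:E * \int[leb R]_(t in `[(j%:R * h)%R, t0]) kin t
   <= E (j%:R * h)%R
      + (h^-1)%:E * \int[leb R]_(t in `[(j%:R * h - h)%R, (t0 - h)%R]) kin t
      + \int[leb R]_(t in `[(j%:R * h)%R, t0]) pow t)%E.
Hypothesis E_init : (E 0%R + K0%:E <= B0%:E)%E.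
Hypothesis gf_le : (B0%:E + \int[leb R]_(t in `[0%R, T]) gf t <= B%:E)%E.

Let Fr (j : nat) := fine (\int[leb R]_(t in `[0%R, (j%:R * h)%R]) gf t).

Let gf_lty : (\int[leb R]_(t in `[0%R, T]) gf t < +oo)%E.
Proof. by move: gf_le; case: (\int[_]_(_ in _) _)%E => [x|//|//]; rewrite ltry. Qed.

Let int_ge0 (g : R -> \bar R) (D : set R) : (forall t, 0 <= g t)%E -> (0 <= \int[leb R]_(t in D) g t)%E.
Proof. by move=> g0; apply: integral_ge0. Qed.

Let cell_lty (g : R -> \bar R) a b : (forall t, 0 <= g t)%E ->
  (\int[leb R]_(t in `[0%R, T]) g t < +oo)%E -> 0 <= a -> b <= T ->
  (\int[leb R]_(t in `[a, b]) g t < +oo)%E.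
Proof.
move=> g0 gT a0 bT; apply: le_lt_trans gT; apply: lower_integral_subset => //.
by move=> t /=; rewrite !in_itv/=; lra.
Qed.

Let Fr_fin j : j%:R * h <= T -> (Fr j)%:E = (\int[leb R]_(t in `[0%R, (j%:R * h)%R]) gf t)%E.
Proof. by move=> jT; rewrite fineK// ge0_fin_numE ?int_ge0//; exact: cell_lty. Qed.

Let Fr_le j : j%:R * h <= T -> B0 + Fr j <= B.
Proof.
move=> jT; rewrite -lee_fin EFinD Fr_fin//; apply: le_trans gf_le; rewrite leeD2l//.
by apply: lower_integral_subset => // t /=; rewrite !in_itv/=; lra.
Qed.

(** The quantity e + k / h telescopes: e bounds the elastic energy at the node, k the kinetic energy
    integrated over the preceding cell, and in the induction S adds up the values of k over the
    cells of [0, j h]. The bound by k is stated for t < j h because the next cell uses it at t = t0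
    - h with t0 < (j + 1) h. The factor j h in the bound on S is the source of smallness on short
    times. *)
Definition node_estimate (j : nat) : Prop :=
  exists e k S : R, [/\ 0 <= e, 0 <= k, 0 <= S <= j%:R * h * (2 * B) &
  [/\ (E (j%:R * h)%R <= e%:E)%E,
      forall t, t < j%:R * h -> (\int[leb R]_(s in `[(j%:R * h - h)%R, t]) kin s <= k%:E)%E,
      e + k / h <= B0 + Cu * S + Fr j,
      (\int[leb R]_(t in `[0%R, (j%:R * h)%R]) gv t <= S%:E)%E &
      \forall t \ae leb R, 0 <= t <= j%:R * h -> (E t <= (2 * B)%:E)%E]].

Lemma node_estimate0 : node_estimate 0.
Proof.
have fE : (fine (E 0%R))%:E = E 0%R.
  rewrite fineK// ge0_fin_numE//; apply: le_lt_trans (ltry B0).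
  by apply: le_trans E_init; rewrite leeDl// lee_fin.
have null (g : R -> \bar R) : (\int[leb R]_(t in `[0%R, 0%R]) g t = 0)%E.
  by rewrite set_itv1 integral_set1.
(* The cell before time 0 has length h and kinetic energy at most [K0], so k = h K0 and k / h =
   K0. *)
exists (fine (E 0%R)), (h * K0), 0; rewrite mul0r; split.
- by rewrite fine_ge0.
- by rewrite mulr_ge0// ltW.
- by rewrite !mul0r lexx.
split.
- by rewrite fE.
- move=> t t0; rewrite sub0r.
  apply: (@le_trans _ _ (\int[leb R]_(s in `[(- h)%R, t]) (cst K0%:E s))%E).
    apply: ae_ge0_le_lower_integral => //.
    by apply: aeW => s /=; rewrite in_itv/= => st; apply: kin_past; lra.
  rewrite integral_cst//= lebesgue_measure_itv/= lte_fin; case: ifP => _; last first.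
    by rewrite mule0 lee_fin mulr_ge0// ltW.
  by rewrite -EFinB -EFinM lee_fin mulrC ler_wpM2r//; lra.
- rewrite mulr0 addr0 /Fr mul0r null/= addr0 mulrAC mulfV ?gt_eqF// mul1r.
  by rewrite -lee_fin EFinD fE.
- by rewrite null.
- have := ae_neq (0 : R); apply: leb_aeS.
  by move=> t /eqP t0 tt; exfalso; apply: t0; lra.
Qed.

Lemma node_estimateS (j : nat) : j.+1%:R * h <= T -> Cu * (j.+1%:R * h) <= 4^-1 ->
  node_estimate j -> node_estimate j.+1.
Proof.
move=> jT jCu [e [k [S [e0 k0 /andP[S0 SB] [Ee kk ek vS aeE]]]]].
set a := j%:R * h in SB Ee kk aeE vS; set b := j.+1%:R * h in jT jCu *.
have bE : b = a + h by rewrite /b -natr1 mulrDl mul1r.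
have a0 : 0 <= a by rewrite mulr_ge0// ltW.
have ab : a < b by rewrite bE ltrDl.
have aT : a <= T by real_lra.
have jCu' : Cu * a + Cu * h <= 4^-1 by rewrite -mulrDr -bE.
pose U := fine (\int[leb R]_(t in `[a, b]) gu t)%E.
have UE : (U%:E = \int[leb R]_(t in `[a, b]) gu t)%E.
  by rewrite fineK// ge0_fin_numE ?int_ge0//; exact: cell_lty.
have FE : ((Fr j.+1 - Fr j)%:E = \int[leb R]_(t in `[a, b]) gf t)%E.
  rewrite EFinB !Fr_fin// (@ge0_itv_split R gf 0 a b) ?(ltW ab)//.
  rewrite addeAC subee ?add0e// ge0_fin_numE ?int_ge0//; exact: cell_lty.
(* The right-hand side of the energy inequality over the whole cell; Cu U is the share of the force
   to be absorbed by the kinetic energy. *)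
pose r := e + k / h + (Fr j.+1 - Fr j + Cu * U).
have mgfu : (\int[leb R]_(t in `[a, b]) (gf t + Cu%:E * gu t) = (Fr j.+1 - Fr j + Cu * U)%:E)%E.
  rewrite ge0_integralD//=.
  - by rewrite ge0_integralZl//=; [rewrite -FE -UE|exact: measurable_funTS].
  - exact: measurable_funTS.
  - by move=> t _; rewrite mule_ge0// lee_fin.
  - by apply: measurable_funeM; exact: measurable_funTS.
have step : \forall t \ae leb R, a <= t < b ->
    (E t + (h^-1)%:E * \int[leb R]_(s in `[a, t]) kin s <= r%:E)%E.
  have := energy j; apply: leb_aeS.
  move=> t; rewrite -/a -/b => H tab; apply: le_trans (H _ _) _; [by real_lra|by real_lra|].
  rewrite /r EFinD; apply: leeD.
    rewrite EFinD; apply: leeD => //; rewrite mulrC EFinM; apply: lee_wpmul2l.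
      by rewrite lee_fin invr_ge0 ltW.
    by apply: kk; real_lra.
  rewrite -mgfu; apply: (@le_trans _ _ (\int[leb R]_(s in `[a, t]) (gf s + Cu%:E * gu s))%E).
    apply: integral_le_bound => //.
      by move=> s _; rewrite adde_ge0// mule_ge0// lee_fin.
    have := ae_neq a; have := ae_neq b.
    apply: leb_aeS2.
    move=> s sb sa /=; rewrite in_itv/= => /andP[sa' st]; apply: pow_le.
    have : a < s by rewrite lt_neqAle eq_sym sa.
    by real_lra.
  apply: lower_integral_subset => //.
    by move=> s; rewrite adde_ge0// mule_ge0// lee_fin.
  by move=> s /=; rewrite !in_itv/=; real_lra.
have h10 : (0 <= (h^-1)%:E)%E by rewrite lee_fin invr_ge0 ltW.
have kap0 t : (0 <= \int[leb R]_(s in `[a, t]) kin s)%E by exact: int_ge0.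
have kap_le s t : s <= t ->
    (\int[leb R]_(r in `[a, s]) kin r <= \int[leb R]_(r in `[a, t]) kin r)%E.
  by move=> st; apply: lower_integral_subset => // x /=; rewrite !in_itv/=; real_lra.
have stepE : \forall t \ae leb R, a <= t < b -> (E t <= r%:E)%E.
  move: step; apply: leb_aeS.
  by move=> t H /H; apply: le_trans; rewrite leeDl// mule_ge0.
(* The comparison of [gu] with [kin] asks for a finite elastic energy, which [stepE] provides at
   almost every time of the cell. *)
have kin_ge (g : R -> \bar R) : measurable_fun setT g -> (forall t, 0 <= g t)%E ->
    (forall t, 0 < t < T -> (E t < +oo -> g t <= kin t)%E) ->
    forall c : \bar R, (forall t, a <= t < b -> (\int[leb R]_(s in `[a, t]) kin s <= c)%E) ->
    (\int[leb R]_(t in `[a, b]) g t <= c)%E.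
  move=> mg g0 gk c kc; apply: ge0_itv_left_limit => // t tab.
  apply: le_trans (kc t tab); apply: ae_ge0_le_lower_integral => //.
  move: stepE; have := ae_neq a; apply: leb_aeS2.
  move=> s sa H /=; rewrite in_itv/= => /andP[sa' st]; apply: gk.
    have : a < s by rewrite lt_neqAle eq_sym sa.
    by real_lra.
  by apply: le_lt_trans (ltry r); apply: H; real_lra.
(* With t fixed, almost every s in (t, b) satisfies the inequality with the kinetic integral cut at
   t; letting s tend to b, semicontinuity of [E] alone yields the value at the node. *)
have E_end t : a <= t < b -> (E b + (h^-1)%:E * \int[leb R]_(s in `[a, t]) kin s <= r%:E)%E.
  move=> tab; have tb : t < b by real_lra.
  set W := (_ * _)%E; have W0 : (0 <= W)%E by rewrite mule_ge0.
  have good : \forall s \ae leb R, t < s < b -> (E s + W <= r%:E)%E.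
    move: step; apply: leb_aeS => s H st; have sab : a <= s < b by real_lra.
    apply: le_trans (H sab); rewrite leeD2l// lee_pmul2l ?fin_numE//; last by rewrite lte_fin invr_gt0.
    by apply: kap_le; real_lra.
  have [s _ sg] := ae_exists_itv tb good.
  have Wr : (W <= r%:E)%E by apply: le_trans sg; rewrite leeDr.
  have Wf : (fine W)%:E = W by rewrite fineK// ge0_fin_numE// (le_lt_trans Wr)// ltry.
  rewrite -Wf -leeBrDr// -EFinB; apply: E_lsc; first by real_lra.
  move=> d d0; have [||s' s'b s'g] := @ae_exists_itv R (Order.max t (b - d)) b (fun s => E s + W <= r%:E)%E.
  - by rewrite gt_max tb/= ltrBlDr ltrDl.
  - move: good; apply: leb_aeS => s'' H; rewrite gt_max => /andP[/andP[ts _] sb]; apply: H.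
    by rewrite ts.
  exists s'; move: s'b; rewrite gt_max => /andP[/andP[ts ds] sb]; split.
  - by rewrite ds.
  - by real_lra.
  - by rewrite EFinB leeBrDr// Wf.
(* The next value of k, for which [E_end] becomes E b + k / h <= r. *)
pose ks := ereal_sup [set (\int[leb R]_(s in `[a, t]) kin s)%E | t in `[a, b[].
have ks_ge t : a <= t < b -> (\int[leb R]_(s in `[a, t]) kin s <= ks)%E.
  by move=> tab; apply: ereal_sup_ubound; exists t => //=; rewrite in_itv.
have aab : a <= a < b by rewrite lexx.
have Eb_fin : (fine (E b))%:E = E b.
  rewrite fineK// ge0_fin_numE//; apply: le_lt_trans (ltry r).
  by apply: le_trans (E_end a aab); rewrite leeDl// mule_ge0.
have ks_le : (ks <= (h * (r - fine (E b)))%:E)%E.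
  apply: ge_ereal_sup => _ [t /= tab <-]; rewrite EFinM -lee_pdivrMl//.
  by rewrite EFinB leeBrDr// Eb_fin addeC; apply: E_end; move: tab; rewrite in_itv.
have ksf : (fine ks)%:E = ks.
  rewrite fineK// ge0_fin_numE; first by apply: le_lt_trans ks_le _; rewrite ltry.
  exact: le_trans (kap0 a) (ks_ge a aab).
set k' := fine ks in ksf; set e' := fine (E b) in Eb_fin ks_le.
have k'0 : 0 <= k' by rewrite fine_ge0// (le_trans (kap0 a)) ?ks_ge.
have e'0 : 0 <= e' by rewrite fine_ge0.
have Uk : U <= k' by rewrite -lee_fin UE ksf; apply: kin_ge.
have vk : (\int[leb R]_(t in `[a, b]) gv t <= k'%:E)%E.
  by rewrite ksf; apply: kin_ge => // t tT _; exact: gv_kin.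
have k'r : k' <= h * (r - e') by rewrite -lee_fin ksf.
have k'h : k' / h <= r - e' by rewrite ler_pdivrMr// mulrC.
have U0 : 0 <= U by rewrite fine_ge0// int_ge0.
have F0 : 0 <= Fr j.+1 - Fr j by rewrite -lee_fin FE int_ge0.
have kh0 : 0 <= k / h by rewrite divr_ge0// ltW.
have CuU : Cu * U <= Cu * k' by rewrite ler_wpM2l.
have B00 : 0 <= B.
  rewrite -lee_fin; apply: le_trans gf_le; rewrite adde_ge0 ?int_ge0//.
  by apply: le_trans E_init; rewrite adde_ge0.
have rS : r <= B0 + Cu * (S + k') + Fr j.+1 by rewrite /r mulrDr; real_lra.
have r0 : 0 <= r by rewrite /r; have := mulr_ge0 Cu0 U0; real_lra.
have p0 : 0 <= Cu * a by rewrite mulr_ge0.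
have q0 : 0 <= Cu * h by rewrite mulr_ge0// ltW.
have k'hr : k' <= h * r by apply: le_trans k'r _; rewrite ler_pM2l//; real_lra.
have CuS : Cu * S <= Cu * a * (2 * B) by rewrite -mulrA ler_wpM2l.
have Cuk : Cu * k' <= Cu * h * r by rewrite -mulrA ler_wpM2l.
(* The bounds give (1 - Cu h) r <= (1 + 2 Cu a) B, and 1 + 2 Cu a <= 2 (1 - Cu h) since Cu (a + h)
   <= 1 / 4. *)
have rB : r <= 2 * B.
  have qpos : 0 < 1 - Cu * h by real_lra.
  rewrite -(ler_pM2l qpos); apply: (@le_trans _ _ ((1 + 2 * (Cu * a)) * B)).
    by have := Fr_le jT; move: rS; rewrite mulrDr; real_lra.
  by rewrite [leRHS]mulrA ler_wpM2r//; real_lra.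
exists e', k', (S + k'); split => //.
  rewrite -/b addr_ge0//= bE mulrDl; apply: lerD => //; apply: le_trans k'hr _.
  by rewrite ler_pM2l.
split.
- by rewrite -/b Eb_fin.
- move=> t; rewrite -/b bE addrK -bE => tb; rewrite ksf.
  have [ta|ta] := leP a t; first by apply: ks_ge; rewrite ta.
  by apply: le_trans (kap_le t a (ltW ta)) _; exact: ks_ge.
- by real_lra.
- by rewrite -/b (@ge0_itv_split R gv 0 a b) ?(ltW ab)// EFinD leeD.
- have H : \forall t \ae leb R, (0 <= t <= a -> (E t <= (2 * B)%:E)%E) /\ (a <= t < b -> (E t <= r%:E)%E).
    by apply: (leb_aeS2 _ aeE stepE) => t H1 H2; split.
  move: H (ae_neq b); apply: leb_aeS2 => t [H1 H2]; rewrite -/b => /eqP tb tt.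
  have [ta|ta] := leP t a; first by apply: H1; real_lra.
  apply: (@le_trans _ _ r%:E); last by rewrite lee_fin.
  apply: H2; rewrite (ltW ta)/= lt_neqAle; apply/andP; split; first exact/eqP.
  by case/andP: tt.
Qed.

End DiscreteEnergy.

(** * Energy of approximate solutions *)

Section TimeSlices.
Context d (X : measurableType d) (R : realType) (mu : {sigma_finite_measure set X -> \bar R}).
Variables (T : R) (D : set X).
Hypothesis mD : measurable D.

Let Q := [set p : measurableTypeR R * X | 0 < p.1 < T /\ D p.2].

Let mQ : measurable Q.
Proof.
have -> : Q = `]0, T[%classic `*` D by apply/seteqP; split => p; rewrite /Q /= in_itv.
by apply: measurableX => //; exact: measurable_itv.
Qed.

Lemma L2_time_section f t : L2_time mu T D f -> 0 < t < T -> measurable_fun D (f t).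
Proof.
move=> [mf _] tT.
have /(measurable_fun_pair2 t) H : measurable_fun setT
    ((fun p : measurableTypeR R * X => f p.1 p.2) \_ Q) by apply/(measurable_restrictT _ mQ).
apply: (@eq_measurable_fun _ _ _ _ D (fun x => ((fun p : measurableTypeR R * X => f p.1 p.2) \_ Q) (t, x))).
  by move=> x; rewrite inE => Dx; rewrite patchT// inE /Q/=.
exact: measurable_funTS.
Qed.

(** By Tonelli's theorem the slice integrals of the extension by 0 are measurable on the whole line;
    they agree with those of f at interior times. *)
Lemma L2_time_slices f : L2_time mu T D f ->
  exists g : R -> \bar R, [/\ measurable_fun setT g, forall t, (0 <= g t)%E,
    (\int[leb R]_(t in `[0%R, T]) g t < +oo)%E &
    forall t, 0 < t < T -> g t = (\int[mu]_(x in D) (f t x ^+ 2)%:E)%E].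
Proof.
move=> [mf foo]; pose F := (fun p : measurableTypeR R * X => (f p.1 p.2 ^+ 2)%:E) \_ Q.
have mF : measurable_fun setT F.
  apply/(measurable_restrictT _ mQ); apply/measurable_EFinP; exact: measurable_funX.
have F0 p : (0 <= F p)%E by apply: erestrict_ge0 => q _; rewrite lee_fin sqr_ge0.
have gE t : 0 < t < T -> fubini_F mu F t = (\int[mu]_(x in D) (f t x ^+ 2)%:E)%E.
  move=> tT; rewrite [RHS]integral_mkcond; apply: eq_integral => x _.
  rewrite /F /patch; congr (if _ then _ else _).
  by apply/idP/idP; rewrite !inE /Q/=; [case|split].
exists (fubini_F mu F); split => //.
- exact: measurable_fun_fubini_tonelli_F.
- by move=> t; apply: integral_ge0.
- have mg : measurable_fun setT (fubini_F mu F) by exact: measurable_fun_fubini_tonelli_F.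
  rewrite -integral_itv_bndo_bndc; last exact: measurable_funTS.
  rewrite -integral_itv_obnd_cbnd; last exact: measurable_funTS.
  apply: le_lt_trans foo; rewrite le_eqVlt; apply/orP; left; apply/eqP.
  by apply: eq_integral => t; rewrite inE/= in_itv/= => /gE.
Qed.
End TimeSlices.

(** * Displacements and velocities *)

Section TimeCurves.
Variable R : realType.

Lemma velocity_continuous (T : R) (y v : R -> R * R) i : 0 <= T -> has_velocity T y v ->
  {within `[0, T], continuous (fun t => pcomp i (y t))}.
Proof.
move=> T0 /(_ i)[iv yE].
have H := parameterized_integral_continuous T0 iv.
apply: (@subspace_eq_continuous _ _ _ (fun t => pcomp i (y 0) + parameterized_integral (leb R) 0 t (fun s => pcomp i (v s)))).
  by move=> t; rewrite inE/= in_itv/= => tT; rewrite /parameterized_integral -yE.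
by move=> t; apply: cvgD; [exact: cvg_cst|exact: H].
Qed.

(* Tonelli and [|y| <= (1 + y^2) / 2]: a displacement that is everywhere large
   on an interval costs either time or velocity. *)
Lemma displacement_bound (T T0 l A a b c t0 : R) (f : R -> R -> R) (g : R -> \bar R) :
  L2_time (leb R) T `]0, l[ f -> 0 <= a -> a <= b -> b <= l -> 0 <= c ->
  0 <= t0 -> t0 <= T0 -> T0 <= T ->
  measurable_fun setT g -> (forall t, 0 <= g t)%E ->
  (forall t, 0 < t < T -> g t = (\int[leb R]_(x in `]0%R, l[) (f t x ^+ 2)%:E)%E) ->
  (\int[leb R]_(t in `[0%R, T0]) g t <= A%:E)%E ->
  (forall x, a < x < b -> (leb R).-integrable `[0, T] (fun s => (f s x)%:E)) ->
  (forall x, a < x < b -> c <= `|\int[leb R]_(s in `[0, t0]) f s x|) ->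
  c * (b - a) <= (A + T0 * l) / 2.
Proof.
move=> Lf a0 ab bl c0 t00 t0T0 T0T mg g0 gE gA fi fc.
have l0 : 0 <= l by lra.
have T00 : 0 <= T0 by lra.
have [mf _] := Lf.
pose Q : set (measurableTypeR R * measurableTypeR R) := `]0, T0[%classic `*` `]a, b[%classic.
have mQ : measurable Q by apply: measurableX; exact: measurable_itv.
(* One has q >= |f|. The integral of q over Q is bounded below through the sections at fixed x and
   above through those at fixed time. *)
pose q (s x : R) := (f s x ^+ 2 + 1) / 2.
pose F := (fun p : measurableTypeR R * measurableTypeR R => (q p.1 p.2)%:E) \_ Q.
have q0 s x : 0 <= q s x by rewrite divr_ge0// addr_ge0// sqr_ge0.
have mF : measurable_fun setT F.
  apply/(measurable_restrictT _ mQ); apply/measurable_EFinP; apply: measurable_funM => //.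
  apply: measurable_funD => //; apply: measurable_funX; apply: measurable_funS mf => //.
    have -> : [set p : measurableTypeR R * measurableTypeR R | 0 < p.1 < T /\ `]0, l[%classic p.2] = `]0, T[%classic `*` `]0, l[%classic.
      by apply/seteqP; split => p; rewrite /= in_itv.
    by apply: measurableX; exact: measurable_itv.
  move=> p; rewrite /Q/= !in_itv/= => -[H1 H2]; split; lra.
have F0 p : (0 <= F p)%E by apply: erestrict_ge0 => r _; rewrite lee_fin q0.
have low : ((c * (b - a))%:E <= \int[leb R]_x \int[leb R]_s F (s, x))%E.
  apply: (@le_trans _ _ (\int[leb R]_x (cst c%:E \_ `]a, b[) x)%E).
    by rewrite -integral_mkcond integral_cst//= leb_oo// -EFinM.
  apply: ae_ge0_le_lower_integral => //.
  - by move=> x _; apply: erestrict_ge0 => y _; rewrite lee_fin.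
  - by move=> x _; apply: integral_ge0.
  apply: aeW => x _; rewrite {1}/patch; case: ifPn => [|_]; last by apply: integral_ge0.
  rewrite inE/= in_itv/= => xab.
  have fi0 : (leb R).-integrable `[0, t0] (EFin \o (fun s => f s x)).
    by apply: integrableS (fi x xab) => //; apply: subset_itvl; rewrite bnd_simp; lra.
  apply: (@le_trans _ _ (\int[leb R]_(s in `[0%R, t0]) `|(f s x)%:E|)%E).
    have := fc x xab; rewrite -lee_fin; move=> /le_trans; apply.
    by rewrite -abse_EFin /Rintegral fineK; [apply: le_abse_integral => //; case/integrableP: fi0|
      exact: integrable_fin_num].
  rewrite integral_mkcond; apply: ae_ge0_le_lower_integral => //.
    by move=> s _; apply: erestrict_ge0 => r _; rewrite abse_ge0.
  apply: leb_aeS2 (ae_neq (0 : R)) (ae_neq t0) => s /eqP s0 /eqP st0 _.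
  rewrite /F /patch; case: ifPn => [|_]; last by apply: F0.
  rewrite inE/= in_itv/= => st.
  rewrite ifT; last by rewrite inE /Q/= !in_itv/=; split=> //; lra.
  rewrite /= lee_fin /q ler_pdivlMr//; have := sqr_ge0 (`|f s x| - 1); rewrite -[f s x ^+ 2]real_normK ?num_real//.
  nra.
have up : (\int[leb R]_s \int[leb R]_x F (s, x) <= ((A + T0 * l) / 2)%:E)%E.
  apply: (@le_trans _ _ (\int[leb R]_s ((fun s => (2^-1)%:E * g s + (l / 2)%:E)%E \_ `[0%R, T0]) s)%E).
    apply: ae_ge0_le_lower_integral => //.
    - by move=> s _; apply: integral_ge0.
    - move=> s _; apply: erestrict_ge0 => r _.
      by rewrite adde_ge0// ?mule_ge0// lee_fin// divr_ge0.
    apply: aeW => s _; have [sT|sT] := boolP (0 < s < T0); last first.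
      rewrite integral0_eq.
        by apply: erestrict_ge0 => r _; rewrite adde_ge0// ?mule_ge0// lee_fin// divr_ge0.
      move=> x _; rewrite /F patchC// inE /Q/= !in_itv/= => -[H _].
      by rewrite H in sT.
    rewrite [leRHS]patchT; last by rewrite inE/= in_itv/=; lra.
    rewrite gE; last by lra.
    have mfs : measurable_fun `]0, l[ (f s).
      by apply: (L2_time_section _ Lf); [exact: measurable_itv|lra].
    apply: (@le_trans _ _ (\int[leb R]_(x in `]0%R, l[) ((2^-1)%:E * (f s x ^+ 2)%:E + (2^-1)%:E))%E).
      rewrite [leRHS]integral_mkcond; apply: ae_ge0_le_lower_integral => //.
        by move=> x _; apply: erestrict_ge0 => y _; rewrite -EFinM -EFinD lee_fin addr_ge0// mulr_ge0// sqr_ge0.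
      apply: aeW => x _; rewrite /F {1}/patch; case: ifPn => [|_]; last first.
        by apply: erestrict_ge0 => y _; rewrite -EFinM -EFinD lee_fin addr_ge0// mulr_ge0// sqr_ge0.
      rewrite inE /Q/= !in_itv/= => -[_ xab]; rewrite patchT; last by rewrite inE/= in_itv/=; lra.
      by rewrite -EFinM -EFinD lee_fin /q mulrDl mul1r [_ * f s x ^+ 2]mulrC.
    rewrite ge0_integralD//=.
    - rewrite ge0_integralZl_EFin//=.
      + by rewrite integral_cst//= leb_oo// subr0 -EFinM mulrC.
      + by move=> x _; rewrite lee_fin sqr_ge0.
      + by apply/measurable_EFinP; exact: measurable_funX.
    - by move=> x _; rewrite -EFinM lee_fin mulr_ge0// sqr_ge0.
    - by apply: measurable_funeM; apply/measurable_EFinP; exact: measurable_funX.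
  rewrite -integral_mkcond ge0_integralD//=.
  - rewrite ge0_integralZl_EFin//=; last exact: measurable_funTS.
    rewrite integral_cst//= lebesgue_measure_itv/=.
    apply: (@le_trans _ _ ((2^-1 * A)%:E + (l / 2 * T0)%:E)%E).
      apply: leeD; first by rewrite EFinM lee_wpmul2l.
      case: ifP => _; first by rewrite -EFinD -EFinM lee_fin oppr0 addr0.
      by rewrite mule0 lee_fin mulr_ge0// divr_ge0.
    by rewrite -EFinD lee_fin; lra.
  - by move=> s _; rewrite mule_ge0.
  - by apply: measurable_funeM; exact: measurable_funTS.
  - by move=> s _; rewrite lee_fin divr_ge0.
rewrite -lee_fin; apply: le_trans low _; apply: le_trans up.
by rewrite (fubini_tonelli _ mF F0).
Qed.

End TimeCurves.

Section VectorSlices.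
Context d (X : measurableType d) (R : realType).
Variables (D : set X).
Hypothesis mD : measurable D.

Lemma sqnormE (v : R * R) : sqnorm v = pcomp false v ^+ 2 + pcomp true v ^+ 2.
Proof. by rewrite /sqnorm /dot !expr2. Qed.

Lemma sqnorm_ge0 (v : R * R) : 0 <= sqnorm v.
Proof. by rewrite sqnormE addr_ge0// sqr_ge0. Qed.

Lemma integral_sqnorm (mu : {measure set X -> \bar R}) (f : X -> R * R) :
  (forall i, measurable_fun D (fun x => pcomp i (f x))) ->
  (\int[mu]_(x in D) (sqnorm (f x))%:E =
   \int[mu]_(x in D) (pcomp false (f x) ^+ 2)%:E + \int[mu]_(x in D) (pcomp true (f x) ^+ 2)%:E)%E.
Proof.
move=> mf; rewrite -ge0_integralD//=.
- by move=> x _; rewrite lee_fin sqr_ge0.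
- by apply/measurable_EFinP; exact: measurable_funX (mf false).
- by move=> x _; rewrite lee_fin sqr_ge0.
- by apply/measurable_EFinP; exact: measurable_funX (mf true).
Qed.

Lemma measurable_sqnorm (f : X -> R * R) : (forall i, measurable_fun D (fun x => pcomp i (f x))) ->
  measurable_fun D (fun x => sqnorm (f x)).
Proof.
move=> mf; apply: (@eq_measurable_fun _ _ _ _ D (fun x => pcomp false (f x) ^+ 2 + pcomp true (f x) ^+ 2)).
  by move=> x _; rewrite sqnormE.
by apply: measurable_funD; apply: measurable_funX; exact: mf.
Qed.

Lemma L2_sqnorm (mu : {measure set X -> \bar R}) (f : X -> R * R) :
  (forall i, L2 mu D (fun x => pcomp i (f x))) ->
  (\int[mu]_(x in D) (sqnorm (f x))%:E < +oo)%E.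
Proof.
move=> Lf; rewrite integral_sqnorm; last by move=> i; case: (Lf i).
by rewrite lte_add_pinfty//; [case: (Lf false)|case: (Lf true)].
Qed.

Lemma L2_time_sqnorm (mu : {sigma_finite_measure set X -> \bar R}) (T : R) (f : R -> X -> R * R) :
  (forall i, L2_time mu T D (fun t x => pcomp i (f t x))) ->
  (forall t, 0 < t < T -> measurable_fun D (fun x => sqnorm (f t x))) /\
  exists g : R -> \bar R, [/\ measurable_fun setT g, forall t, (0 <= g t)%E,
    (\int[leb R]_(t in `[0%R, T]) g t < +oo)%E &
    forall t, 0 < t < T -> g t = (\int[mu]_(x in D) (sqnorm (f t x))%:E)%E].
Proof.
move=> Lf; have sec t : 0 < t < T -> forall i, measurable_fun D (fun x => pcomp i (f t x)).
  by move=> tT i; exact: (L2_time_section mD (Lf i)).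
split=> [t tT|]; first exact/measurable_sqnorm/sec.
have [g1 [m1 p1 f1 e1]] := L2_time_slices mD (Lf false).
have [g2 [m2 p2 f2 e2]] := L2_time_slices mD (Lf true).
exists (fun t => g1 t + g2 t)%E; split.
- exact: emeasurable_funD.
- by move=> t; rewrite adde_ge0.
- by rewrite ge0_integralD//; [rewrite lte_add_pinfty|exact: measurable_funTS|exact: measurable_funTS].
- by move=> t tT; rewrite e1// e2// integral_sqnorm//; exact: sec.
Qed.

End VectorSlices.

(** * Geometry of deformations of finite energy *)

Section Geometry.
Variables (R : realType) (P : params R).
Hypothesis okP : params_ok P.
Local Notation l := (len P).

Lemma finite_energy_bilipschitz (M : R) : 0 <= M -> exists k L : R, [/\ 0 < k, 0 <= L &
  forall eta, calH l eta -> (E_K P eta <= M%:E)%E -> forall x y, 0 <= x -> x <= y -> y <= l ->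
    k * (y - x) <= (eta y).1 - (eta x).1 <= L * (y - x) /\
    `|(eta y).2 - (eta x).2| <= L * (y - x)].
Proof.
move=> M0; have [k [L [C [k0 L0 H]]]] := deformation_bounds okP M0.
exists k, L; split => // eta He EM x y x0 xy yl.
have [H2 ce [deta sl]] := calH_slope He.
have [H1 HL _] := H _ _ H2 ce sl EM.
have inl z : x < z < y -> 0 <= z <= l by lra.
split.
  apply: (slope_increment (i := false) ce sl _ x0 xy yl) => z /inl zl.
  by rewrite H1//=; have := HL false z zl; rewrite ler_norml => /andP[].
rewrite ler_norml -mulNr; apply: (slope_increment (i := true) ce sl _ x0 xy yl) => z /inl zl.
by rewrite -ler_norml; exact: HL.
Qed.

(** Here the constants may depend on the deformation, so its own energy serves as M. The abscissa is
    strictly increasing, hence injective, and [curve_null] applies. *)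
Lemma finite_energy_curve eta : calH l eta -> (E_K P eta < +oo)%E ->
  (forall x y, 0 < x < l -> 0 < y < l -> (eta x).1 = (eta y).1 -> x = y) /\
  exists G : set (measurableTypeR R * measurableTypeR R),
    [/\ measurable G, leb2 R G = 0%E & curve l eta `<=` G].
Proof.
move=> He Ef; have EE : ((fine (E_K P eta))%:E = E_K P eta)%E.
  by rewrite fineK// ge0_fin_numE// E_K_ge0.
have [|k [L [k0 L0 H]]] := @finite_energy_bilipschitz (fine (E_K P eta)).
  by rewrite fine_ge0// E_K_ge0.
have {}H := H eta He; rewrite EE lexx in H; have {}H := H isT.
have l0 : 0 < l by case: okP.
have [_ ce [deta _]] := calH_slope He.
split.
  move=> x y xl yl xy; apply/eqP; apply: contraT; rewrite neq_lt => /orP[lt|lt].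
    have [| | |/andP[]] := H x y; [lra..|]; rewrite xy subrr.
    have : 0 < k * (y - x) by rewrite mulr_gt0// subr_gt0.
    by lra.
  have [| | |/andP[]] := H y x; [lra..|]; rewrite xy subrr.
  have : 0 < k * (x - y) by rewrite mulr_gt0// subr_gt0.
  by lra.
have [_ _ e0 el _] := He.
apply: (@curve_null R k L l eta k0 L0 l0 (within_continuous_pcomp (i := false) ce)) => //.
- by move=> x y ? ? ?; have [] := H x y.
- by move=> x y ? ? ?; have [] := H x y.
Qed.

Lemma is_wder_congr n (f g w : R -> R) : (forall x, 0 < x < l -> f x = g x) ->
  is_wder l n f w -> is_wder l n g w.
Proof.
move=> fg [Lw H]; split => // phi tphi; rewrite -H//; apply: eq_Rintegral => x.
by rewrite inE/= in_itv/= => /fg ->.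
Qed.

Lemma wder_congr n (f g : R -> R) : (forall x, 0 < x < l -> f x = g x) ->
  wder l n f = wder l n g.
Proof.
move=> fg; rewrite /wder; congr (xget _ _); apply/seteqP; split => w; apply: is_wder_congr => //.
by move=> x /fg.
Qed.

(** Meant for time 0, when the solution equals the datum on [0, l] only: the set of weak
    derivatives, and so the one chosen from it, depends only on the values inside the interval. *)
Lemma elastic_congr s (eta eta' : R -> R * R) : (forall x, 0 < x < l -> eta x = eta' x) ->
  elastic P s eta = elastic P s eta'.
Proof.
move=> ee; have W n : wderv l n eta = wderv l n eta'.
  by apply/funext => x; rewrite /wderv; congr (_ x, _ x); apply: wder_congr => y /ee ->.
by rewrite /elastic /E_K !W.
Qed.

End Geometry.

Section PlanarLebesgue.
Variable R : realType.

(* An alias: on [product_measure1] itself the canonical sigma-finite structure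
   is that of products of probabilities. *)
Definition leb_plane : set (measurableTypeR R * measurableTypeR R) -> \bar R := leb2 R.

HB.instance Definition _ := Measure.on leb_plane.

Let leb_plane_sigma_finite : sigma_finite setT leb_plane.
Proof.
have /sigma_finiteP[F [TF ndF Foo]] := sigma_finiteT (leb R).
exists (fun n => F n `*` F n).
  rewrite -setXTT TF predeqE => -[x y]; split.
    move=> [/= [n _ Fnx] [k _ Fky]]; exists (maxn n k) => //; split.
    - by move: x Fnx; exact/subsetPset/ndF/leq_maxl.
    - by move: y Fky; exact/subsetPset/ndF/leq_maxr.
  by move=> [n _ []/= ? ?]; split; exists n.
move=> k; have [? ?] := Foo k; split; first exact: measurableX.
by rewrite /leb_plane product_measure1E// lte_mul_pinfty// ge0_fin_numE.
Qed.

HB.instance Definition _ := Measure_isSigmaFinite.Build _ _ _ leb_plane leb_plane_sigma_finite.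

End PlanarLebesgue.

(** * Approximate solutions satisfy the abstract hypotheses on the energies *)

Section Solution.
Variables (R : realType) (P : params R) (T : R) (D : data R) (delta0 h : R).
Variables (eta : R -> R -> R * R) (u Phi : R -> R * R -> R * R) (veta : R -> R -> R * R).
Hypothesis okP : params_ok P.
Hypothesis T0 : 0 < T.
Hypothesis okD : data_ok P T D.
Hypothesis delta01 : 0 < delta0 <= 1.
Hypothesis h0 : 0 < h.
Hypothesis sol : approx_solution_with_velocity P T D delta0 h eta u Phi veta.
Local Notation l := (len P).
Local Notation Om := (Omega (len P)).
Local Notation rmax := (rho_plus P + rho_minus P).
Local Notation rmin := (Order.min (rho_plus P) (rho_minus P)).
Local Notation E := (fun t => elastic P (Num.sqrt delta0 / 2) (eta t)).
Local Notation kin := (kinetic P D eta u veta).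

Let l0 : 0 < l. Proof. by case: okP. Qed.
Let rp0 : 0 < rho_plus P. Proof. by case: okP => _ _ []. Qed.
Let rm0 : 0 < rho_minus P. Proof. by case: okP => _ _ []. Qed.
Let rs0 : 0 < rho_s P. Proof. by case: okP. Qed.
Let s0 : 0 < Num.sqrt delta0 / 2.
Proof. by rewrite divr_gt0// sqrtr_gt0; case/andP: delta01. Qed.
Let s1 : Num.sqrt delta0 / 2 <= 1 / 2.
Proof. by rewrite ler_pM2r ?invr_gt0// -[leRHS]sqrtr1 ler_wsqrtr//; case/andP: delta01. Qed.
Let rmax0 : 0 < rmax. Proof. by rewrite addr_gt0. Qed.
Let rmin0 : 0 < rmin. Proof. by rewrite lt_min rp0. Qed.
Let mOm : measurable (Om : set (measurableTypeR R * measurableTypeR R)).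
Proof. exact: measurable_Omega. Qed.

Let rho_ge0 t z : 0 <= rho P eta t z.
Proof. by apply: phase_ge0; exact: ltW. Qed.

Let rho_le t z : rho P eta t z <= rmax.
Proof. by apply: phase_le; exact: ltW. Qed.

Let mu_ge0 t z : 0 <= mu P eta t z.
Proof. by apply: phase_ge0; case: okP => _ _ [] *; exact: ltW. Qed.

Lemma mdot_ge0 (A : bool -> bool -> R) : 0 <= mdot A A.
Proof. by rewrite /mdot sumr_ge0// => i _; rewrite sumr_ge0// => j _; rewrite -expr2 sqr_ge0. Qed.

Lemma dissipation_ge0 t : (0 <= dissipation P delta0 eta u t)%E.
Proof.
apply: integral_ge0 => z _; rewrite lee_fin addr_ge0// mulr_ge0// ?mdot_ge0//.
by case/andP: delta01 => /ltW.
Qed.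

Lemma kinetic_ge0 t : (0 <= kin t)%E.
Proof.
rewrite adde_ge0//; apply: integral_ge0 => x _; rewrite lee_fin mulr_ge0 ?sqnorm_ge0//.
  by rewrite divr_ge0// ltW.
by rewrite divr_ge0// rho_ge0.
Qed.

Lemma elastic_ge0 t : (0 <= E t)%E.
Proof. by apply: le_trans (E_K_le_elastic _ _ (ltW s0)); exact: E_K_ge0. Qed.

Lemma eta_continuous_time i x : 0 <= x <= l -> {within `[0, T], continuous (fun t => pcomp i (eta t x))}.
Proof. by move=> xl; apply: (velocity_continuous (v := fun t => veta t x) (ltW T0)); exact: (sol_veta sol). Qed.

(** Along times s_k in (t - 1 / (k + 1), t) the deformations converge pointwise, each material point
    following an absolutely continuous curve, and [elastic_lsc] applies. *)
Lemma elastic_time_lsc t (c : R) : 0 < t <= T ->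
  (forall e : R, 0 < e -> exists s : R, [/\ t - e < s < t, 0 <= s & (E s <= c%:E)%E]) ->
  (E t <= c%:E)%E.
Proof.
move=> tT H; have Hs (k : nat) : exists s : R,
    [/\ t - (k.+1%:R)^-1 < s < t, 0 <= s & (E s <= c%:E)%E].
  by apply: H; rewrite invr_gt0.
have [sk Hk] := choice Hs.
have c0 : 0 <= c by have [_ _] := Hk 0; rewrite -lee_fin; apply: le_trans; exact: elastic_ge0.
have skT k : 0 <= sk k <= T by have [] := Hk k; lra.
have tT' : 0 <= t <= T by lra.
apply: (@elastic_lsc R P okP _ c (fun k => eta (sk k))) => //.
- by move=> k; have [] := sol_eta_space sol (skT k).
- by move=> k; have [] := sol_eta_space sol (skT k).
- by have [] := sol_eta_space sol tT'.
- by have [] := sol_eta_space sol tT'.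
- move=> i x xl; apply/cvgrPdist_le => e e0.
  have [d d0 Hd] := within_continuous_dist (eta_continuous_time (i := i) xl) tT' e0.
  near=> k; rewrite distrC; apply: Hd => //.
  have [skt _ _] := Hk k; rewrite ltr_distlC.
  have : k.+1%:R^-1 < d by near: k; exact: near_infty_natSinv_lt (PosNum d0).
  by move: skt; move: (k.+1%:R^-1) => r; lra.
- by move=> k; have [] := Hk k.
Unshelve. all: by end_near. Qed.

Let Lu i : L2_time (@leb_plane R) T Om (fun t z => pcomp i (u t z)).
Proof. by have [_ /(_ i)[]] := sol_u_space sol. Qed.

Let mvu t : 0 < t < T -> measurable_fun (Om : set (measurableTypeR R * measurableTypeR R)) (fun z => sqnorm (u t z)).
Proof. by have [H _] := @L2_time_sqnorm _ (measurableTypeR R * measurableTypeR R)%type R Om mOm (@leb_plane R) T u Lu; exact: H. Qed.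

Let mveta t : 0 < t < T -> measurable_fun `]0, l[ (fun x => sqnorm (veta t x)).
Proof.
by have [H _] := @L2_time_sqnorm _ (measurableTypeR R) R `]0, l[%classic (measurable_itv _) (leb R) T veta (sol_veta_L2 sol); exact: H.
Qed.

Lemma kinetic_ge_solid (Gv : R -> \bar R) t :
  (forall t, 0 < t < T -> Gv t = (\int[leb R]_(x in `]0%R, l[) (sqnorm (veta t x))%:E)%E) ->
  0 < t < T -> ((rho_s P / 2)%:E * Gv t <= kin t)%E.
Proof.
move=> GvE tT; rewrite /kinetic GvE// -ge0_integralZl_EFin//.
- apply: (@le_trans _ _ (\int[leb R]_(x in `]0%R, l[) (rho_s P / 2 * sqnorm (veta_ext D veta t x))%:E)%E).
    rewrite le_eqVlt; apply/orP; left; apply/eqP/eq_integral => x _.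
    by rewrite /veta_ext ltNge ltW ?EFinM//; case/andP: tT.
  rewrite leeDl//; apply: integral_ge0 => z _.
  by rewrite lee_fin mulr_ge0 ?sqnorm_ge0// divr_ge0// rho_ge0.
- by move=> x _; rewrite lee_fin sqnorm_ge0.
- by apply/measurable_EFinP; exact: mveta.
- by rewrite divr_ge0// ltW.
Qed.

(** Finite energy at time t makes the curve a null set and its abscissa injective, so that the
    density is at least [rmin] almost everywhere; this is the proviso of the abstract hypothesis
    [gu_kin]. *)
Lemma kinetic_ge_fluid (Gu : R -> \bar R) t :
  (forall t, 0 < t < T -> Gu t = (\int[leb2 R]_(z in Om) (sqnorm (u t z))%:E)%E) ->
  0 < t < T -> (E t < +oo)%E -> ((rmin / 2)%:E * Gu t <= kin t)%E.
Proof.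
move=> GuE tT Et; have tT' : 0 <= t <= T by lra.
have [He _] := sol_eta_space sol tT'.
have [|inj [G [mG G0 cG]]] := finite_energy_curve okP He.
  by apply: le_lt_trans Et; apply: E_K_le_elastic; exact: ltW.
have t0 : (t < 0) = false by apply/negbTE; rewrite -leNgt; lra.
rewrite /kinetic GuE// -ge0_integralZl_EFin//.
- apply: (@le_trans _ _ (\int[leb2 R]_(z in Om) (rho P eta t z / 2 * sqnorm (u_ext D u t z))%:E)%E); last first.
    rewrite leeDr//; apply: integral_ge0 => x _.
    by rewrite lee_fin mulr_ge0 ?sqnorm_ge0// divr_ge0// ltW.
  apply: ae_ge0_le_lower_integral => //.
  + by move=> z _; rewrite -EFinM lee_fin mulr_ge0 ?sqnorm_ge0// divr_ge0// ltW.
  + by move=> z _; rewrite lee_fin mulr_ge0 ?sqnorm_ge0// divr_ge0// rho_ge0.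
  exists G; split => // z /= Hz; apply: contrapT => Gz; apply: Hz => Oz.
  rewrite -EFinM lee_fin /u_ext t0 ler_wpM2r ?sqnorm_ge0// ler_pM2r ?invr_gt0//.
  by rewrite /rho t0; apply: phase_ge => //; [exact: ltW|exact: ltW|move=> /cG].
- by move=> x _; rewrite lee_fin sqnorm_ge0.
- by apply/measurable_EFinP; exact: mvu.
- by rewrite divr_ge0// ltW.
Qed.

Definition past_kinetic : \bar R :=
  ((rho_s P / 2)%:E * \int[leb R]_(x in `]0%R, l[) (sqnorm (eta_star D x))%:E +
   (rmax / 2)%:E * \int[leb2 R]_(z in Om) (sqnorm (u0 D z))%:E)%E.

Lemma past_kinetic_lty : (past_kinetic < +oo)%E.
Proof.
have [_ Lu0 Ls _] := okD.
by rewrite lte_add_pinfty// lte_mul_pinfty ?lee_fin ?divr_ge0 ?ltW//;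
  apply: L2_sqnorm => //; exact: measurable_itv.
Qed.

Lemma kinetic_past t : t < 0 -> (kin t <= past_kinetic)%E.
Proof.
move=> t0; have [_ Lu0 Ls _] := okD.
rewrite /kinetic /past_kinetic; apply: leeD.
  rewrite -ge0_integralZl_EFin//.
  - by apply: ae_ge0_le_lower_integral => //; [move=> x _; rewrite lee_fin mulr_ge0 ?sqnorm_ge0// divr_ge0// ltW|
      move=> x _; rewrite -EFinM lee_fin mulr_ge0 ?sqnorm_ge0// divr_ge0// ltW|
      apply: aeW => x _; rewrite /veta_ext t0 EFinM].
  - by move=> x _; rewrite lee_fin sqnorm_ge0.
  - apply/measurable_EFinP; apply: measurable_sqnorm => i.
    by case: (Ls i).
  - by rewrite divr_ge0// ltW.
rewrite -ge0_integralZl_EFin//.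
- apply: ae_ge0_le_lower_integral => //.
  + by move=> x _; rewrite lee_fin mulr_ge0 ?sqnorm_ge0// divr_ge0// rho_ge0.
  + by move=> x _; rewrite -EFinM lee_fin mulr_ge0 ?sqnorm_ge0// divr_ge0// ltW.
  apply: aeW => z _; rewrite /u_ext t0 -EFinM lee_fin ler_wpM2r ?sqnorm_ge0//.
  by rewrite ler_pM2r ?invr_gt0// rho_le.
- by move=> x _; rewrite lee_fin sqnorm_ge0.
- apply/measurable_EFinP; apply: measurable_sqnorm => i.
  by case: (Lu0 i).
- by rewrite divr_ge0// ltW.
Qed.

Lemma force_power_le (Gf Gu : R -> \bar R) t :
  (forall t, 0 < t < T -> Gf t = (\int[leb2 R]_(z in Om) (sqnorm (force D t z))%:E)%E) ->
  (forall t, 0 < t < T -> Gu t = (\int[leb2 R]_(z in Om) (sqnorm (u t z))%:E)%E) ->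
  0 < t < T -> (force_power P D eta u t <= (rmax / 2)%:E * Gf t + (rmax / 2)%:E * Gu t)%E.
Proof.
move=> GfE GuE tT; have [_ _ _ Lf] := okD.
have [mf _] := @L2_time_sqnorm _ (measurableTypeR R * measurableTypeR R)%type R Om mOm (@leb_plane R) T (force D) Lf.
have r0 : 0 <= rmax / 2 by rewrite divr_ge0// ltW.
rewrite GfE// GuE// -!ge0_integralZl_EFin//.
- rewrite -ge0_integralD//.
  + apply: integral_le_bound => //.
      by move=> z _; rewrite -!EFinM -EFinD lee_fin addr_ge0// mulr_ge0 ?sqnorm_ge0.
    apply: aeW => z _; rewrite -!EFinM -EFinD lee_fin -mulrDr -mulrA.
    have H : dot (force D t z) (u t z) <= 2^-1 * (sqnorm (force D t z) + sqnorm (u t z)).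
      rewrite /dot /sqnorm /dot; have := sqr_ge0 ((force D t z).1 - (u t z).1).
      by have := sqr_ge0 ((force D t z).2 - (u t z).2); nra.
    have H0 : 0 <= 2^-1 * (sqnorm (force D t z) + sqnorm (u t z)).
      by rewrite mulr_ge0// addr_ge0 ?sqnorm_ge0.
    by apply: le_trans (ler_wpM2l (rho_ge0 t z) H) _; rewrite ler_wpM2r// rho_le.
  + by move=> z _; rewrite -EFinM lee_fin mulr_ge0 ?sqnorm_ge0.
  + by apply: measurable_funeM; apply/measurable_EFinP; exact: mf.
  + by move=> z _; rewrite -EFinM lee_fin mulr_ge0 ?sqnorm_ge0.
  + by apply: measurable_funeM; apply/measurable_EFinP; exact: mvu.
- by move=> x _; rewrite lee_fin sqnorm_ge0.
- by apply/measurable_EFinP; exact: mvu.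
- by move=> x _; rewrite lee_fin sqnorm_ge0.
- by apply/measurable_EFinP; exact: mf.
Qed.

Lemma energy_step (j : nat) : \forall t0 \ae leb R,
  j%:R * h <= t0 <= j.+1%:R * h -> 0 <= t0 <= T ->
  (E t0 + (h^-1)%:E * \int[leb R]_(t in `[(j%:R * h)%R, t0]) kin t
   <= E (j%:R * h)%R
      + (h^-1)%:E * \int[leb R]_(t in `[(j%:R * h - h)%R, (t0 - h)%R]) kin t
      + \int[leb R]_(t in `[(j%:R * h)%R, t0]) force_power P D eta u t)%E.
Proof.
have := sol_energy sol j; apply: leb_aeS => t H tj tT.
apply: le_trans (H tj tT); rewrite leeD2r// leeDl//.
by apply: integral_ge0 => r _; exact: dissipation_ge0.
Qed.

(** The weight 1 / 2 is the largest value of sqrt(delta0) / 2 for delta0 <= 1, which makes the bound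
    uniform in delta0. *)
Definition initial_elastic : \bar R :=
  (E_K P (eta0 D) + (1 / 2)%:E * \int[leb R]_(x in `]0%R, l[) (sqnorm (wderv l 3 (eta0 D) x))%:E)%E.

Lemma initial_elastic_lty : (initial_elastic < +oo)%E.
Proof.
have [[_ H3 Ef _] _ _ _] := okD.
rewrite lte_add_pinfty// lte_mul_pinfty//.
apply: (@L2_sqnorm _ (measurableTypeR R) R `]0, l[%classic (measurable_itv _)) => i; have [W _] := wderP (H3 i) (leqnn 3).
by case: i W.
Qed.

Lemma elastic0_le : (E 0%R <= initial_elastic)%E.
Proof.
rewrite /= (@elastic_congr _ _ _ (eta 0) (eta0 D)); last first.
  by move=> x xl; apply: (sol_eta_init sol); lra.
rewrite /elastic leeD2l// lee_wpmul2r ?lee_fin//.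
by apply: integral_ge0 => x _; rewrite lee_fin sqnorm_ge0.
Qed.

End Solution.

(** * Energy bound uniform in h and delta0 *)

Section EnergyBound.
Variables (R : realType) (P : params R) (T : R) (D : data R).
Hypothesis okP : params_ok P.
Hypothesis T0 : 0 < T.
Hypothesis okD : data_ok P T D.
Local Notation l := (len P).

Lemma energy_bound : exists B A Tm : R, [/\ 0 <= B, 0 <= A, 0 < Tm <= T &
  forall T0 delta0 h eta u Phi veta, 0 < T0 <= Tm -> 0 < delta0 <= 1 -> 0 < h <= T0 ->
    approx_solution_with_velocity P T D delta0 h eta u Phi veta ->
  (forall t, 0 <= t <= T0 -> (E_K P (eta t) <= B%:E)%E) /\
  (forall Gv : R -> \bar R, measurable_fun setT Gv -> (forall t, 0 <= Gv t)%E ->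
    (forall t, 0 < t < T -> Gv t = (\int[leb R]_(x in `]0%R, l[) (sqnorm (veta t x))%:E)%E) ->
    (\int[leb R]_(t in `[0%R, T0]) Gv t <= (A * T0)%:E)%E)].
Proof.
have [_ _ _ Lf] := okD.
have [_ [Gf [mGf Gf0 Gf_lty GfE]]] := @L2_time_sqnorm _ (measurableTypeR R * measurableTypeR R)%type
  R (Omega l) (@measurable_Omega _ l) (@leb_plane R) T (force D) Lf.
have [rp0 rm0] : 0 < rho_plus P /\ 0 < rho_minus P by case: okP => _ _ [].
have rs0 : 0 < rho_s P by case: okP.
pose rmax := rho_plus P + rho_minus P; pose rmin := Order.min (rho_plus P) (rho_minus P).
have rmax0 : 0 < rmax by rewrite addr_gt0.
have rmin0 : 0 < rmin by rewrite lt_min rp0.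
pose gf t := ((rmax / 2)%:E * Gf t)%E.
have rmax2 : 0 <= rmax / 2 by rewrite divr_ge0// ltW.
have gf0 t : (0 <= gf t)%E by rewrite mule_ge0.
have mgf : measurable_fun setT gf by exact: measurable_funeM.
have gf_lty : (\int[leb R]_(t in `[0%R, T]) gf t < +oo)%E.
  by rewrite ge0_integralZl_EFin//; [rewrite lte_mul_pinfty|exact: measurable_funTS].
pose K0 := fine (past_kinetic P D); pose I0 := fine (initial_elastic P D).
have pk0 : (0 <= past_kinetic P D)%E.
  have sq0 d (X : measurableType d) (mu : {measure set X -> \bar R}) A (f : X -> R * R) c : 0 <= c ->
      (0 <= c%:E * \int[mu]_(x in A) (sqnorm (f x))%:E)%E.
    by move=> c0; rewrite mule_ge0 ?lee_fin// integral_ge0// => x _; rewrite lee_fin sqnorm_ge0.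
  by apply: adde_ge0; apply: sq0; rewrite // divr_ge0// ltW.
have K0E : K0%:E = past_kinetic P D.
  by rewrite fineK// ge0_fin_numE// (past_kinetic_lty okP okD).
have ie0 : (0 <= initial_elastic P D)%E.
  by rewrite adde_ge0 ?E_K_ge0// mule_ge0 ?lee_fin// integral_ge0// => x _;
    rewrite lee_fin sqnorm_ge0.
have I0E : I0%:E = initial_elastic P D.
  by rewrite fineK// ge0_fin_numE// (initial_elastic_lty okD).
have K00 : 0 <= K0 by rewrite fine_ge0.
have I00 : 0 <= I0 by rewrite fine_ge0.
pose F0 := fine (\int[leb R]_(t in `[0%R, T]) gf t)%E.
have F0E : (F0%:E = \int[leb R]_(t in `[0%R, T]) gf t)%E.
  by rewrite fineK// ge0_fin_numE// integral_ge0.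
have F00 : 0 <= F0 by rewrite fine_ge0// integral_ge0.
(* The ratio Cu of the density bounds turns the lower bound (rmin / 2) |u|^2 of the kinetic energy
   into the share (rmax / 2) |u|^2 of the force. *)
pose B := I0 + K0 + F0; pose Cu := rmax / rmin.
have B0 : 0 <= B by rewrite !addr_ge0.
have Cu0 : 0 < Cu by rewrite divr_gt0.
(* The N cells that cover [0, T0] reach up to N h <= 2 T0; this must not exceed T, and Cu N h must
   be at most 1 / 4. *)
pose Tm := Order.min (T / 2) (8 * Cu)^-1.
(* The integral of (rho_s / 2) |veta|^2 is at most S <= N h (2 B) <= 4 B T0, whence the factor 8 B /
   rho_s. *)
exists (2 * B), (8 * B / rho_s P), Tm; split.
- by rewrite mulr_ge0.
- by apply: divr_ge0; [exact: mulr_ge0|exact: ltW].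
- have T2 : T / 2 <= T by rewrite ler_pdivrMr// ler_peMr ?ler1n// ltW.
  apply/andP; split; last by rewrite ge_min T2.
  by rewrite lt_min divr_gt0//= invr_gt0 mulr_gt0.
move=> T1 delta0 h eta u Phi veta /andP[T10]; rewrite le_min => /andP[T1T T1C] d01 /andP[h0 hT1] sol.
have [_ Lu0] := sol_u_space sol.
have Lu i : L2_time (@leb_plane R) T (Omega l) (fun t z => pcomp i (u t z)) by have [] := Lu0 i.
have [_ [Gu [mGu Gu0 Gu_lty GuE]]] := @L2_time_sqnorm _ (measurableTypeR R * measurableTypeR R)%type
  R (Omega l) (@measurable_Omega _ l) (@leb_plane R) T u Lu.
pose gu t := ((rmin / 2)%:E * Gu t)%E.
have rmin2 : 0 <= rmin / 2 by rewrite divr_ge0// ltW.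
have gu0 t : (0 <= gu t)%E by rewrite mule_ge0.
have mgu : measurable_fun setT gu by exact: measurable_funeM.
have gu_lty : (\int[leb R]_(t in `[0%R, T]) gu t < +oo)%E.
  by rewrite ge0_integralZl_EFin//; [rewrite lte_mul_pinfty|exact: measurable_funTS].
pose E t := elastic P (Num.sqrt delta0 / 2) (eta t).
pose N := (Num.truncn (T1 / h)).+1.
have Nlow : T1 < N%:R * h by rewrite -ltr_pdivrMr// truncnS_gt.
have Nup : N%:R * h <= 2 * T1.
  have H : (Num.truncn (T1 / h))%:R * h <= T1 by rewrite -ler_pdivlMr// truncn_le// divr_ge0// ltW.
  have -> : N%:R * h = (Num.truncn (T1 / h))%:R * h + h by rewrite /N -natr1 mulrDl mul1r.
  by real_lra.
have NC : Cu * (N%:R * h) <= 4^-1.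
  apply: (@le_trans _ _ (Cu * (2 * (8 * Cu)^-1))).
    by rewrite ler_pM2l//; real_lra.
  suff -> : Cu * (2 * (8 * Cu)^-1) = 4^-1 by [].
  have : Cu != 0 by exact: lt0r_neq0.
  by move: (Cu) => c c0; field.
have Hnode Gv : measurable_fun setT Gv -> (forall t, 0 <= Gv t)%E ->
    (forall t, 0 < t < T -> Gv t = (\int[leb R]_(x in `]0%R, l[) (sqnorm (veta t x))%:E)%E) ->
    forall j, (j <= N)%N -> node_estimate h (I0 + K0) B Cu E (kinetic P D eta u veta)
      (fun t => (rho_s P / 2)%:E * Gv t)%E gf j.
  move=> mGv Gv0 GvE; have E_init : (E 0%R + K0%:E <= (I0 + K0)%:E)%E.
    by rewrite EFinD leeD2r// I0E; exact: elastic0_le d01 sol.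
  have kp t : t < 0 -> (kinetic P D eta u veta t <= K0%:E)%E.
    by move=> t0; rewrite K0E; exact: (kinetic_past _ _ _ okP okD t0).
  have E0 := elastic_ge0 eta okP d01.
  have k0 := kinetic_ge0 D eta u veta okP.
  elim=> [_|j IH jN]; first exact: (node_estimate0 _ _ _ _ h0 K00 E0 k0 kp E_init).
  have jle : j.+1%:R * h <= N%:R * h by rewrite ler_pM2r// ler_nat.
  apply: (@node_estimateS R T h K0 (I0 + K0) B Cu E (kinetic P D eta u veta)
    (force_power P D eta u) gu _ gf) => //.
  - exact: ltW.
  - exact: measurable_funeM.
  - by move=> t; rewrite mule_ge0// lee_fin divr_ge0// ltW.
  - by move=> t tT Et; exact: (kinetic_ge_fluid okP d01 sol GuE tT Et).
  - by move=> t tT; exact: (kinetic_ge_solid okP sol GvE tT).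
  - move=> t tT; apply: le_trans (force_power_le okP okD sol GfE GuE tT) _.
    rewrite /gf /gu leeD2l// muleA -EFinM.
    have -> : Cu * (rmin / 2) = rmax / 2 by rewrite /Cu mulrA divfK// lt0r_neq0.
    by [].
  - by move=> t c tT H; exact: (elastic_time_lsc okP T0 d01 sol tT H).
  - exact: (energy_step okP d01 sol).
  - by rewrite -F0E -EFinD.
  - by real_lra.
  - by apply: le_trans NC; rewrite ler_pM2l.
  - by apply: IH; exact: ltnW.
split.
  have [_ [Gv [mGv Gv0 _ GvE]]] := @L2_time_sqnorm _ (measurableTypeR R) R `]0, l[%classic
    (measurable_itv _) (leb R) T veta (sol_veta_L2 sol).
  have [e [k [S [_ _ _ [_ _ _ _ aeE]]]]] := Hnode Gv mGv Gv0 GvE N (leqnn N).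
  move=> t tT1; apply: (@le_trans _ _ (E t)).
    by apply: E_K_le_elastic; rewrite divr_ge0// sqrtr_ge0.
  (* The almost everywhere bound reaches every t > 0 by semicontinuity from the left; time 0, which
     has no earlier times, uses the initial energy. *)
  have [t0|t0] := leP t 0.
    have -> : t = 0 by real_lra.
    apply: le_trans (elastic0_le d01 sol) _.
    by rewrite -I0E lee_fin /B; real_lra.
  apply: (elastic_time_lsc okP T0 d01 sol); first by real_lra.
  move=> d d0; have [||s st sE] := @ae_exists_itv R (Order.max 0 (t - d)) t (fun s => E s <= (2 * B)%:E)%E.
  - by rewrite gt_max t0/= ltrBlDr ltrDl.
  - move: aeE; apply: leb_aeS => s H; rewrite gt_max => /andP[/andP[s0 _] st]; apply: H; real_lra.
  exists s; move: st; rewrite gt_max => /andP[/andP[s0 ds] st]; split => //.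
  - by rewrite ds.
  - exact: ltW.
move=> Gv mGv Gv0 GvE.
have [e [k [S [_ _ /andP[_ SB] [_ _ _ Sv _]]]]] := Hnode Gv mGv Gv0 GvE N (leqnn N).
have {}Sv : ((rho_s P / 2)%:E * \int[leb R]_(t in `[0%R, T1]) Gv t <= S%:E)%E.
  apply: le_trans Sv; rewrite -ge0_integralZl_EFin//.
  - apply: lower_integral_subset.
      by move=> t; rewrite mule_ge0// lee_fin divr_ge0// ltW.
    by move=> t /=; rewrite !in_itv/=; real_lra.
  - exact: measurable_funTS.
  - by rewrite divr_ge0// ltW.
have r20 : 0 < rho_s P / 2 by rewrite divr_gt0.
rewrite -(@lee_pmul2l _ (rho_s P / 2)%:E)//; apply: le_trans Sv _.
have rs1 : rho_s P != 0 by exact: lt0r_neq0.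
have AE : rho_s P / 2 * (8 * B / rho_s P * T1) = 2 * T1 * (2 * B) by field.
rewrite -EFinM lee_fin AE.
by apply: le_trans SB _; rewrite ler_wpM2r// mulr_ge0.
Qed.

End EnergyBound.

(** * Confinement of the solid *)

Section NoCollision.
Variables (R : realType) (P : params R) (T : R) (D : data R).
Hypothesis okP : params_ok P.
Hypothesis T0 : 0 < T.
Hypothesis okD : data_ok P T D.
Local Notation l := (len P).
Local Notation S0 := (sup_abs_second (len P) (eta0 D)).

(** A real [sup] is an upper bound only when the set is bounded; the Lipschitz bound on the height
    provides this. *)
Lemma initial_height_le x : 0 <= x <= l -> `|(eta0 D x).2| <= S0.
Proof.
move=> xl; have [[He _ Ef _] _ _ _] := okD.
have EE : ((fine (E_K P (eta0 D)))%:E = E_K P (eta0 D))%E by rewrite fineK// ge0_fin_numE// E_K_ge0.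
have [|k [L [_ L0 /(_ _ He)]]] := @finite_energy_bilipschitz _ _ okP (fine (E_K P (eta0 D))).
  by rewrite fine_ge0// E_K_ge0.
rewrite EE lexx => /(_ isT) H; apply: ub_le_sup; last by exists x.
exists (L * l) => _ [y /= + <-]; rewrite in_itv/= => /andP[y0 yl].
have [_] := H 0 y (lexx 0) y0 yl; have [_ _ -> _ _] := He.
by rewrite !subr0 => /le_trans; apply; rewrite ler_wpM2l.
Qed.

Lemma no_collision : exists T1 k : R, [/\ 0 < T1 <= T, 0 < k &
  forall delta0 h eta u Phi, 0 < delta0 <= 1 -> 0 < h <= T1 ->
    approx_solution P T D delta0 h eta u Phi ->
  forall t x, 0 <= t <= T1 -> 0 <= x <= l ->
    `|(eta t x).2| <= height_bound l (eta0 D) /\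
    k * x <= (eta t x).1 <= l - k * (l - x)].
Proof.
have l0 : 0 < l by case: okP.
have [[_ _ _ S0l] _ _ _] := okD.
have [B [A [Tm [B0 A0 /andP[Tm0 TmT] H]]]] := energy_bound okP T0 okD.
have [k [L [k0 L0 HL]]] := finite_energy_bilipschitz okP B0.
(* Half of the initial gap: the height bound is S0 + m, so the height may grow by m. *)
pose m := 2^-1 * (l / 2 - S0); have m0 : 0 < m by rewrite mulr_gt0// subr_gt0.
(* A displacement of Lipschitz constant 2 L varies by at most m / 2 over the length iota. *)
pose iota := Order.min (m / (4 * (L + 1))) l.
have L1 : 0 < 4 * (L + 1) by rewrite mulr_gt0// ltr_wpDl.
have iota0 : 0 < iota by rewrite lt_min l0 divr_gt0.
have iotal : iota <= l by rewrite ge_min lexx orbT.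
have iotaL : 2 * L * iota <= m / 2.
  have : iota * (4 * (L + 1)) <= m by rewrite -ler_pdivlMr// ge_min lexx.
  by real_lra.
have Al : 0 < A + l + 1 by real_lra.
(* A displacement of m / 2 over the length iota would give m iota <= (A + l) T1; the summand 1 makes
   this strictly false. *)
pose T1 := Order.min Tm (m * iota / (A + l + 1)).
have T10 : 0 < T1 by rewrite lt_min Tm0 divr_gt0// mulr_gt0.
have T1m : T1 <= Tm by rewrite ge_min lexx.
have T1A : T1 * (A + l + 1) <= m * iota by rewrite -ler_pdivlMr// ge_min lexx orbT.
exists T1, k; split => //; first by rewrite T10 (le_trans T1m).
move=> delta0 h eta u Phi d01 hT1 [veta sol] t x0 tT1 xl0.
have [|Ht HGv] := H T1 delta0 h eta u Phi veta _ d01 hT1 sol; first by rewrite T10.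
have tT : 0 <= t <= T by real_lra.
have zT : 0 <= (0 : R) <= T by real_lra.
have [Het _] := sol_eta_space sol tT; have [He0 _] := sol_eta_space sol zT.
have Bt := HL _ Het (Ht t tT1).
have z1 : 0 <= (0 : R) <= T1 by real_lra.
have Bz := HL _ He0 (Ht 0 z1).
have [_ _ et0 etl _] := Het.
split; last first.
  have [x00 x0l] := andP xl0.
  have [/andP[+ _] _] := Bt 0 x0 (lexx 0) x00 x0l; have [/andP[+ _] _] := Bt x0 l x00 x0l (lexx l).
  by rewrite et0 etl/= !subr0; real_lra.
(* The vertical displacement since time 0, a difference of two functions with Lipschitz constant
   L. *)
pose w x := (eta t x).2 - (eta 0 x).2.
suff wm : `|w x0| <= m.
  have -> : height_bound l (eta0 D) = S0 + m by rewrite /height_bound /m; real_lra.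
  rewrite -[(eta t x0).2](subrK (eta 0 x0).2) addrC; apply: le_trans (ler_normD _ _) _.
  by apply: lerD => //; rewrite (sol_eta_init sol)//; exact: initial_height_le.
rewrite leNgt; apply/negP => wm.
have wE x : 0 <= x <= l -> w x = \int[leb R]_(s in `[0, t]) pcomp true (veta s x).
  move=> xl; have [_ /(_ t tT) /= E] := sol_veta sol xl true.
  by rewrite /w E addrAC subrr add0r.
have wL : forall x y, 0 <= x <= l -> 0 <= y <= l -> `|w y - w x| <= 2 * L * `|y - x|.
  apply: lipschitz_sym => x y xx xy yl; have [_ H1] := Bt x y xx xy yl; have [_ H2] := Bz x y xx xy yl.
  have -> : w y - w x = ((eta t y).2 - (eta t x).2) - ((eta 0 y).2 - (eta 0 x).2) by rewrite /w; ring.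
  by apply: le_trans (ler_normB _ _) _; rewrite -mulrA mulr_natl mulr2n lerD.
have [|a [a0 alb inJ]] := window_around _ xl0 (r := iota); first by rewrite iota0.
have wJ x : a < x < a + iota -> m / 2 <= `|w x|.
  move=> /inJ[xl xi]; have near : `|w x0 - w x| <= m / 2.
    apply: le_trans (wL _ _ xl xl0) _; apply: le_trans iotaL.
    by rewrite ler_wpM2l// mulr_ge0.
  have wm2 : m / 2 + `|w x0 - w x| < `|w x0| by apply: le_lt_trans wm; rewrite [leRHS]splitr lerD2l.
  have : `|w x0| <= `|w x| + `|w x0 - w x| by rewrite -{1}[w x0](subrK (w x)) addrC ler_normD.
  by move=> /(lt_le_trans wm2); rewrite ltrD2r => /ltW.
have [_ [Gv [mGv Gv0 _ GvE]]] := @L2_time_sqnorm _ (measurableTypeR R) R `]0, l[%classic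
    (measurable_itv _) (leb R) T veta (sol_veta_L2 sol).
have [g [mg g0 _ gE]] := @L2_time_slices _ (measurableTypeR R) R (leb R) T `]0, l[%classic
    (measurable_itv _) _ (sol_veta_L2 sol true).
have gA : (\int[leb R]_(t in `[0%R, T1]) g t <= (A * T1)%:E)%E.
  apply: le_trans (HGv Gv mGv Gv0 GvE); apply: ae_ge0_le_lower_integral => //.
  apply: leb_aeS2 (ae_neq (0 : R)) (ae_neq T) => s /eqP s0 /eqP sT.
  rewrite /= in_itv/= => sT1; have sT' : 0 < s < T by real_lra.
  rewrite gE// GvE//; apply: ae_ge0_le_lower_integral => //.
  - by move=> x _; rewrite lee_fin sqr_ge0.
  - by move=> x _; rewrite lee_fin sqnorm_ge0.
  - by apply: aeW => x _; rewrite lee_fin sqnormE lerDr sqr_ge0.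
have := @displacement_bound R T T1 l (A * T1) a (a + iota) (m / 2) t
   (fun s x => pcomp true (veta s x)) g (sol_veta_L2 sol true).
have iab : a <= a + iota by rewrite lerDl ltW.
have m20 : 0 <= m / 2 by rewrite divr_ge0// ltW.
have T1T : T1 <= T := le_trans T1m TmT.
have [t0 tT1'] := andP tT1.
move=> /(_ a0 iab alb m20 t0 tT1' T1T mg g0 gE gA).
move=> Hd; have {}Hd : m / 2 * (a + iota - a) <= (A * T1 + T1 * l) / 2.
  apply: Hd => x xJ; first by have [] := sol_veta sol (inJ x xJ).1 true.
  by rewrite -wE ?(inJ x xJ).1// wJ.
by real_lra.
Qed.

End NoCollision.

(** * Pointwise bounds under weak convergence *)

Section WeakLimit.
Context d (X : measurableType d) (R : realType) (mu : {measure set X -> \bar R}).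
Variable D : set X.
Hypothesis mD : measurable D.
Hypothesis D_lty : (mu D < +oo)%E.

Lemma aeS2 (A B C : X -> Prop) : (forall x, A x -> B x -> C x) ->
  {ae mu, forall x, A x} -> {ae mu, forall x, B x} -> {ae mu, forall x, C x}.
Proof. by move=> ABC; apply: filterS2. Qed.

(* No measurability is required of [f]. *)
Lemma le_lower_Rintegral (f g : X -> R) (M : R) : mu.-integrable D (EFin \o g) ->
  (forall x, D x -> f x <= g x /\ `|f x| <= M) -> \int[mu]_(x in D) f x <= \int[mu]_(x in D) g x.
Proof.
move=> ig fg; pose F x := (f x)%:E.
have part (h : X -> \bar R) : (forall x, D x -> 0 <= h x <= `|M|%:E)%E ->
    (\int[mu]_(x in D) h x)%E \is a fin_num.
  move=> hM; rewrite ge0_fin_numE; last by apply: integral_ge0 => x /hM/andP[].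
  apply: (@le_lt_trans _ _ (\int[mu]_(x in D) cst `|M|%:E x)%E).
    apply: ae_ge0_le_lower_integral => //; first by move=> x /hM/andP[].
      by move=> x _; rewrite /= lee_fin.
    by apply: aeW => x /hM/andP[].
  by rewrite integral_cst// lte_mul_pinfty// lee_fin.
have fM x : D x -> `|f x| <= `|M| by move=> /fg[_ /le_trans]; apply; exact: ler_norm.
have Ff : (\int[mu]_(x in D) F x)%E \is a fin_num.
  rewrite integralE fin_numB; apply/andP; split; apply: part => x Dx; have := fM x Dx;
    rewrite ler_norml => /andP[? ?].
    by rewrite funeposE le_max lexx orbT ge_max !lee_fin normr_ge0 andbT.
  by rewrite funenegE le_max lexx orbT ge_max /F -EFinN !lee_fin normr_ge0 andbT lerNl.
apply: fine_le => //; first exact: integrable_fin_num.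
rewrite integralE [leRHS]integralE; apply: leeB; apply: ae_ge0_le_lower_integral => //;
  apply: aeW => x Dx; have [fgx _] := fg x Dx.
  by rewrite !funeposE ge_max !le_max lexx !lee_fin fgx !orbT.
by rewrite !funenegE ge_max !le_max lexx /= !lee_fin lerN2 fgx !orbT.
Qed.

(** Tested with the indicator of the set where f > c, weak convergence gives a nonpositive integral
    of f - c over that set, which is therefore null. The bound M keeps the integrals of the f_k
    finite, so that they can be compared with that of c. *)
Lemma weak_limit_le (fk : nat -> X -> R) (f c : X -> R) (M : R) : L2 mu D f -> L2 mu D c ->
  (\forall n \near \oo, forall x, D x -> fk n x <= c x /\ `|fk n x| <= M) ->
  (forall g, L2 mu D g -> (fun n => \int[mu]_(x in D) (fk n x * g x)) @ \oo
     --> \int[mu]_(x in D) (f x * g x)) ->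
  {ae mu, forall x, D x -> f x <= c x}.
Proof.
move=> Lf Lc Hk wc; have [[mf _] [mc _]] := (Lf, Lc).
have mfc : measurable_fun D (fun x => f x - c x) by exact: measurable_funB.
pose G := D `&` (fun x => f x - c x) @^-1` `]0, +oo[%classic.
have mG : measurable G by apply: mfc => //; exact: measurable_itv.
pose g : X -> R := \1_G.
have g01 x : g x = 0 \/ g x = 1 by rewrite /g indicE; case: (x \in G); [right|left].
have Lg : L2 mu D g.
  apply: (L2_bounded (M := 1)) => //; first exact: measurable_indic.
  by move=> x _; have [->|->] := g01 x; rewrite ?normr0 ?normr1.
have ifg := L2_mul_integrable mD Lf Lg; have icg := L2_mul_integrable mD Lc Lg.
have lim : \int[mu]_(x in D) (f x * g x) <= \int[mu]_(x in D) (c x * g x).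
  rewrite -lerN2; apply: (cvgn_ge (u := fun n => - \int[mu]_(x in D) (fk n x * g x))).
    exact: cvgN (wc g Lg).
  move: Hk; apply: filterS => n Hn; rewrite lerN2; apply: (le_lower_Rintegral (M := `|M|)) => // x Dx.
  have [H1 H2] := Hn x Dx; have [->|->] := g01 x; first by rewrite !mulr0 normr0.
  by rewrite !mulr1; split => //; apply: le_trans H2 (ler_norm _).
have pos x : D x -> 0 <= (f x - c x) * g x.
  move=> Dx; rewrite /g indicE; have [|_] := boolP (x \in G); last by rewrite mulr0.
  by rewrite inE /G/= in_itv/= andbT mulr1 => -[_ /ltW].
have int0 : (\int[mu]_(x in D) `|((f x - c x) * g x)%:E| = 0)%E.
  have -> : (\int[mu]_(x in D) `|((f x - c x) * g x)%:E| = \int[mu]_(x in D) ((f x * g x)%:E - (c x * g x)%:E))%E.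
    apply: eq_integral => x; rewrite inE => Dx; rewrite -EFinB -mulrBl abse_EFin ger0_norm//; exact: pos.
  apply/eqP; rewrite eq_le; apply/andP; split; last first.
    by apply: integral_ge0 => x Dx; rewrite -EFinB -mulrBl lee_fin; exact: pos.
  rewrite integralB_EFin//; rewrite -[X in (X - _)%E]fineK ?integrable_fin_num//.
  by rewrite -[X in (_ - X)%E]fineK ?integrable_fin_num// -EFinB lee_fin subr_le0.
have mfg : measurable_fun D (fun x => ((f x - c x) * g x)%:E).
  by apply/measurable_EFinP; apply: measurable_funM => //; exact: measurable_indic.
have /(ae_eq_integral_abs mu mD mfg) := int0.
apply: filterS => x H Dx; rewrite leNgt; apply/negP => cf.
have := H Dx; rewrite /g indicE mem_set/=; last by split => //=; rewrite in_itv/= andbT subr_gt0.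
by rewrite mulr1 => -[] /eqP; rewrite subr_eq0 => /eqP E; rewrite E ltxx in cf.
Qed.

End WeakLimit.

(** * From the bounds to the absence of contact *)

Section FinalBounds.
Variable R : realType.

Lemma Omega_not_bd (l : R) z : Omega l z -> ~ bdOmega l z.
Proof. by move=> Oz [_]; apply; exact: open_nbhs_nbhs (conj (@open_Omega _ l) Oz). Qed.

Lemma height_bound_lt (l : R) eta : sup_abs_second l eta < l / 2 -> height_bound l eta < l / 2.
Proof. by rewrite /height_bound; lra. Qed.

Lemma confined_not_bd (l Hb k : R) v x : 0 < k -> Hb < l / 2 -> 0 < x < l ->
  `|v.2| <= Hb -> k * x <= v.1 <= l - k * (l - x) -> ~ bdOmega l v.
Proof.
move=> k0 Hbl xl; rewrite ler_norml => v2 v1; apply: Omega_not_bd; split; last by lra.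
have [x0 xl'] := andP xl.
have : 0 < k * x by rewrite mulr_gt0.
have : 0 < k * (l - x) by rewrite mulr_gt0// subr_gt0.
by lra.
Qed.

Lemma cvg_pcomp (u : nat -> R * R) (v : R * R) i : u @ \oo --> v ->
  (fun n => pcomp i (u n)) @ \oo --> pcomp i v.
Proof.
by move=> uv; case: i; [exact: (cvg_comp _ _ uv (@cvg_snd _ _ _ _ _))|exact: (cvg_comp _ _ uv (@cvg_fst _ _ _ _ _))].
Qed.

End FinalBounds.

Theorem lemma5p2 (R : realType) (P : params R) (T : R) (D : data R) :
  params_ok P -> 0 < T -> data_ok P T D ->
  exists2 T0 : R, 0 < T0 <= T &
  forall delta0 : R, 0 < delta0 <= 1 ->
  (exists2 h0 : R, 0 < h0 &
     forall h : R, 0 < h < h0 ->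
     forall (eta : R -> R -> R * R) (u Phi : R -> R * R -> R * R),
     approx_solution P T D delta0 h eta u Phi ->
     (height_sup T0 (len P) eta
      <= (height_bound (len P) (eta0 D))%:E)%E /\
     (forall t x : R, 0 <= t <= T0 -> 0 < x < len P ->
        ~ bdOmega (len P) (eta t x))) /\
  (forall (hs : nat -> R) (etas : nat -> R -> R -> R * R)
          (us Phis : nat -> R -> R * R -> R * R),
     (forall n, 0 < hs n) -> hs @ \oo --> (0 : R) ->
     (forall n, approx_solution P T D delta0 (hs n) (etas n) (us n) (Phis n)) ->
     (forall eta : R -> R -> R * R,
        (forall t x : R, 0 <= t <= T0 -> 0 <= x <= len P ->
           (fun n => etas n t x) @ \oo --> eta t x) ->
        (height_sup T0 (len P) eta
         <= (height_bound (len P) (eta0 D))%:E)%E /\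
        (forall t x : R, 0 <= t <= T0 -> 0 < x < len P ->
           ~ bdOmega (len P) (eta t x))) /\
     (forall eta : R -> R -> R * R,
        weak_L2_cvg T0 (len P) etas eta ->
        \forall p \ae (@lebesgue_measure R \x @lebesgue_measure R)%E,
          0 < p.1 < T0 -> 0 < p.2 < len P ->
          `|(eta p.1 p.2).2| <= height_bound (len P) (eta0 D) /\
          ~ bdOmega (len P) (eta p.1 p.2))).
Proof.
move=> okP T0 okD; have [T1 [k [T1T k0 H]]] := no_collision okP T0 okD.
have l0 : 0 < len P by case: okP.
have Hbl : height_bound (len P) (eta0 D) < len P / 2.
  by apply: height_bound_lt; case: okD => -[].
set Hb := height_bound _ _ in H Hbl *; set l := len P in H l0 Hbl *.
have conclude (eta : R -> R -> R * R) :
    (forall t x, 0 <= t <= T1 -> 0 <= x <= l ->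
       `|(eta t x).2| <= Hb /\ k * x <= (eta t x).1 <= l - k * (l - x)) ->
    (height_sup T1 l eta <= Hb%:E)%E /\
    (forall t x : R, 0 <= t <= T1 -> 0 < x < l -> ~ bdOmega l (eta t x)).
  move=> He; split.
    by apply: ge_ereal_sup => _ [t [x [tT xl ->]]]; rewrite lee_fin; have [] := He t x tT xl.
  move=> t x tT xl; have xl' : 0 <= x <= l by real_lra.
  by have [? ?] := He t x tT xl'; exact: (confined_not_bd k0 Hbl xl).
exists T1 => // delta0 d01; split.
  (* The threshold on h is the final time itself: the energy estimate asks that h <= T0. *)
  exists T1 => [|h hT1 eta u Phi sol]; first by case/andP: T1T.
  have hT1' : 0 < h <= T1 by real_lra.
  by apply: conclude; exact: H d01 hT1' sol.
move=> hs etas us Phis hs0 hsc sols.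
have near_bounds : \forall n \near \oo, forall t x, 0 <= t <= T1 -> 0 <= x <= l ->
    `|(etas n t x).2| <= Hb /\ k * x <= (etas n t x).1 <= l - k * (l - x).
  have T10 : 0 < T1 by case/andP: T1T.
  have /cvgrPdist_lt/(_ _ T10) := hsc; apply: filterS => n; rewrite sub0r normrN gtr0_norm// => hn.
  have hT1' : 0 < hs n <= T1 by rewrite hs0 ltW.
  exact: H d01 hT1' (sols n).
split=> eta etac.
  apply: conclude => t x tT xl; have c2 := cvg_pcomp (i := true) (etac t x tT xl).
  have c1 := cvg_pcomp (i := false) (etac t x tT xl).
  split.
    rewrite -lerN2; apply: (cvgn_ge (u := fun n => - `|(etas n t x).2|)).
      by apply: cvgN; exact: cvg_norm c2.
    by move: near_bounds; apply: filterS => n /(_ t x tT xl)[]; rewrite lerN2.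
  apply/andP; split.
    apply: (cvgn_ge c1).
    by move: near_bounds; apply: filterS => n /(_ t x tT xl)[_ /andP[]].
  rewrite -lerN2; apply: (cvgn_ge (cvgN c1)).
  by move: near_bounds; apply: filterS => n /(_ t x tT xl)[_ /andP[_]]; rewrite lerN2.
set Q := `]0, T1[%classic `*` `]0, l[%classic.
have mQ : measurable (Q : set (measurableTypeR R * measurableTypeR R)).
  by apply: measurableX; exact: measurable_itv.
have Q_lty : (leb2 R Q < +oo)%E.
  rewrite product_measure1E//=; try exact: measurable_itv.
  by apply: lte_mul_pinfty; rewrite ?ge0_fin_numE// leb_oo_lty.
have [Leta wc] := etac.
have QE (p : R * R) : Q p -> [/\ 0 <= p.1 <= T1, 0 <= p.2 <= l, 0 < p.1 < T1 & 0 < p.2 < l].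
  by rewrite /Q/= !in_itv/= => -[? ?]; split => //; real_lra.
have kge y : 0 <= y -> 0 <= k * y by exact: mulr_ge0 (ltW k0).
(* The height is bounded by Hb, and the abscissa lies in [0, l]. *)
have bounded i : \forall n \near \oo, forall p, Q p -> `|pcomp i (etas n p.1 p.2)| <= Hb + l.
  move: near_bounds; apply: filterS => n Hn p /QE[pT pl _ _].
  have [H2 H1] := Hn _ _ pT pl; have Hb0 : 0 <= Hb := le_trans (normr_ge0 _) H2.
  have kx : 0 <= k * p.2 by apply: kge; case/andP: pl.
  have klx : 0 <= k * (l - p.2) by apply: kge; rewrite subr_ge0; case/andP: pl.
  by case: i => /=; [real_lra|rewrite ler_norml; real_lra].
(* [weak_limit_le] is one-sided: lower bounds are obtained as upper bounds for the opposite
   functions. *)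
have neg i : [/\ L2 (leb2 R) Q (fun p => - pcomp i (eta p.1 p.2)) &
    forall g, L2 (leb2 R) Q g ->
    (fun n => \int[leb2 R]_(p in Q) (- pcomp i (etas n p.1 p.2) * g p)) @ \oo -->
       \int[leb2 R]_(p in Q) (- pcomp i (eta p.1 p.2) * g p)].
  have L2N g : L2 (leb2 R) Q g -> L2 (leb2 R) Q (fun p => - g p).
    move=> [mg gf]; split; first exact: measurableT_comp.
    by under eq_integral do rewrite sqrrN.
  split=> [|g Lg]; first exact: L2N.
  have E (f : R * R -> R) : \int[leb2 R]_(p in Q) (f p * - g p) = \int[leb2 R]_(p in Q) (- f p * g p).
    by apply: eq_Rintegral => p _; rewrite mulrN mulNr.
  have := wc i _ (L2N _ Lg); rewrite -/Q (E (fun p => pcomp i (eta p.1 p.2))).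
  apply: cvg_trans; apply: near_eq_cvg; apply: nearW => n.
  by rewrite -(E (fun p => pcomp i (etas n p.1 p.2))).
have L2aff (c : R * R -> R) (M : R) : measurable_fun setT (c : measurableTypeR R * measurableTypeR R -> R) ->
    (forall p, Q p -> `|c p| <= M) -> L2 (leb2 R) Q c.
  by move=> mc cM; apply: (L2_bounded (M := M)) => //; exact: measurable_funTS.
have a2 : {ae leb2 R, forall p, Q p -> pcomp true (eta p.1 p.2) <= Hb}.
  apply: (weak_limit_le mQ Q_lty (fk := fun n p => pcomp true (etas n p.1 p.2)) (M := Hb + l)).
  - exact: Leta.
  - exact: (L2aff _ `|Hb|).
  - move: near_bounds (bounded true); apply: filterS2 => n Hn Bn p Qp; split; last exact: Bn.
    by have [pT pl _ _] := QE p Qp; have [H2 _] := Hn _ _ pT pl; apply: le_trans (ler_norm _) H2.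
  - exact: wc true.
have a2' : {ae leb2 R, forall p, Q p -> - pcomp true (eta p.1 p.2) <= Hb}.
  have [LN wN] := neg true.
  apply: (weak_limit_le mQ Q_lty (fk := fun n p => - pcomp true (etas n p.1 p.2)) (M := Hb + l)) => //.
  - exact: (L2aff _ `|Hb|).
  - move: near_bounds (bounded true); apply: filterS2 => n Hn Bn p Qp.
    split; last by rewrite normrN; exact: Bn.
    by have [pT pl _ _] := QE p Qp; have [H2 _] := Hn _ _ pT pl; apply: le_trans (ler_norm _) _; rewrite normrN.
have m2 : measurable_fun setT (fun p : measurableTypeR R * measurableTypeR R => p.2) by exact: measurable_snd.
have a1 : {ae leb2 R, forall p, Q p -> pcomp false (eta p.1 p.2) <= l - k * (l - p.2)}.
  apply: (weak_limit_le mQ Q_lty (fk := fun n p => pcomp false (etas n p.1 p.2)) (M := Hb + l)).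
  - exact: Leta.
  - apply: (L2aff _ (l + k * l)).
      by apply: measurable_funB => //; apply: measurable_funM => //; exact: measurable_funB.
    move=> p /QE[_ /andP[p0 pl] _ _]; rewrite ler_norml.
    have : 0 <= k * (l - p.2) by apply: kge; rewrite subr_ge0.
    have := kge _ p0.
    by real_lra.
  - move: near_bounds (bounded false); apply: filterS2 => n Hn Bn p Qp; split; last exact: Bn.
    by have [pT pl _ _] := QE p Qp; have [_ /andP[]] := Hn _ _ pT pl.
  - exact: wc false.
have a1' : {ae leb2 R, forall p, Q p -> - pcomp false (eta p.1 p.2) <= - (k * p.2)}.
  have [LN wN] := neg false.
  apply: (weak_limit_le mQ Q_lty (fk := fun n p => - pcomp false (etas n p.1 p.2)) (M := Hb + l)) => //.
  - apply: (L2aff _ (k * l)).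
      by apply: measurableT_comp => //; exact: measurable_funM.
    move=> p /QE[_ /andP[p0 pl] _ _]; rewrite normrN ger0_norm ?kge//.
    by rewrite ler_wpM2l// ltW.
  - move: near_bounds (bounded false); apply: filterS2 => n Hn Bn p Qp.
    split; last by rewrite normrN; exact: Bn.
    by have [pT pl _ _] := QE p Qp; have [_ /andP[H1 _]] := Hn _ _ pT pl; rewrite lerN2.
have b2 : {ae leb2 R, forall p, Q p -> `|(eta p.1 p.2).2| <= Hb}.
  by apply: (aeS2 _ a2 a2') => p h2 h2' Qp; rewrite ler_norml lerNl h2'// h2.
have b1 : {ae leb2 R, forall p, Q p -> k * p.2 <= (eta p.1 p.2).1 <= l - k * (l - p.2)}.
  by apply: (aeS2 _ a1 a1') => p h1 h1' Qp; rewrite h1// andbT -lerN2 h1'.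
apply: (aeS2 _ b1 b2) => p h1 h2 pT pl.
have Qp : Q p by split; rewrite /= in_itv.
by split; [exact: h2|exact: (confined_not_bd k0 Hbl pl (h2 Qp) (h1 Qp))].
Qed.
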